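(* Let $X\in\mathcal{V}$ be a homogeneous quadratic planar vector field. Then $X$ is $C^\infty$-regularisable if and only if, after an invertible real linear change of the coordinates $(x,y)$, it takes the canonical form $$X=\left(\kappa x^2-y^2,\ (\kappa+1)xy\right),$$ where $\kappa<0$ is the unique characteristic value of $X$. If, instead, $X$ is linearly equivalent to $\left(\kappa_1x^2+\kappa_2xy-y^2,\ (\kappa_1+1)xy+\kappa_2y^2\right)$ with $\kappa_1<0$ and $\kappa_2\neq0$, then $X$ is $C^{0,1}$-regularisable.
   Context: A homogeneous quadratic vector field $X=(P,Q)$ ($P,Q$ real homogeneous polynomials of degree 2) belongs to $\mathcal{V}$ if the origin is an isolated zero of $X$ and all real projective roots of the directional polynomial $xQ(x,y)-yP(x,y)$ (the characteristic directions) have multiplicity one. An invertible linear map $T$ acts on vector fields by $(T\cdot X)(z)=T\,X(T^{-1}z)$. The characteristic value attached to a characteristic direction $\hat y^*=y/x$ is the ratio of the two eigenvalues at $(0,\hat y^* )$ of the desingularised blow-up $\hat X=(\hat xP(1,\hat y),\,p(\hat y))$, $p(\hat y)=Q(1,\hat y)-\hat yP(1,\hat y)$; here it is taken as $P(1,\hat y^* )/p'(\hat y^* )$. Regularisability: let $\varphi$ be the flow of $X$ and $I$ the origin. For a compact smooth 2-dimensional submanifold with boundary $N$, $n=\partial N$, put $n^+=\{p\in n:\exists t>0,\varphi(p,(-t,0))\cap N=\emptyset\}$, $n^-=\{p\in n:\exists t>0,\varphi(p,(0,t))\cap N=\emptyset\}$, $\tau=\{p\in n: X\text{ tangent to }n\text{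 at }p\}$, $a^+=\{p\in n^+:\varphi(p,t)\in N\ \forall t\ge0\}$, $a^-=\{p\in n^-:\varphi(p,t)\in N\ \forall t\le0\}$. $N$ is an isolating block for $I$ if $I$ is the maximal invariant set in $N$, $n^+\cap n^-=\tau$ and $\tau$ is a smooth codimension-one submanifold of $n$. Let $\pi:n^+\setminus a^+\to n^-\setminus a^-$ send $p$ to the exit point of its forward orbit from $N$. $X$ is $C^k$-regularisable if $\pi$ has a unique $C^k$ extension $\overline\pi:n^+\to n^-$ (the block map), and similarly for other classes; $C^{0,1}$ denotes Lipschitz maps. For a $C^0$-regularisable $X\in\mathcal V$ (exactly one ingoing and one outgoing asymptotic orbit), the differentiability of $\overline\pi$ is studied as the germ, at the point of the ingoing asymptotic orbit, of the transition map from a smooth section transverse to the ingoing asymptotic orbit to a smooth section transverse to the outgoing one; the result does not depend on the choice of sections. *)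

(* Defs.v *)
From mathcomp Require Import all_boot all_order all_algebra.
From mathcomp Require Import all_classical all_reals all_analysis.
Set Implicit Arguments.
Unset Strict Implicit.
Unset Printing Implicit Defensive.
Import Order.TTheory GRing.Theory Num.Theory numFieldNormedType.Exports.
Local Open Scope classical_set_scope.
Local Open Scope ring_scope.

Notation plane R := (R * R)%type.

(** ** Homogeneous quadratic vector fields *)

Definition quadratic_form {R : realType} (P : plane R -> R) : Prop :=
  exists a b c : R, forall x y, P (x, y) = a * x ^+ 2 + b * x * y + c * y ^+ 2.

Definition quadratic_field {R : realType} (X : plane R -> plane R) : Prop :=
  quadratic_form (fun z => (X z).1) /\ quadratic_form (fun z => (X z).2).

(* x Q - y P; since R is infinite, this binary cubic form is identified with
   the function it defines. *)
Definition directional_poly {R : realType} (X : plane R -> plane R) (x y : R) : R :=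
  x * (X (x, y)).2 - y * (X (x, y)).1.

(* [u : v] is a root of multiplicity at least 2 when (v x - u y)^2 divides the
   cubic form; the identically zero form is therefore excluded. *)
Definition simple_directions {R : realType} (X : plane R -> plane R) : Prop :=
  forall u v : R, (u, v) <> (0, 0) -> directional_poly X u v = 0 ->
  ~ exists a b : R, forall x y : R,
      directional_poly X x y = (v * x - u * y) ^+ 2 * (a * x + b * y).

Definition class_V {R : realType} (X : plane R -> plane R) : Prop :=
  [/\ quadratic_field X,
      \forall z \near (0 : plane R), X z = 0 -> z = 0
    & simple_directions X].

(* Y is T . X for some invertible linear map T, with inverse T'. *)
Definition linearly_equivalent {R : realType} (X Y : plane R -> plane R) : Prop :=
  exists T T' : {linear plane R -> plane R},
    [/\ cancel T T', cancel T' T & forall z, Y z = T (X (T' z))].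

(* The first disjunct is the blow-up chart y = yhat * x.  The second one is the
   chart x = xhat * y, used for the vertical direction xhat = 0 only; on a
   direction seen by both charts the two ratios agree. *)
Definition characteristic_value {R : realType} (X : plane R -> plane R) (k : R) : Prop :=
  (exists y : R,
     let p := fun t => (X (1, t)).2 - t * (X (1, t)).1 in
     p y = 0 /\ k = (X (1, y)).1 / derive1 p y) \/
  (let q := fun t => (X (t, 1)).1 - t * (X (t, 1)).2 in
     q 0 = 0 /\ k = (X (0, 1)).2 / derive1 q 0).

(** ** Smoothness *)

Fixpoint Ck_on {R : realType} {V W : normedModType R} (k : nat) (U : set V)
    (f : V -> W) : Prop :=
  match k with
  | 0 => forall x, U x -> {for x, continuous f}
  | k'.+1 => (forall x, U x -> differentiable f x) /\
             (forall v : V, Ck_on k' U ('D_v f))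
  end.

Definition smooth_on {R : realType} {V W : normedModType R} (U : set V)
    (f : V -> W) : Prop := forall k, Ck_on k U f.

Definition smooth_germ {R : realType} (D : R -> R) : Prop :=
  exists2 U : set R, open_nbhs (0 : R) U & smooth_on U D.

Definition lipschitz_germ {R : realType} (D : R -> R) : Prop :=
  exists2 U : set R, nbhs (0 : R) U & [lipschitz D x | x in U].

(** ** Smooth planar domains *)

(* A slice chart of N at p: a diffeomorphism between open sets sending p to the
   origin and N to the upper half-plane. *)
Record boundary_chart {R : realType} (N : set (plane R)) (p : plane R) :=
  BoundaryChart {
    chart_dom : set (plane R);
    chart_cod : set (plane R);
    chart :> plane R -> plane R;
    chart_inv : plane R -> plane R;
    chart_dom_open : open chart_dom;
    chart_cod_open : open chart_cod;
    chart_smooth : smooth_on chart_dom chart;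
    chart_inv_smooth : smooth_on chart_cod chart_inv;
    chartK : forall z, chart_dom z ->
      chart_cod (chart z) /\ chart_inv (chart z) = z;
    chart_invK : forall w, chart_cod w ->
      chart_dom (chart_inv w) /\ chart (chart_inv w) = w;
    chart_center : chart_dom p /\ chart p = 0;
    chart_slice : forall z, chart_dom z -> (N z <-> 0 <= (chart z).2)
  }.

Definition smooth_domain {R : realType} (N : set (plane R)) : Prop :=
  forall p, N p -> N° p \/ inhabited (boundary_chart N p).

Definition bd {R : realType} (N : set (plane R)) : set (plane R) := N `\` N°.

(** ** Flow, isolating blocks and block maps *)

(* flow X p t q: the maximal solution of z' = X z issued from p is defined at
   time t (of either sign), and equals q there.  A partial flow is needed, as
   quadratic fields are in general not complete. *)
Definition flow {R : realType} (X : plane R -> plane R) (p : plane R) (t : R)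
    (q : plane R) : Prop :=
  exists c : R -> plane R,
    [/\ c 0 = p, c t = q
      & forall s : R, Num.min 0 t <= s <= Num.max 0 t ->
          is_derive s (1 : R) c (X (c s))].

Definition flow_in {R : realType} (X : plane R -> plane R) (N : set (plane R))
    (p : plane R) (t : R) : Prop := exists2 q, flow X p t q & N q.

Definition n_in {R : realType} (X : plane R -> plane R) (N : set (plane R)) :
    set (plane R) :=
  [set p | bd N p /\
    exists2 t : R, 0 < t & forall s, - t < s < 0 -> ~ flow_in X N p s].

Definition n_out {R : realType} (X : plane R -> plane R) (N : set (plane R)) :
    set (plane R) :=
  [set p | bd N p /\
    exists2 t : R, 0 < t & forall s, 0 < s < t -> ~ flow_in X N p s].

(* X p is in the kernel of the differential of a local equation of bd N. *)
Definition tangency {R : realType} (X : plane R -> plane R) (N : set (plane R)) :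
    set (plane R) :=
  [set p | bd N p /\
    exists c : boundary_chart N p, ('D_(X p) (c : plane R -> plane R) p).2 = 0].

Definition a_in {R : realType} (X : plane R -> plane R) (N : set (plane R)) :
    set (plane R) :=
  [set p | n_in X N p /\ forall t : R, 0 <= t -> flow_in X N p t].

Definition a_out {R : realType} (X : plane R -> plane R) (N : set (plane R)) :
    set (plane R) :=
  [set p | n_out X N p /\ forall t : R, t <= 0 -> flow_in X N p t].

(* The invariant set is the origin.  A codimension-one submanifold of the curve
   bd N is a 0-dimensional one, that is, a set of isolated points. *)
Definition isolating_block {R : realType} (X : plane R -> plane R)
    (N : set (plane R)) : Prop :=
  [/\ compact N,
      smooth_domain N,
      [set p | forall t : R, flow_in X N p t] = [set 0],
      n_in X N `&` n_out X N = tangency X N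
    & forall p, tangency X N p ->
        exists2 U, nbhs p U & tangency X N `&` U = [set p]].

(* q is the point where the forward orbit of p exits N; at a tangency, q = p. *)
Definition exit_point {R : realType} (X : plane R -> plane R) (N : set (plane R))
    (p q : plane R) : Prop :=
  exists t : R,
    [/\ 0 <= t, flow X p t q, forall s, 0 <= s <= t -> flow_in X N p s
      & n_out X N q].

(* f restricts to a continuous map n_in -> n_out extending the transition map
   n_in \ a_in -> n_out \ a_out; its values off n_in are irrelevant. *)
Definition block_extension {R : realType} (X : plane R -> plane R)
    (N : set (plane R)) (f : plane R -> plane R) : Prop :=
  [/\ forall p, n_in X N p -> n_out X N (f p),
      forall p, (n_in X N `\` a_in X N) p -> exit_point X N p (f p)
    & {within n_in X N, continuous f}].

(* At a point p of a_in, bd N is transverse to X, so that n_in and n_out are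
   smooth sections near p and f p; s |-> c^-1 (s, 0) and the first coordinate
   of d are local parameters on them. *)
Definition transition_germ {R : realType} (C : (R -> R) -> Prop)
    (N : set (plane R)) (f : plane R -> plane R) (p : plane R) : Prop :=
  exists (c : boundary_chart N p) (d : boundary_chart N (f p)),
    C (fun s => (d (f (chart_inv c (s, 0)))).1).

(* The class C is imposed on the germ of the block map at the ingoing asymptotic
   orbit. With C := fun=> True, this is C^0-regularisability. *)
Definition regularisable {R : realType} (C : (R -> R) -> Prop)
    (X : plane R -> plane R) : Prop :=
  exists2 N, isolating_block X N &
  exists f : plane R -> plane R,
    [/\ block_extension X N f,
        forall g, block_extension X N g -> forall p, n_in X N p -> g p = f p
      & forall p, a_in X N p -> transition_germ C N f p].

(* Main.v *)
(** Up to linear equivalence a field of class V has a characteristic direction on the axis [y = 0],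
    and the other two are either complex or real. This leaves two normal forms, [focus_saddle k m] and
    [triple_saddle a b], with directional polynomials [y (x^2 + y^2)] and [x y (x - y)].

    If a characteristic value is positive, then a whole neighbourhood of some entrance point is
    asymptotic to the origin, and the extension of the block map can be deformed there: it is not
    unique. If the three characteristic values of [triple_saddle a b] are negative, then the first
    integral of the orbits shows that those entering close to the half-axis [x > 0] leave near two
    different half-lines, according to their side: the block map has no continuous extension.

    For [focus_saddle k m] the orbits are [r = C (sin theta)^k exp (m theta)] in either half plane. If
    [k < 0] the two one-sided derivatives of the block map at the entrance point thus have the ratio
    [exp (+- 2 pi m / k)], and smoothness requires [m = 0]. Conversely the unit disc is then an
    isolating block: since [x P + y Q = (k x + m y) (x^2 + y^2)], the line [k x + m y = 0] separates
    entrance from exit points. The equation of the orbits gives its block map, which is Lipschitz at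
    the entrance point, and is [(x, y) |-> (- x, y)] if [m = 0]. *)

From HB Require Import structures.
Require Import Defs.
From mathcomp Require Import all_boot all_order all_algebra.
From mathcomp Require Import all_classical all_reals all_analysis.
From mathcomp Require Import ring lra.
Set Implicit Arguments.
Unset Strict Implicit.
Unset Printing Implicit Defensive.
Import Order.TTheory GRing.Theory Num.Theory numFieldNormedType.Exports.
Local Open Scope classical_set_scope.
Local Open Scope ring_scope.

(** * Calculus of functions of one real variable *)

(** The flow is defined through solution curves, so uniqueness and existence of orbits both have to
    be established. Uniqueness is Gronwall's inequality for a squared distance; existence always
    comes from an explicit curve tangent to the field, run through at the right speed ([reparam]).
    In the negative results the block is arbitrary, and orbits entering near the half-axis need
    longer and longer to pass the origin, so no limit of orbits is taken. Two anchors remain: the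
    segment from the origin to the entrance point, which contains no exit point, and a first
    integral, which compares the two ends of an orbit. For [focus_saddle], with [al = - 1 / k], it
    gives the limit of the ratio of the heights at exit and entry, with a factor [exp (m al pi)]
    above the axis and [exp (- m al pi)] below, [pi] being the angle swept. In the positive result
    the circle is parametrised by the tangent of half the angle. The exit arc is opposite to the
    entrance arc, so that the block map, followed by the central symmetry, is a self-map of one
    interval fixing 0; the charts of the disc are chosen to read off exactly this self-map. *)

Section Calculus.
Context {R : realType}.
Implicit Types (f g : R -> R) (x s t : R).

(** The rules below act on explicit lambda terms, so that derivatives are computed by nesting them;
    this lemma then replaces the raw function and the raw value by the intended ones. *)
Lemma derive_ext x f g (df dg : R) : is_derive x (1 : R) f df -> f =1 g -> df = dg ->
  is_derive x (1 : R) g dg.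
Proof. by move=> h /funext <- <-. Qed.

Lemma derive_const x (c : R) : is_derive x (1 : R) (fun=> c) 0.
Proof. exact: is_derive_cst. Qed.

Lemma derive_var x : is_derive x (1 : R) (fun y : R => y) 1.
Proof. exact: is_derive_id. Qed.

Lemma derive_add x f g (df dg : R) : is_derive x (1 : R) f df -> is_derive x (1 : R) g dg ->
  is_derive x (1 : R) (fun y => f y + g y) (df + dg).
Proof. by move=> hf hg; apply: is_deriveD. Qed.

Lemma derive_sub x f g (df dg : R) : is_derive x (1 : R) f df -> is_derive x (1 : R) g dg ->
  is_derive x (1 : R) (fun y => f y - g y) (df - dg).
Proof. by move=> hf hg; apply: is_deriveB. Qed.

Lemma derive_opp x f (df : R) : is_derive x (1 : R) f df ->
  is_derive x (1 : R) (fun y => - f y) (- df).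
Proof. by move=> hf; apply: is_deriveN. Qed.

Lemma derive_mul x f g (df dg : R) : is_derive x (1 : R) f df -> is_derive x (1 : R) g dg ->
  is_derive x (1 : R) (fun y => f y * g y) (f x * dg + g x * df).
Proof. by move=> hf hg; apply: is_deriveM. Qed.

Lemma derive_exp x f n (df : R) : is_derive x (1 : R) f df ->
  is_derive x (1 : R) (fun y => f y ^+ n) (n%:R * f x ^+ n.-1 * df).
Proof.
move=> hf; elim: n => [|n IH].
  apply: (derive_ext (derive_const x 1)) => [y|]; first by rewrite expr0.
  by rewrite !mul0r.
apply: (derive_ext (derive_mul hf IH)) => [y|]; first by rewrite exprS.
case: n {IH} => [|n]; first by rewrite /= !expr0; ring.
by rewrite /= -[n.+2%:R]natr1 exprS; ring.
Qed.

Lemma derive_inv x f (df : R) : f x != 0 -> is_derive x (1 : R) f df ->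
  is_derive x (1 : R) (fun y => (f y)^-1) (- (f x) ^- 2 * df).
Proof. by move=> h hf; apply: is_deriveV. Qed.

Lemma derive_expR x f (df : R) : is_derive x (1 : R) f df ->
  is_derive x (1 : R) (fun y => expR (f y)) (expR (f x) * df).
Proof. by move=> hf; apply: is_derive1_comp. Qed.

Lemma derive_ln x f (df : R) : 0 < f x -> is_derive x (1 : R) f df ->
  is_derive x (1 : R) (fun y => ln (f y)) ((f x)^-1 * df).
Proof. by move=> h hf; apply: is_derive1_comp; apply: is_derive1_ln. Qed.

Lemma derive_atan x f (df : R) : is_derive x (1 : R) f df ->
  is_derive x (1 : R) (fun y => atan (f y)) ((1 + f x ^+ 2)^-1 * df).
Proof. by move=> hf; apply: is_derive1_comp. Qed.

Lemma derive_comp x f g (df dg : R) : is_derive (g x) (1 : R) f df -> is_derive x (1 : R) g dg ->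
  is_derive x (1 : R) (fun y => f (g y)) (df * dg).
Proof. by move=> hf hg; apply: is_derive1_comp. Qed.

Lemma derive_cont x f (df : R) : is_derive x (1 : R) f df -> {for x, continuous f}.
Proof. by move=> [h _]; apply/differentiable_continuous/derivable1_diffP. Qed.

Lemma within_cont_derive (a b : R) f (df : R -> R) :
  (forall s, a <= s <= b -> is_derive s (1 : R) f (df s)) ->
  {within `[a, b], continuous f}.
Proof.
move=> h; apply: continuous_in_subspaceT => x; rewrite inE /= in_itv /= => xab.
exact: derive_cont (h _ xab).
Qed.

Lemma MVT_cc (a b : R) f (df : R -> R) : a <= b ->
  (forall s, a <= s <= b -> is_derive s (1 : R) f (df s)) ->
  exists2 c, a <= c <= b & f b - f a = df c * (b - a).
Proof.
move=> ab h; have [||c] := @MVT_segment R f df a b ab.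
- by move=> x; rewrite in_itv /= => /andP[xa xb]; apply: h; rewrite !ltW.
- exact: within_cont_derive h.
- by rewrite in_itv /= => cab fE; exists c.
Qed.

Lemma derive_ge0_le (a b : R) f (df : R -> R) : a <= b ->
  (forall s, a <= s <= b -> is_derive s (1 : R) f (df s)) ->
  (forall s, a <= s <= b -> 0 <= df s) -> f a <= f b.
Proof.
move=> ab h hp; have [c cab E] := MVT_cc ab h.
by rewrite -subr_ge0 E mulr_ge0 ?hp ?subr_ge0.
Qed.

Lemma derive_gt0_lt (a b : R) f (df : R -> R) : a < b ->
  (forall s, a <= s <= b -> is_derive s (1 : R) f (df s)) ->
  (forall s, a <= s <= b -> 0 < df s) -> f a < f b.
Proof.
move=> ab h hp; have [c cab E] := MVT_cc (ltW ab) h.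
by rewrite -subr_gt0 E mulr_gt0 ?hp ?subr_gt0.
Qed.

Lemma derive0_eq (a b : R) f (df : R -> R) : a <= b ->
  (forall s, a <= s <= b -> is_derive s (1 : R) f (df s)) ->
  (forall s, a <= s <= b -> df s = 0) -> f a = f b.
Proof.
move=> ab h hp; have [c cab E] := MVT_cc ab h.
by apply/eqP; rewrite eq_sym -subr_eq0 E hp// mul0r.
Qed.

(** The product of [f] and [expR (- L * (s - a))] is non-increasing. No sign is imposed on [f],
    which allows the opposite of a square in [sign_preserved]. *)
Lemma gronwall (a b L : R) f (df : R -> R) : a <= b ->
  (forall s, a <= s <= b -> is_derive s (1 : R) f (df s)) ->
  (forall s, a <= s <= b -> df s <= L * f s) ->
  f b <= f a * expR (L * (b - a)).
Proof.
move=> ab h hp.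
pose g y := - (f y * expR (- L * (y - a))).
have : g a <= g b.
  apply: (@derive_ge0_le a b g
    (fun s => - (f s * (expR (- L * (s - a)) * - L) + expR (- L * (s - a)) * df s))) => //.
    move=> s sab; apply/derive_opp/derive_mul; first exact: h.
    apply: derive_expR.
    apply: (derive_ext (derive_mul (derive_const _ (- L)) (derive_sub (derive_var _) (derive_const _ a)))) => //.
    by ring.
  move=> s sab; have e0 : 0 <= expR (- L * (s - a)) by exact: expR_ge0.
  have := hp _ sab; nra.
rewrite /g subrr mulr0 expR0 mulr1 lerN2 => H.
have e0 : 0 < expR (L * (b - a)) by exact: expR_gt0.
have := ler_wpM2r (ltW e0) H.
by rewrite -mulrA -expRD mulNr addNr expR0 mulr1.
Qed.

Lemma bounded_on_segment (a b : R) f : a <= b -> {within `[a, b], continuous f} ->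
  exists2 M : R, 0 < M & forall s : R, a <= s <= b -> `|f s| <= M.
Proof.
move=> ab fc; have [c1 _ h1] := EVT_max ab fc; have [c2 _ h2] := EVT_min ab fc.
exists (1 + `|f c1| + `|f c2|).
  by rewrite -addrA ltr_pwDl// addr_ge0.
move=> s sab; have sI : s \in `[a, b] by rewrite in_itv.
have := h1 _ sI; have := h2 _ sI; move=> A B.
have := ler_norm (f c1); have := ler_norm (- f c2); rewrite normrN => C D.
have := normr_ge0 (f c1); have := normr_ge0 (f c2) => E F.
rewrite ler_norml; apply/andP; split; lra.
Qed.

Lemma derive_fst x (c : R -> plane R) (v : plane R) : is_derive x (1 : R) c v ->
  is_derive x (1 : R) (fun s => (c s).1) v.1.
Proof.
move=> [cd cv]; have H : h^-1 *: ((c \o shift x) (h *: 1) - c x) @[h --> 0^'] --> v.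
  by rewrite -cv; exact: cd.
have H1 := cvg_comp _ fst H (cvg_fst (F:=nbhs v.1) (G:=nbhs v.2)).
have H2 : h^-1 *: (((fun s => (c s).1) \o shift x) (h *: 1) - (c x).1) @[h --> 0^'] --> v.1.
  exact: H1.
by split; [apply/cvg_ex; exists v.1|apply: cvg_lim].
Qed.

Lemma derive_snd x (c : R -> plane R) (v : plane R) : is_derive x (1 : R) c v ->
  is_derive x (1 : R) (fun s => (c s).2) v.2.
Proof.
move=> [cd cv]; have H : h^-1 *: ((c \o shift x) (h *: 1) - c x) @[h --> 0^'] --> v.
  by rewrite -cv; exact: cd.
have H1 := cvg_comp _ snd H (cvg_snd (F:=nbhs v.1) (G:=nbhs v.2)).
have H2 : h^-1 *: (((fun s => (c s).2) \o shift x) (h *: 1) - (c x).2) @[h --> 0^'] --> v.2.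
  exact: H1.
by split; [apply/cvg_ex; exists v.2|apply: cvg_lim].
Qed.

Lemma derive_pair x f g (df dg : R) : is_derive x (1 : R) f df -> is_derive x (1 : R) g dg ->
  is_derive x (1 : R) (fun s => (f s, g s)) ((df, dg) : plane R).
Proof.
move=> [fd fv] [gd gv].
have Hf : h^-1 *: ((f \o shift x) (h *: 1) - f x) @[h --> 0^'] --> df.
  by rewrite -fv; exact: fd.
have Hg : h^-1 *: ((g \o shift x) (h *: 1) - g x) @[h --> 0^'] --> dg.
  by rewrite -gv; exact: gd.
have H := cvg_pair Hf Hg.
have H2 : h^-1 *: (((fun s => (f s, g s)) \o shift x) (h *: 1) - (f x, g x)) @[h --> 0^'] --> ((df, dg) : plane R).
  exact: H.
by split; [apply/cvg_ex; exists (df, dg)|apply: cvg_lim].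
Qed.

(** A quadratic field is even, so reversing time together with the central symmetry maps solutions
    to solutions. Statements on negative times are reduced to positive ones in this way. *)
Lemma derive_reverse x (c : R -> plane R) (v : plane R) : is_derive (- x) (1 : R) c v ->
  is_derive x (1 : R) (fun u => - c (- u)) v.
Proof.
move=> hc.
have dN : is_derive x (1 : R) (fun u => - u) (-1) by apply: derive_opp; apply: derive_var.
have := derive_pair (derive_opp (derive_comp (g := -%R) (derive_fst hc) dN))
                    (derive_opp (derive_comp (g := -%R) (derive_snd hc) dN)).
rewrite !mulrN1 !opprK -surjective_pairing.
suff -> : (fun u => - c (- u)) = (fun u => (- (c (- u)).1, - (c (- u)).2)) by [].
by apply/funext => u; case: (c (- u)).
Qed.

End Calculus.

(** * Solutions and flows of quadratic fields *)

Section Flow.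
Context {R : realType}.
Implicit Types (X : plane R -> plane R) (N : set (plane R)) (c : R -> plane R).

(** Induction along an interval, through the supremum of the times up to which [P] holds. It serves
    bounds whose proof at a given time needs them at all earlier times. *)
Lemma real_induction (t : R) (P : R -> Prop) : P 0 ->
  (forall s : R, 0 <= s <= t -> P s ->
     exists2 e, 0 < e & forall u, s <= u < s + e -> u <= t -> P u) ->
  (forall s : R, 0 < s <= t -> (forall u : R, 0 <= u < s -> P u) -> P s) ->
  forall s : R, 0 <= s <= t -> P s.
Proof.
move=> P0 Popen Pclosed.
have [t0|t0] := leP 0 t; last by move=> s /andP[s0 st]; have := le_lt_trans (le_trans s0 st) t0; rewrite ltxx.
pose A := [set s | 0 <= s <= t /\ forall u : R, 0 <= u <= s -> P u].
have A0 : A 0.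
  split; first by rewrite lexx.
  by move=> u u0; have -> : u = 0 by apply/eqP; rewrite eq_le andbC.
have hA : has_sup A.
  by split; [exists 0|exists t => s [/andP[]]].
set m := sup A.
have m0 : 0 <= m by apply: sup_upper_bound.
have mt : m <= t by apply: sup_le_ub; [exists 0|move=> s [/andP[]]].
have Plt u : 0 <= u < m -> P u.
  move=> /andP[u0 um]; have /(sup_adherent)/(_ hA)[s [_ Ps] us] : 0 < m - u by rewrite subr_gt0.
  apply: Ps; rewrite u0 /= ltW//.
  by move: us; rewrite -/m opprB addrC subrK.
have Pm : P m.
  have [m0'|] := ltP 0 m; first by apply: Pclosed => //; rewrite m0'.
  by move=> m0'; have -> : m = 0 by apply/eqP; rewrite eq_le m0'.
have Ple u : 0 <= u <= m -> P u.
  by move=> /andP[u0]; rewrite le_eqVlt => /predU1P[->//|um]; apply: Plt; rewrite u0.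
suff mE : m = t by move=> s; rewrite -mE; exact: Ple.
apply/eqP; rewrite eq_le mt /= leNgt; apply/negP => mlt.
have [|e e0 He] := Popen m _ Pm; first by rewrite m0.
pose v := Num.min (m + e / 2) t.
have vm : m < v by rewrite lt_min mlt ltrDl divr_gt0.
have : v <= m.
  apply: sup_upper_bound => //; split.
    by rewrite (le_trans m0 (ltW vm)) ge_min lexx orbT.
  move=> u /andP[u0 uv]; have [um|um] := leP u m; first by apply: Ple; rewrite u0.
  move: uv; rewrite le_min => /andP[uv1 uv2].
  apply: He => //; rewrite (ltW um) /=; apply: le_lt_trans uv1 _.
  by rewrite ltrD2l ltr_pdivrMr// ltr_pMr// ltr1n.
by rewrite leNgt vm.
Qed.

Lemma quadratic_fieldP X : quadratic_field X -> exists a b d a' b' d' : R,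
  forall z, X z = (a * z.1 ^+ 2 + b * z.1 * z.2 + d * z.2 ^+ 2,
                   a' * z.1 ^+ 2 + b' * z.1 * z.2 + d' * z.2 ^+ 2).
Proof.
move=> [[a [b [d h]]] [a' [b' [d' h']]]]; exists a, b, d, a', b', d' => -[x y].
by rewrite -h -h'; case: (X _).
Qed.

Lemma quadratic_even X : quadratic_field X -> forall z, X (- z) = X z.
Proof.
move=> /quadratic_fieldP[a [b [d [a' [b' [d' h]]]]]] z; rewrite !h /=.
by congr (_, _); ring.
Qed.

Lemma orbit_cont X c s : is_derive s (1 : R) c (X (c s)) -> {for s, continuous c}.
Proof. by move=> [h _]; apply/differentiable_continuous/derivable1_diffP. Qed.

Lemma quadratic_form_bound (K al be ga de p q : R) :
  `|al| <= K -> `|be| <= K -> `|ga| <= K -> `|de| <= K ->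
  2 * (p ^+ 2 * al + p * q * be + p * q * ga + q ^+ 2 * de) <= 4 * K * (p ^+ 2 + q ^+ 2).
Proof.
rewrite !ler_norml => /andP[_ k1] /andP[k2 k2'] /andP[k3 k3'] /andP[_ k4].
have e1 : p ^+ 2 * al <= p ^+ 2 * K by apply: ler_wpM2l; rewrite // sqr_ge0.
have e4 : q ^+ 2 * de <= q ^+ 2 * K by apply: ler_wpM2l; rewrite // sqr_ge0.
have cross r : - K <= r -> r <= K -> 2 * (p * q * r) <= K * (p ^+ 2 + q ^+ 2).
  move=> r1 r2.
  have a1 : 0 <= (p + q) ^+ 2 * (K - r) by rewrite mulr_ge0 ?sqr_ge0 ?subr_ge0.
  have a2 : 0 <= (p - q) ^+ 2 * (r + K) by rewrite mulr_ge0 ?sqr_ge0// -lerBlDr sub0r.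
  by move: a1 a2; clear; lra.
have c1 := cross _ k2 k2'; have c2 := cross _ k3 k3'.
by move: e1 e4 c1 c2; clear; lra.
Qed.

(** The squared distance [w] of two solutions satisfies [w' <= 4 K w], where [K] comes from a bound
    of both curves on the segment; it vanishes at 0, so Gronwall's inequality makes it vanish
    throughout. *)
Lemma ode_unique X c1 c2 (t : R) : quadratic_field X ->
  (forall s : R, 0 <= s <= t -> is_derive s (1 : R) c1 (X (c1 s))) ->
  (forall s : R, 0 <= s <= t -> is_derive s (1 : R) c2 (X (c2 s))) ->
  c1 0 = c2 0 -> forall s : R, 0 <= s <= t -> c1 s = c2 s.
Proof.
move=> /quadratic_fieldP[a [b [d [a' [b' [d' h]]]]]] h1 h2 E s /andP[s0 st].
pose x1 u := (c1 u).1; pose y1 u := (c1 u).2.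
pose x2 u := (c2 u).1; pose y2 u := (c2 u).2.
have le_st u : 0 <= u <= s -> 0 <= u <= t by move=> /andP[-> us]; apply: le_trans us st.
have dx1 u : 0 <= u <= s -> is_derive u (1 : R) x1 (X (c1 u)).1.
  by move=> /le_st us; apply: derive_fst; apply: h1.
have dy1 u : 0 <= u <= s -> is_derive u (1 : R) y1 (X (c1 u)).2.
  by move=> /le_st us; apply: derive_snd; apply: h1.
have dx2 u : 0 <= u <= s -> is_derive u (1 : R) x2 (X (c2 u)).1.
  by move=> /le_st us; apply: derive_fst; apply: h2.
have dy2 u : 0 <= u <= s -> is_derive u (1 : R) y2 (X (c2 u)).2.
  by move=> /le_st us; apply: derive_snd; apply: h2.
have [M1 M10 B1] := bounded_on_segment s0 (within_cont_derive dx1).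
have [M2 M20 B2] := bounded_on_segment s0 (within_cont_derive dy1).
have [M3 M30 B3] := bounded_on_segment s0 (within_cont_derive dx2).
have [M4 M40 B4] := bounded_on_segment s0 (within_cont_derive dy2).
pose M := M1 + M2 + M3 + M4.
pose A := `|a| + `|b| + `|d| + `|a'| + `|b'| + `|d'|.
pose K := A * M.
have bnd p q r x y : `|p| <= A -> `|q| <= A -> `|x| + `|y| <= r -> r <= M ->
    `|p * x + q * y| <= K.
  move=> pA qA xyr rM; apply: le_trans (ler_normD _ _) _; rewrite !normrM.
  apply: (@le_trans _ _ (A * `|x| + A * `|y|)).
    by apply: lerD; apply: ler_wpM2r.
  rewrite -mulrDr; apply: ler_wpM2l; first exact: le_trans pA.
  exact: le_trans rM.
have aA : [/\ `|a| <= A, `|b| <= A, `|d| <= A & [/\ `|a'| <= A, `|b'| <= A & `|d'| <= A]].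
  have := normr_ge0 a; have := normr_ge0 b; have := normr_ge0 d.
  have := normr_ge0 a'; have := normr_ge0 b'; have := normr_ge0 d'.
  rewrite /A; clear; move=> *; split; [lra|lra|lra|split; lra].
move: aA => [aA bA dA [a'A b'A d'A]].
pose w u := (x1 u - x2 u) ^+ 2 + (y1 u - y2 u) ^+ 2.
pose dw u := 2 * (x1 u - x2 u) * ((X (c1 u)).1 - (X (c2 u)).1)
           + 2 * (y1 u - y2 u) * ((X (c1 u)).2 - (X (c2 u)).2).
have dwP u : 0 <= u <= s -> is_derive u (1 : R) w (dw u).
  move=> us; apply: (derive_ext (derive_add
    (derive_exp 2 (derive_sub (dx1 _ us) (dx2 _ us)))
    (derive_exp 2 (derive_sub (dy1 _ us) (dy2 _ us))))) => //=.
have w0 : w 0 = 0 by rewrite /w /x1 /x2 /y1 /y2 E !subrr !expr0n addr0.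
have : w s <= w 0 * expR (4 * K * (s - 0)).
  apply: (gronwall s0 dwP) => u us.
  have := B1 _ us; have := B2 _ us; have := B3 _ us; have := B4 _ us.
  rewrite /dw /w !h /= -/(x1 u) -/(x2 u) -/(y1 u) -/(y2 u).
  move: (x1 u) (x2 u) (y1 u) (y2 u) => X1 X2 Y1 Y2 H4 H3 H2 H1.
  have N12 := ler_normD X1 X2; have N34 := ler_normD Y1 Y2.
  have [k1 k2] : `|a * (X1 + X2) + b * Y1| <= K /\ `|b * X2 + d * (Y1 + Y2)| <= K.
    by split; apply: (@bnd _ _ M) => //; rewrite /M; move: M10 M20 M30 M40 H1 H2 H3 H4 N12 N34; clear; lra.
  have [k3 k4] : `|a' * (X1 + X2) + b' * Y1| <= K /\ `|b' * X2 + d' * (Y1 + Y2)| <= K.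
    by split; apply: (@bnd _ _ M) => //; rewrite /M; move: M10 M20 M30 M40 H1 H2 H3 H4 N12 N34; clear; lra.
  (* A difference of values of a quadratic map is linear in the difference of the arguments, with
     coefficients bounded by [K]. *)
  have -> : 2 * (X1 - X2) * (a * X1 ^+ 2 + b * X1 * Y1 + d * Y1 ^+ 2
         - (a * X2 ^+ 2 + b * X2 * Y2 + d * Y2 ^+ 2)) +
      2 * (Y1 - Y2) * (a' * X1 ^+ 2 + b' * X1 * Y1 + d' * Y1 ^+ 2
         - (a' * X2 ^+ 2 + b' * X2 * Y2 + d' * Y2 ^+ 2)) =
     2 * ((X1 - X2) ^+ 2 * (a * (X1 + X2) + b * Y1)
         + (X1 - X2) * (Y1 - Y2) * (b * X2 + d * (Y1 + Y2))
         + (X1 - X2) * (Y1 - Y2) * (a' * (X1 + X2) + b' * Y1)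
         + (Y1 - Y2) ^+ 2 * (b' * X2 + d' * (Y1 + Y2))) by ring.
  exact: quadratic_form_bound.
rewrite w0 mul0r => ws0.
have X0 := sqr_ge0 (x1 s - x2 s); have Y0 := sqr_ge0 (y1 s - y2 s).
have /eqP : (x1 s - x2 s) ^+ 2 = 0 by move: ws0 X0 Y0; rewrite /w; clear; lra.
have /eqP : (y1 s - y2 s) ^+ 2 = 0 by move: ws0 X0 Y0; rewrite /w; clear; lra.
rewrite !sqrf_eq0 !subr_eq0 => /eqP Ey /eqP Ex.
by move: Ex Ey; rewrite /x1 /x2 /y1 /y2; case: (c1 s) (c2 s) => ? ? [? ?] /= -> ->.
Qed.

Lemma flow_forward X p (t : R) q : 0 <= t -> flow X p t q <->
  exists c, [/\ c 0 = p, c t = q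
    & forall s : R, 0 <= s <= t -> is_derive s (1 : R) c (X (c s))].
Proof. by move=> t0; rewrite /flow min_l// max_r. Qed.

Lemma flow_opp X p (t : R) q : quadratic_field X -> flow X p t q -> flow X (- p) (- t) (- q).
Proof.
move=> hX [c [c0 ct hc]].
exists (fun s => - c (- s)); split; rewrite ?oppr0 ?opprK ?c0 ?ct// => s hs.
have /hc cs : Num.min 0 t <= - s <= Num.max 0 t.
  move: hs; rewrite -[X in Num.min X _]oppr0 -[X in Num.max X _]oppr0 -oppr_max -oppr_min.
  by move=> /andP[h1 h2]; rewrite lerNr h2 lerNl h1.
rewrite (quadratic_even hX); exact: derive_reverse.
Qed.

Lemma flow_unique X p (t : R) q q' : quadratic_field X -> flow X p t q -> flow X p t q' -> q = q'.
Proof.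
move=> hX; wlog t0 : p t q q' / 0 <= t.
  move=> H; have [|t0] := leP 0 t; first exact: H.
  move=> /(flow_opp hX) h1 /(flow_opp hX) h2.
  by apply: oppr_inj; apply: H h1 h2; rewrite oppr_ge0 ltW.
move=> /flow_forward-/(_ t0)[c1 [c10 <- h1]] /flow_forward-/(_ t0)[c2 [c20 <- h2]].
by apply: (ode_unique hX h1 h2); rewrite ?c10 ?c20// t0 lexx.
Qed.


(** Shrinking the interval makes [f] continuous on a compact segment, hence integrable; the integral
    from [a'] is then differentiable inside. *)
Lemma antiderivative (a b a' b' : R) (f : R -> R) : a < a' -> b' < b ->
  (forall x, a < x < b -> {for x, continuous f}) ->
  exists F : R -> R, forall x, a' < x < b' -> is_derive x (1 : R) F (f x).
Proof.
move=> aa' b'b fc.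
have fi : lebesgue_measure.-integrable `[a', b'] (EFin \o f).
  apply: continuous_compact_integrable; first exact: segment_compact.
  apply: continuous_in_subspaceT => x; rewrite inE /= in_itv /= => /andP[x1 x2].
  by apply: fc; rewrite (lt_le_trans aa' x1) (le_lt_trans x2 b'b).
exists (fun x : R => (\int[lebesgue_measure]_(t in [set` `[a', x]]) (f t))%R).
move=> x /andP[x1 x2].
have [|D E] := @continuous_FTC1_closed R f a' x b' x2 fi x1.
  by apply: fc; rewrite (lt_trans aa' x1) (lt_trans x2 b'b).
by split; [exact: D|rewrite -derive1E E].
Qed.

(** If [X] is [om] times the velocity of a curve, the time elapsed along the curve is an
    antiderivative [F] of [1 / om]. The solution is the curve composed with the inverse of [F],
    whose derivative is [om]. *)
Lemma reparam X (z1 z2 dz1 dz2 om : R -> R) (a b th0 th1 : R) :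
  a < th0 -> th0 <= th1 -> th1 < b ->
  (forall th, a < th < b -> is_derive th (1 : R) z1 (dz1 th)) ->
  (forall th, a < th < b -> is_derive th (1 : R) z2 (dz2 th)) ->
  (forall th, a < th < b -> {for th, continuous om}) ->
  (forall th, a < th < b -> 0 < om th) ->
  (forall th, a < th < b -> X (z1 th, z2 th) = (om th * dz1 th, om th * dz2 th)) ->
  exists (T : R) (c : R -> plane R),
    [/\ 0 <= T, c 0 = (z1 th0, z2 th0), c T = (z1 th1, z2 th1),
        forall s : R, 0 <= s <= T -> is_derive s (1 : R) c (X (c s)) &
        forall s : R, 0 <= s <= T -> exists th,
          [/\ th0 <= th <= th1, c s = (z1 th, z2 th),
              0 < s -> th0 < th & s < T -> th < th1]].
Proof.
move=> a0 h01 b1 d1 d2 omc om0 XE.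
pose a' := (a + th0) / 2; pose b' := (b + th1) / 2.
have aa' : a < a' by rewrite /a'; move: a0; clear; lra.
have a'0 : a' < th0 by rewrite /a'; move: a0; clear; lra.
have b'b : b' < b by rewrite /b'; move: b1; clear; lra.
have b1' : th1 < b' by rewrite /b'; move: b1; clear; lra.
pose f th := (om th)^-1.
have fc th : a < th < b -> {for th, continuous f}.
  move=> hth; apply: continuousV; last exact: omc.
  by rewrite gt_eqF// om0.
have [F dF] := antiderivative aa' b'b fc.
have f0 x : a' < x < b' -> 0 < f x.
  by move=> /andP[x1 x2]; rewrite invr_gt0; apply: om0; rewrite (lt_trans aa' x1) (lt_trans x2 b'b).
have Flt x y : a' < x -> x < y -> y < b' -> F x < F y.
  move=> x1 xy y1; apply: (derive_gt0_lt xy) => s /andP[s1 s2].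
    by apply: dF; rewrite (lt_le_trans x1 s1) (le_lt_trans s2 y1).
  by apply: f0; rewrite (lt_le_trans x1 s1) (le_lt_trans s2 y1).
have Finj x y : a' < x < b' -> a' < y < b' -> F x = F y -> x = y.
  move=> /andP[x1 x2] /andP[y1 y2] E; case: (ltgtP x y) => // h.
    by have := Flt _ _ x1 h y2; rewrite E ltxx.
  by have := Flt _ _ y1 h x2; rewrite E ltxx.
(* The inverse of [F]; the default [th0] is never reached at the values of [F] on the interval. *)
pose G y := xget th0 [set th | a' < th < b' /\ F th = y].
have GK th : a' < th < b' -> G (F th) = th.
  move=> hth; rewrite /G; case: xgetP => [y _ [y1 y2]|/(_ th)]; first exact: Finj.
  by case.
have dG th : a' < th < b' -> is_derive (F th) (1 : R) G (om th).
  move=> hth; have -> : om th = (f th)^-1 by rewrite /f invrK.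
  have nb : \forall x \near th, a' < x < b'.
    move: hth => /andP[h1 h2]; near=> x; apply/andP; split; near: x.
      exact: lt_nbhsr.
    exact: lt_nbhsl.
  apply: is_derive_inverse.
  - by near=> x; apply: GK; near: x.
  - by near=> x; apply: (@derive_cont _ _ _ (f x)); apply: dF; near: x.
  - exact: dF.
  - by rewrite gt_eqF// f0.
have h0 : a' < th0 < b' by rewrite a'0 (le_lt_trans h01 b1').
have h1 : a' < th1 < b' by rewrite (lt_le_trans a'0 h01) b1'.
have T0 : 0 <= F th1 - F th0.
  rewrite subr_ge0; move: h01; rewrite le_eqVlt => /predU1P[->//|h].
  by apply/ltW/Flt.
exists (F th1 - F th0), (fun s => (z1 (G (s + F th0)), z2 (G (s + F th0)))).
have pick s : 0 <= s <= F th1 - F th0 -> exists2 th, th0 <= th <= th1 & F th = s + F th0.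
  move=> /andP[s0 s1].
  have [||th] := @IVT R F th0 th1 (s + F th0) h01.
  - apply: (@within_cont_derive _ _ _ _ f) => x /andP[x1 x2]; apply: dF.
    by rewrite (lt_le_trans a'0 x1) (le_lt_trans x2 b1').
  - have T0' : F th0 <= F th1 by rewrite -subr_ge0.
    by rewrite (min_idPl T0') (max_idPr T0') lerDr s0 -lerBrDr.
  - by rewrite in_itv /= => ? <-; exists th.
have in_ab th : th0 <= th <= th1 -> a' < th < b'.
  by move=> /andP[x1 x2]; rewrite (lt_le_trans a'0 x1) (le_lt_trans x2 b1').
split => //.
- by rewrite add0r GK.
- by rewrite subrK GK.
- move=> s /pick[th hth E].
  have hab := in_ab _ hth.
  have hab2 : a < th < b.
    by move: hab => /andP[x1 x2]; rewrite (lt_trans aa' x1) (lt_trans x2 b'b).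
  have dsh : is_derive s (1 : R) (fun u => u + F th0) 1.
    by apply: (derive_ext (derive_add (derive_var s) (derive_const s (F th0)))); rewrite ?addr0.
  have dGs : is_derive (s + F th0) (1 : R) G (om th) by rewrite -E; apply: dG.
  have GE : G (s + F th0) = th by rewrite -E GK.
  have dd1 : is_derive (G (s + F th0)) (1 : R) z1 (dz1 th) by rewrite GE; apply: d1.
  have dd2 : is_derive (G (s + F th0)) (1 : R) z2 (dz2 th) by rewrite GE; apply: d2.
  have dg := derive_comp (g := fun u => u + F th0) dGs dsh.
  rewrite GE XE//.
  pose Gs u := G (u + F th0).
  have := derive_pair (derive_comp (g := Gs) dd1 dg) (derive_comp (g := Gs) dd2 dg).
  by rewrite !mulr1 ![om th * _]mulrC.
- move=> s hs; have [th hth E] := pick _ hs; have hab := in_ab _ hth.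
  exists th; split => //.
  + by rewrite -E GK.
  + move=> s0; rewrite ltNge; apply/negP => hle.
    have tE : th = th0 by apply/eqP; rewrite eq_le hle; case/andP: hth.
    by move: E s0; rewrite tE => /(congr1 (fun v => v - F th0)); rewrite subrr addrK => <-; rewrite ltxx.
  + move=> s0; rewrite ltNge; apply/negP => hle.
    have tE : th = th1 by apply/eqP; rewrite eq_le hle andbT; case/andP: hth.
    by move: E s0; rewrite tE => ->; rewrite addrK ltxx.
Unshelve. all: by end_near.
Qed.

End Flow.

(** * Short-time behaviour of orbits *)

Section Local.
Context {R : realType}.
Implicit Types (X : plane R -> plane R) (N O : set (plane R)) (c : R -> plane R).

Lemma MVT_oo (a b : R) (f : R -> R) (df : R -> R) : a < b ->
  (forall s : R, a <= s <= b -> is_derive s (1 : R) f (df s)) ->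
  exists2 c : R, a < c < b & f b - f a = df c * (b - a).
Proof.
move=> ab h; have [||c] := @MVT R f df a b ab.
- by move=> x; rewrite in_itv /= => /andP[xa xb]; apply: h; rewrite !ltW.
- exact: within_cont_derive h.
- by rewrite in_itv /= => cab fE; exists c.
Qed.

Lemma cont_near (T U : topologicalType) (f : T -> U) x (A : set U) :
  {for x, continuous f} -> nbhs (f x) A -> \forall y \near x, A (f y).
Proof. by move=> fc /fc. Qed.

Lemma nbhs_box O (p : plane R) : nbhs p O -> exists2 r : R, 0 < r &
  forall z : plane R, `|z.1 - p.1| < r -> `|z.2 - p.2| < r -> O z.
Proof.
move=> /nbhs_ballP[r /= r0 rO]; exists r => // z h1 h2; apply: rO.
by split; rewrite /ball /= distrC.
Qed.

Lemma box_nbhs (p : plane R) (r : R) : 0 < r ->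
  nbhs p [set z : plane R | `|z.1 - p.1| < r /\ `|z.2 - p.2| < r].
Proof.
move=> r0; apply/nbhs_ballP; exists r => //= z [h1 h2].
by split; rewrite distrC.
Qed.

Lemma quadratic_bounded X (p : plane R) (r : R) : quadratic_field X ->
  exists2 M : R, 0 < M & forall z : plane R, `|z.1 - p.1| < r -> `|z.2 - p.2| < r ->
     `|(X z).1| <= M /\ `|(X z).2| <= M.
Proof.
move=> /quadratic_fieldP[a [b [d [a' [b' [d' h]]]]]].
pose B := `|p.1| + `|p.2| + `|r|.
have B0 : 0 <= B by rewrite !addr_ge0.
have bound (u v w : R) (z : plane R) : `|z.1| <= B -> `|z.2| <= B ->
    `|u * z.1 ^+ 2 + v * z.1 * z.2 + w * z.2 ^+ 2| <= (`|u| + `|v| + `|w|) * B ^+ 2.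
  move=> z1 z2; rewrite !expr2 -mulrA; apply: (le_trans (ler_normD _ _)).
  rewrite mulrDl; apply: lerD; last first.
    by rewrite !normrM; apply: ler_wpM2l => //; apply: ler_pM.
  apply: (le_trans (ler_normD _ _)); rewrite mulrDl; apply: lerD.
    by rewrite !normrM; apply: ler_wpM2l => //; apply: ler_pM.
  by rewrite !normrM; apply: ler_wpM2l => //; apply: ler_pM.
pose A := (`|a| + `|b| + `|d|) + (`|a'| + `|b'| + `|d'|).
exists (A * B ^+ 2 + 1).
  by rewrite ltr_wpDl// mulr_ge0 ?sqr_ge0// !addr_ge0.
move=> z z1 z2; have near0 (x y : R) : `|x - y| < r -> `|x| <= `|y| + `|r|.
  move=> xy; rewrite -{1}(subrK y x) addrC; apply: (le_trans (ler_normD _ _)).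
  by rewrite lerD2l; apply/ltW/(lt_le_trans xy)/ler_norm.
have Z1 : `|z.1| <= B by apply: (le_trans (near0 _ _ z1)); rewrite /B lerD2r lerDl.
have Z2 : `|z.2| <= B by apply: (le_trans (near0 _ _ z2)); rewrite /B lerD2r lerDr.
rewrite h /=; split.
  apply: (le_trans (bound _ _ _ _ Z1 Z2)); rewrite -[leLHS]addr0; apply: lerD => //.
  by apply: ler_wpM2r; rewrite ?sqr_ge0// /A lerDl !addr_ge0.
apply: (le_trans (bound _ _ _ _ Z1 Z2)); rewrite -[leLHS]addr0; apply: lerD => //.
by apply: ler_wpM2r; rewrite ?sqr_ge0// /A lerDr !addr_ge0.
Qed.

Lemma quadratic_continuous X : quadratic_field X -> continuous X.
Proof.
move=> /quadratic_fieldP[a [b [d [a' [b' [d' h]]]]]] z.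
have poly (u v w : R) : {for z, continuous (fun z : plane R =>
    u * z.1 ^+ 2 + v * z.1 * z.2 + w * z.2 ^+ 2)}.
  have c1 : fst y @[y --> z] --> z.1 by exact: cvg_fst.
  have c2 : snd y @[y --> z] --> z.2 by exact: cvg_snd.
  apply: cvgD; last by apply: cvgM; [exact: cvg_cst|exact: cvgM].
  apply: cvgD; first by apply: cvgM; [exact: cvg_cst|exact: cvgM].
  by apply: cvgM => //; apply: cvgM => //; exact: cvg_cst.
have -> : X = fun z => (a * z.1 ^+ 2 + b * z.1 * z.2 + d * z.2 ^+ 2,
                   a' * z.1 ^+ 2 + b' * z.1 * z.2 + d' * z.2 ^+ 2) by apply/funext.
exact: cvg_pair (poly a b d) (poly a' b' d').
Qed.

(** If [M] bounds the speed in a box of half-width [r], the box cannot be left before the time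
    [r / M]. Real induction is needed because the speed is bounded only as long as the orbit is in
    the box. The time is common to all solutions issued from [p]. *)
Lemma orbit_stays_near X (p : plane R) O : quadratic_field X -> nbhs p O ->
  exists2 e : R, 0 < e & forall (t : R) c, t < e -> c 0 = p ->
    (forall s : R, 0 <= s <= t -> is_derive s (1 : R) c (X (c s))) ->
    forall s : R, 0 <= s <= t -> O (c s).
Proof.
move=> hX /nbhs_box[r r0 rO].
have [M M0 hM] := quadratic_bounded p r hX.
exists (r / M); first by rewrite divr_gt0.
move=> t c te c0 hc.
suff H : forall s : R, 0 <= s <= t -> `|(c s).1 - p.1| < r /\ `|(c s).2 - p.2| < r.
  by move=> s /H[]; exact: rO.
have fst_lt (f df : R -> R) (s : R) : 0 < s <= t ->
   (forall u : R, 0 <= u <= s -> is_derive u (1 : R) f (df u)) ->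
   (forall u : R, 0 <= u < s -> `|df u| <= M) -> `|f s - f 0| < r.
  move=> /andP[s0 st] hd hb; have [x /andP[x0 xs] ->] := MVT_oo s0 hd.
  rewrite normrM subr0 (gtr0_norm s0); apply: (@le_lt_trans _ _ (M * s)).
    by apply: ler_wpM2r; [exact: ltW|apply: hb; rewrite ltW].
  rewrite mulrC; apply: (le_lt_trans _ (_ : t * M < r)); first by rewrite ler_wpM2r// ltW.
  by rewrite -ltr_pdivlMr.
apply: real_induction.
- by rewrite c0 !subrr normr0.
- move=> s st [s1 s2].
  have cs := orbit_cont (hc _ st).
  have : \forall u \near s, `|(c u).1 - p.1| < r /\ `|(c u).2 - p.2| < r.
    have : nbhs (c s) [set z : plane R | `|z.1 - p.1| < r /\ `|z.2 - p.2| < r].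
      have e0 : 0 < Num.min (r - `|(c s).1 - p.1|) (r - `|(c s).2 - p.2|).
        by rewrite lt_min !subr_gt0 s1.
      apply: filterS (box_nbhs (c s) e0) => z [].
      rewrite !lt_min => /andP[z1 _] /andP[_ z2]; split.
        rewrite -(subrK (c s).1 z.1) -addrA; apply: (le_lt_trans (ler_normD _ _)).
        by rewrite -ltrBrDr.
      rewrite -(subrK (c s).2 z.2) -addrA; apply: (le_lt_trans (ler_normD _ _)).
      by rewrite -ltrBrDr.
    by move=> /cs.
  move=> /nbhs_ballP[e /= e0 He]; exists e => // u /andP[su us] _.
  apply: He; rewrite /ball /= distrC ger0_norm ?subr_ge0//.
  by rewrite ltrBlDl.
- move=> s s0t IH; have /andP[s0 st] := s0t.
  have dc u : 0 <= u <= s -> is_derive u (1 : R) c (X (c u)).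
    by move=> /andP[u0 us]; apply: hc; rewrite u0 (le_trans us st).
  rewrite -c0; split.
    apply: (fst_lt (fun u => (c u).1) (fun u => (X (c u)).1)) => // u us.
      by apply: derive_fst; apply: dc.
    by have [h1 h2] := IH _ us; have [] := hM _ h1 h2.
  apply: (fst_lt (fun u => (c u).2) (fun u => (X (c u)).2)) => // u us.
    by apply: derive_snd; apply: dc.
  by have [h1 h2] := IH _ us; have [] := hM _ h1 h2.
Qed.

(** [W] is the derivative of [g] along [X], tested on solution curves so that heights in a chart and
    polynomials are treated alike. *)
Definition lie_derivative X O (g W : plane R -> R) := forall c (s : R), O (c s) ->
  is_derive s (1 : R) c (X (c s)) -> is_derive s (1 : R) (fun u => g (c u)) (W (c s)).

Lemma decreasing_forward X (p : plane R) O g W : quadratic_field X -> nbhs p O ->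
  lie_derivative X O g W -> (forall z, O z -> W z < 0) ->
  exists2 e : R, 0 < e & forall t q, 0 < t < e -> flow X p t q -> O q /\ g q < g p.
Proof.
move=> hX pO gW W0; have [e e0 he] := orbit_stays_near hX pO.
exists e => // t q /andP[t0 te] /(flow_forward _ _ _ (ltW t0))[c [c0 ct hc]].
have Oc := he _ _ te c0 hc; rewrite -ct.
split; first by apply: Oc; rewrite (ltW t0) lexx.
rewrite -c0 -ltrN2.
apply: (derive_gt0_lt t0 (f := fun u => - g (c u)) (df := fun u => - W (c u))) => s hs.
  by apply: derive_opp; apply: gW; [exact: Oc|exact: hc].
by rewrite oppr_gt0; apply: W0; apply: Oc.
Qed.

Lemma nbhs_oppE (p : plane R) O : nbhs p O -> nbhs (- p) [set z | O (- z)].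
Proof.
move=> h; have : nbhs (- - p) O by rewrite opprK.
by move=> /(@oppr_continuous _ _ (- p)).
Qed.

Lemma lie_derivative_opp X O g W : quadratic_field X -> lie_derivative X O g W ->
  lie_derivative X [set z | O (- z)] (fun z => g (- z)) (fun z => - W (- z)).
Proof.
move=> hX gW c s Os hc.
pose c' u := - c (- u).
have hc' : is_derive (- s) (1 : R) c' (X (c' (- s))).
  rewrite /c' opprK (quadratic_even hX); apply: derive_reverse.
  by rewrite opprK.
have Os' : O (c' (- s)) by rewrite /c' opprK.
have H := gW c' (- s) Os' hc'; rewrite /c' opprK in H.
have dN : is_derive s (1 : R) (fun u => - u) (-1) by apply: derive_opp; apply: derive_var.
apply: (derive_ext (derive_comp (g := -%R) H dN)) => [u|]; first by rewrite opprK.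
by rewrite mulrN1.
Qed.

Lemma increasing_backward X (p : plane R) O g W : quadratic_field X -> nbhs p O ->
  lie_derivative X O g W -> (forall z, O z -> 0 < W z) ->
  exists2 e : R, 0 < e & forall t q, - e < t < 0 -> flow X p t q -> O q /\ g q < g p.
Proof.
move=> hX pO gW W0.
have [|e e0 he] := decreasing_forward hX (nbhs_oppE pO) (lie_derivative_opp hX gW).
  by move=> z /= /W0; rewrite oppr_lt0.
exists e => // t q /andP[t0 te] /(flow_opp hX) fl.
by have := he (- t) (- q); rewrite oppr_gt0 te ltrNl t0 => /(_ isT fl) /=; rewrite !opprK.
Qed.

End Local.

(** * Boundary charts *)

Section Charts.
Context {R : realType}.
Implicit Types (X : plane R -> plane R) (N O : set (plane R)) (c : R -> plane R).

Notation e1 := ((1, 0) : plane R).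
Notation e2 := ((0, 1) : plane R).

Lemma smooth_diff (V W : normedModType R) (U : set V) (f : V -> W) x :
  smooth_on U f -> U x -> differentiable f x.
Proof. by move=> /(_ 1%N) [h _] /h. Qed.

Lemma smooth_cont (V W : normedModType R) (U : set V) (f : V -> W) x :
  smooth_on U f -> U x -> {for x, continuous f}.
Proof. by move=> /(_ 0%N) h /h. Qed.

Lemma smooth_derive (V W : normedModType R) (U : set V) (f : V -> W) v :
  smooth_on U f -> smooth_on U ('D_v f).
Proof. by move=> h k; have [_] := h k.+1; apply. Qed.

Lemma plane_basis (v : plane R) : v = v.1 *: e1 + v.2 *: e2.
Proof.
case: v => a b; rewrite /GRing.scale /GRing.add /= /add_pair /scale_pair /=.
by congr (_, _); rewrite /GRing.scale /= !(mulr0, mulr1, addr0, add0r).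
Qed.

Lemma derive_plane (W : normedModType R) (f : plane R -> W) z v : differentiable f z ->
  'D_v f z = v.1 *: 'D_e1 f z + v.2 *: 'D_e2 f z.
Proof.
move=> df; rewrite !deriveE// [in LHS](plane_basis v).
by rewrite linearD !linearZ.
Qed.

Lemma derive_along (W : normedModType R) (f : plane R -> W) c (s : R) v :
  differentiable f (c s) -> is_derive s (1 : R) c v ->
  is_derive s (1 : R) (fun u => f (c u)) ('D_v f (c s)).
Proof.
move=> df [cd cv].
have cdiff : differentiable c s by apply/derivable1_diffP.
have fcd : differentiable (f \o c) s by apply: differentiable_comp.
split; first by apply: diff_derivable.
by rewrite -[LHS]/('D_1 (f \o c) s) deriveE// diff_comp//= -[X in 'd f _ X]deriveE// cv deriveE.
Qed.

Section Chart.
Variables (N : set (plane R)) (p0 : plane R) (d : boundary_chart N p0).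
Notation D := (chart_dom d).

Lemma chart_diff z : D z -> differentiable (d : plane R -> plane R) z.
Proof. exact: smooth_diff (chart_smooth d). Qed.

Lemma chart_cont z : D z -> {for z, continuous (d : plane R -> plane R)}.
Proof. exact: smooth_cont (chart_smooth d). Qed.

Lemma chart_dom_nbhs z : D z -> nbhs z D.
Proof. by move=> Dz; apply: open_nbhs_nbhs; split => //; apply: chart_dom_open. Qed.

Lemma chart_cod_nbhs w : chart_cod d w -> nbhs w (chart_cod d).
Proof. by move=> Dz; apply: open_nbhs_nbhs; split => //; apply: chart_cod_open. Qed.

(** The rate of change of the height above the boundary along [X]: on the boundary, a positive value
    means that [X] points into [N], a negative one that it points out. *)
Definition chart_speed X z : R := ('D_(X z) (d : plane R -> plane R) z).2.

Lemma chart_speed_lie X : lie_derivative X D (fun z => (d z).2) (chart_speed X).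
Proof.
move=> c s Dc hc; apply: derive_snd.
by apply: derive_along => //; apply: chart_diff.
Qed.

Lemma chart_speed_cont X z : quadratic_field X -> D z -> {for z, continuous (chart_speed X)}.
Proof.
move=> hX Dz.
have hE : {near z, (fun w => (X w).1 * ('D_e1 (d : plane R -> plane R) w).2 +
                             (X w).2 * ('D_e2 (d : plane R -> plane R) w).2) =1 chart_speed X}.
  near=> w; rewrite /chart_speed [in RHS]derive_plane//.
  by apply: chart_diff; near: w; apply: chart_dom_nbhs.
have c1 : {for z, continuous ('D_e1 (d : plane R -> plane R))}.
  exact: smooth_cont (smooth_derive e1 (chart_smooth d)) Dz.
have c2 : {for z, continuous ('D_e2 (d : plane R -> plane R))}.
  exact: smooth_cont (smooth_derive e2 (chart_smooth d)) Dz.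
have Xc : continuous X by exact: quadratic_continuous.
apply/(cvg_trans (near_eq_cvg hE)); rewrite -(nbhs_singleton hE).
apply: cvgD; apply: cvgM.
- by apply: (cvg_comp _ fst (Xc z)); apply: cvg_fst.
- by apply: (cvg_comp _ snd c1); apply: cvg_snd.
- by apply: (cvg_comp _ snd (Xc z)); apply: cvg_snd.
- by apply: (cvg_comp _ snd c2); apply: cvg_snd.
Unshelve. all: by end_near.
Qed.

(** A positive height persists nearby, so such points are interior. At height 0, lowering the image
    in the chart by [r / 2] and pulling it back yields points outside [N] arbitrarily close. *)
Lemma chart_bd z : D z -> (bd N z <-> (d z).2 = 0).
Proof.
move=> Dz; split.
  move=> [Nz nint]; apply/eqP; rewrite eq_le; apply/andP; split; last by apply/(chart_slice Dz).
  rewrite leNgt; apply/negP => dz; apply: nint.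
  have : nbhs (d z) [set w : plane R | 0 < w.2].
    apply: filterS (box_nbhs (d z) dz) => w [_ w2] /=.
    by move: w2; rewrite ltr_norml => /andP[+ _]; rewrite -subr_gt0 opprK subrK.
  move=> /(chart_cont Dz); rewrite /interior /= nbhs_filterE => h.
  apply: filterS (filterI (h : nbhs z [set w | 0 < (d w).2]) (chart_dom_nbhs Dz)) => w [/= w2 Dw].
  by apply/(chart_slice Dw)/ltW.
move=> dz0; have Nz : N z by apply/(chart_slice Dz); rewrite dz0.
split => // zint.
have [cdz dK] := chartK Dz.
have ci : {for d z, continuous (chart_inv d)} by exact: smooth_cont (chart_inv_smooth d) cdz.
have : nbhs (chart_inv d (d z)) N by rewrite dK.
move=> /ci h.
have h' : nbhs (d z) ([set w | N (chart_inv d w)] `&` chart_cod d).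
  by apply: filterI => //; exact: chart_cod_nbhs.
have [r r0 rP] := nbhs_box h'.
have [||/= Nw cw] := rP ((d z).1, (d z).2 - r / 2).
- by rewrite /= subrr normr0.
- rewrite /= addrAC subrr add0r normrN gtr0_norm ?divr_gt0//.
  by rewrite ltr_pdivrMr// ltr_pMr// ltr1n.
have [Dw dwK] := chart_invK cw.
have := (chart_slice Dw).1 Nw; rewrite dwK /= dz0 sub0r.
by rewrite oppr_ge0 leNgt divr_gt0.
Qed.

Lemma n_out_of_speed X z : quadratic_field X -> D z -> (d z).2 = 0 ->
  chart_speed X z < 0 -> n_out X N z.
Proof.
move=> hX Dz dz Vz; split; first exact/chart_bd.
have nb : nbhs z [set w | D w /\ chart_speed X w < 0].
  apply: filterI; first exact: chart_dom_nbhs.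
  have : nbhs (chart_speed X z) [set r : R | r < 0] by exact: lt_nbhsl.
  by move=> /(chart_speed_cont hX Dz).
have [||e e0 he] := decreasing_forward hX nb (g := fun z => (d z).2) (W := chart_speed X).
- by move=> c s [? ?]; apply: chart_speed_lie.
- by move=> w [].
exists e => // s hs [q /he-/(_ hs)[[Dq _]]]; rewrite dz => dq Nq.
by have := (chart_slice Dq).1 Nq; rewrite leNgt dq.
Qed.

Lemma n_in_of_speed X z : quadratic_field X -> D z -> (d z).2 = 0 ->
  0 < chart_speed X z -> n_in X N z.
Proof.
move=> hX Dz dz Vz; split; first exact/chart_bd.
have nb : nbhs z [set w | D w /\ 0 < chart_speed X w].
  apply: filterI; first exact: chart_dom_nbhs.
  have : nbhs (chart_speed X z) [set r : R | 0 < r] by exact: lt_nbhsr.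
  by move=> /(chart_speed_cont hX Dz).
have [||e e0 he] := increasing_backward hX nb (g := fun z => (d z).2) (W := chart_speed X).
- by move=> c s [? ?]; apply: chart_speed_lie.
- by move=> w [].
exists e => // s hs [q /he-/(_ hs)[[Dq _]]]; rewrite dz => dq Nq.
by have := (chart_slice Dq).1 Nq; rewrite leNgt dq.
Qed.

Definition chart_curve (s : R) : plane R := chart_inv d (s, 0).

Lemma chart_curve0 : chart_curve 0 = p0.
Proof.
have [D0 d0] := chart_center d; have [_ K] := chartK D0.
by rewrite /chart_curve -[RHS]K d0.
Qed.

Lemma chart_cod0 : chart_cod d ((0, 0) : plane R).
Proof.
have [D0 d0] := chart_center d; have [K _] := chartK D0.
by rewrite d0 in K.
Qed.

Lemma chart_curve_near : \forall s \near (0 : R),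
  [/\ chart_cod d (s, 0), D (chart_curve s), d (chart_curve s) = (s, 0) & bd N (chart_curve s)].
Proof.
have /nbhs_box[r r0 rP] := chart_cod_nbhs chart_cod0.
apply/nbhs_ballP; exists r => //= s; rewrite /ball /= sub0r normrN => sr.
have cs : chart_cod d (s, 0) by apply: rP; rewrite /= ?subr0 ?normr0.
have [Ds Ks] := chart_invK cs; split => //.
by apply/(chart_bd Ds); rewrite /chart_curve Ks.
Qed.

Lemma chart_curve_derive (s : R) : chart_cod d (s, 0) ->
  is_derive s (1 : R) chart_curve ('D_e1 (chart_inv d) (s, 0)).
Proof.
move=> cs; apply: (@derive_along _ _ (fun u => (u, 0))).
  exact: smooth_diff (chart_inv_smooth d) cs.
exact: (derive_pair (derive_var s) (derive_const s 0)).
Qed.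

Lemma chart_curve_cont (s : R) : chart_cod d (s, 0) -> {for s, continuous chart_curve}.
Proof.
by move=> /chart_curve_derive[h _]; apply/differentiable_continuous/derivable1_diffP.
Qed.

Lemma chart_curve_speed : 'D_('D_e1 (chart_inv d) (0, 0)) (d : plane R -> plane R) p0 = e1.
Proof.
have [D0 d0] := chart_center d.
have h := chart_curve_derive chart_cod0.
have : is_derive 0 (1 : R) (fun s => d (chart_curve s))
   ('D_('D_e1 (chart_inv d) (0, 0)) (d : plane R -> plane R) p0).
  rewrite -[X in 'D_ _ _ X]chart_curve0; apply: derive_along => //.
  by rewrite chart_curve0; exact: chart_diff.
have hE : {near 0, (fun s => d (chart_curve s)) =1 (fun s => (s, 0))}.
  by near=> s; have [] : [/\ chart_cod d (s, 0), D (chart_curve s),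
     d (chart_curve s) = (s, 0) & bd N (chart_curve s)] by near: s; exact: chart_curve_near.
move=> /(near_eq_is_derive hE) [_ <-].
have [_ ->] := derive_pair (derive_var (0 : R)) (derive_const (0 : R) (0 : R)).
by [].
Unshelve. all: by end_near.
Qed.

End Chart.
End Charts.

(** * Isolating blocks *)

Section Blocks.
Context {R : realType}.
Implicit Types (X f : plane R -> plane R) (N O : set (plane R)) (c : R -> plane R).

Notation e1 := ((1, 0) : plane R).

Lemma quadratic0 X : quadratic_field X -> X 0 = 0.
Proof.
move=> /quadratic_fieldP[a [b [d [a' [b' [d' h]]]]]].
by rewrite h /= !expr0n /= !mulr0 !addr0.
Qed.

Lemma flow_const0 X (t : R) : quadratic_field X -> flow X 0 t 0.
Proof.
move=> hX; exists (fun=> 0); split => // s _.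
by rewrite quadratic0//; apply: is_derive_cst.
Qed.

(** A boundary point where [X] vanishes is a tangency, hence would belong to [n_in]; but the
    constant orbit never is outside [N]. *)
Lemma origin_interior X N : quadratic_field X -> isolating_block X N -> N° 0.
Proof.
move=> hX [_ smN inv tan _].
have N0 : N 0.
  have : [set p | forall t : R, flow_in X N p t] 0 by rewrite inv.
  by move=> /(_ 0)[q /(flow_unique hX (flow_const0 0 hX)) <-].
have [//|[d]] := smN _ N0.
have [//|nN] := pselect (N° 0).
have : (n_in X N `&` n_out X N) 0.
  rewrite tan; split; first by split.
  by exists d; rewrite quadratic0// derive0.
move=> [[_ [t t0 h]] _]; exfalso; apply: (h (- t / 2)).
  by rewrite mulNr ltrNl opprK oppr_lt0 divr_gt0// ltr_pdivrMr// ltr_pMr// ltr1n.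
by exists 0 => //; exact: flow_const0.
Qed.

Lemma a_in_not_out X N p : a_in X N p -> ~ n_out X N p.
Proof.
move=> [_ h] [_ [t t0]] /(_ (t / 2)); apply; last by apply: h; rewrite ltW// divr_gt0.
by rewrite divr_gt0//= ltr_pdivrMr// ltr_pMr// ltr1n.
Qed.

(** A negative speed would make [p] an exit point, and a zero speed a tangency, which is again an
    exit point; an asymptotic orbit starts at neither. *)
Lemma a_in_speed X N p (d : boundary_chart N p) : quadratic_field X ->
  isolating_block X N -> a_in X N p -> 0 < chart_speed d X p.
Proof.
move=> hX [_ _ _ tan _] ap; have nout := a_in_not_out ap.
have bp : bd N p by case: ap => -[].
have Dp := (chart_center d).1.
case: (ltrgtP 0 (chart_speed d X p)) => // [Vn|V0].
  by exfalso; apply/nout/(n_out_of_speed hX Dp) => //; apply/chart_bd.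
exfalso; apply: nout.
suff : (n_in X N `&` n_out X N) p by case.
by rewrite tan; split => //; exists d.
Qed.

Lemma boundary_chart_exists X N p : isolating_block X N -> bd N p -> inhabited (boundary_chart N p).
Proof. by move=> [_ smN _ _ _] [Np nint]; case: (smN _ Np). Qed.

Lemma n_in_near_a_in X N p (d : boundary_chart N p) : quadratic_field X ->
  isolating_block X N -> a_in X N p ->
  \forall s \near (0 : R), n_in X N (chart_curve d s).
Proof.
move=> hX bl ap; have V0 := a_in_speed d hX bl ap.
have Dp := (chart_center d).1.
have cc := chart_curve_cont (chart_cod0 d).
have nb : \forall s \near (0 : R), 0 < chart_speed d X (chart_curve d s).
  have : nbhs (chart_speed d X p) [set r : R | 0 < r] by exact: lt_nbhsr.
  move=> /(chart_speed_cont hX Dp) H.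
  have H2 : nbhs (chart_curve d 0) [set w | 0 < chart_speed d X w].
    by rewrite chart_curve0; exact: H.
  exact: (cont_near cc H2).
near=> s; have [cs Ds ds _] : [/\ chart_cod d (s, 0), chart_dom d (chart_curve d s),
     d (chart_curve d s) = (s, 0) & bd N (chart_curve d s)] by near: s; exact: chart_curve_near.
apply: (n_in_of_speed hX Ds); first by rewrite ds.
by near: s.
Unshelve. all: by end_near.
Qed.

(** If the boundary were horizontal where [X] is, then [X] would be tangent to it. Thus the ordinate
    is a local parameter of the boundary at an entrance point on the axis. *)
Lemma chart_curve_transverse X N p (d : boundary_chart N p) :
  chart_speed d X p != 0 -> (X p).2 = 0 -> ('D_e1 (chart_inv d) (0, 0)).2 != 0.
Proof.
move=> V0 X2; apply/negP => /eqP w2.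
have Dp := chart_diff (chart_center d).1.
move: V0; rewrite /chart_speed derive_plane// X2 scale0r addr0 /= => V0.
have := chart_curve_speed d; rewrite derive_plane// w2 scale0r addr0.
case E : ('D_e1 d p) V0 => [u v] /=; rewrite /GRing.scale /= /GRing.scale /= => V0.
move=> /eqP; rewrite xpair_eqE mulf_eq0 => /andP[/eqP h1 /orP[] /eqP h2].
  by move: h1; rewrite h2 scale0r => /esym/eqP; rewrite oner_eq0.
by move: V0; rewrite (h2 : v = 0) mulr0 eqxx.
Qed.

Lemma derive_quotient (g : R -> R) (b : R) : is_derive 0 (1 : R) g b -> g 0 = 0 ->
  g s / s @[s --> 0^'] --> b.
Proof.
move=> [gd gv] g0; rewrite -gv.
have : h^-1 *: ((g \o shift 0) (h *: 1) - g 0) @[h --> 0^'] --> 'D_1 g 0 by exact: gd.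
apply: cvg_trans; apply: near_eq_cvg; near=> s.
by rewrite /= g0 subr0 addr0 /GRing.scale /= mulr1 mulrC.
Unshelve. all: by end_near.
Qed.

Lemma axis_flow X (a x0 t : R) : quadratic_field X -> X e1 = (a, 0) -> a < 0 -> 0 <= x0 -> 0 <= t ->
  flow X (x0, 0) t (x0 / (1 - a * x0 * t), 0).
Proof.
move=> hX Xe a0 x00 t0; apply/(flow_forward _ _ _ t0).
exists (fun s => (x0 / (1 - a * x0 * s), 0)); split => //.
  by rewrite mulr0 subr0 divr1.
move=> s /andP[s0 _].
have den : 0 < 1 - a * x0 * s.
  by rewrite subr_gt0 (le_lt_trans _ ltr01)// mulr_le0_ge0// mulr_le0_ge0// ltW.
have -> : X (x0 / (1 - a * x0 * s), 0) = (a * (x0 / (1 - a * x0 * s)) ^+ 2, 0).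
  move: Xe; move: hX => /quadratic_fieldP[A [B [C [A' [B' [C' h]]]]]]; rewrite !h /=.
  by rewrite !expr0n /= !expr1n !mulr0 !addr0 !mulr1 => -[-> ->]; rewrite mul0r.
apply: (derive_pair _ (derive_const s 0)).
apply: (derive_ext (derive_mul (derive_const s x0) (derive_inv _
  (derive_sub (derive_const s 1) (derive_mul (derive_const s (a * x0)) (derive_var s))))));
  rewrite ?gt_eqF//.
by field; rewrite gt_eqF.
Qed.

Lemma isolating_compact X N : isolating_block X N -> compact N.
Proof. by case. Qed.

Lemma isolating_closed X N : isolating_block X N -> closed N.
Proof. by move=> [cN _ _ _ _]; apply: compact_closed => //; exact: norm_hausdorff. Qed.

Lemma compact_box N : compact N -> exists2 M : R, 0 < M & forall z, N z -> `|z.1| <= M /\ `|z.2| <= M.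
Proof.
move=> cN; have /compact_bounded[M [Mr hM]] := cN.
exists (`|M| + 1); first by rewrite ltr_wpDl.
move=> z Nz; have : `|z| <= `|M| + 1.
  by apply: hM => //; apply: (le_lt_trans (ler_norm M)); rewrite ltrDl.
by rewrite prod_normE ge_max => /andP[].
Qed.

(* The point where the orbit along the half-axis enters the block for the last time. *)
Lemma entry_point X N (a : R) : quadratic_field X -> isolating_block X N -> X e1 = (a, 0) -> a < 0 ->
  exists xB : R, [/\ 0 < xB, a_in X N (xB, 0) &
    forall x : R, 0 < x <= xB -> ~ n_out X N (x, 0)].
Proof.
move=> hX bl Xe a0.
have N0 := origin_interior hX bl.
have [M M0 hM] := compact_box (isolating_compact bl).
(* The supremum of [A] is the end of the piece of the half-axis that starts at the origin and stays
   in [N]. *)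
pose A := [set x | 0 <= x /\ forall u : R, 0 <= u <= x -> N (u, 0)].
have /nbhs_box[r r0 rP] : nbhs (0 : plane R) N by [].
have Ar : A (r / 2).
  split; first by rewrite ltW// divr_gt0.
  move=> u /andP[u0 ur]; apply: rP; rewrite /= subr0 ?normr0// ger0_norm//.
  by apply: (le_lt_trans ur); rewrite ltr_pdivrMr// ltr_pMr// ltr1n.
have hA : has_sup A.
  split; first by exists (r / 2).
  exists M => x [x0 /(_ x)]; rewrite x0 lexx => /(_ isT)/hM[/=].
  by rewrite ger0_norm.
set xB := sup A.
have xB0 : 0 < xB by apply: (@lt_le_trans _ _ (r / 2)); [rewrite divr_gt0|apply: sup_upper_bound].
have Nlt u : 0 <= u < xB -> N (u, 0).
  move=> /andP[u0 um]; have /(sup_adherent)/(_ hA)[s [_ Ps] us] : 0 < xB - u by rewrite subr_gt0.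
  by apply: Ps; rewrite u0 /= ltW//; move: us; rewrite -/xB opprB addrC subrK.
have pc : (fun x : R => (x, 0) : plane R) x @[x --> xB] --> ((xB, 0) : plane R).
  have [h _] := derive_pair (derive_var xB) (derive_const xB (0 : R)).
  exact/differentiable_continuous/derivable1_diffP.
have NB : N (xB, 0).
  apply: (isolating_closed bl) => B /pc /nbhs_ballP[e /= e0 He].
  pose u := Num.max 0 (xB - e / 2).
  have u0 : 0 <= u by rewrite le_max lexx.
  have uB : u < xB by rewrite gt_max xB0 ltrBlDr ltrDl divr_gt0.
  exists (u, 0); split; first by apply: Nlt; rewrite u0.
  apply: He; rewrite /ball /= ger0_norm ?subr_ge0 ?(ltW uB)// ltrBlDr -ltrBlDl.
  rewrite lt_max; apply/orP; right; rewrite ltrD2l ltrN2.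
  by rewrite ltr_pdivrMr// ltr_pMr// ltr1n.
have Nle u : 0 <= u <= xB -> N (u, 0).
  by move=> /andP[u0]; rewrite le_eqVlt => /predU1P[->//|um]; apply: Nlt; rewrite u0.
have bB : bd N (xB, 0).
  split => //; rewrite /interior /= => /pc /nbhs_ballP[e /= e0 He].
  have : xB + e / 2 <= xB.
    apply: sup_upper_bound => //; split; first by rewrite addr_ge0// ltW// divr_gt0.
    move=> u /andP[u0 ue]; have [uB|uB] := leP u xB; first by apply: Nle; rewrite u0.
    apply: He; rewrite /ball /= distrC ger0_norm ?subr_ge0 ?(ltW uB)// ltrBlDl.
    by apply: (le_lt_trans ue); rewrite ltrD2l ltr_pdivrMr// ltr_pMr// ltr1n.
  by rewrite leNgt ltrDl divr_gt0.
(* As [a < 0], the orbit moves along the axis towards the origin and never leaves the segment. In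
   particular the segment contains no exit point, the fact on which all later contradictions
   rest. *)
have stay (x : R) : 0 < x <= xB -> forall t : R, 0 <= t -> flow_in X N (x, 0) t.
  move=> /andP[x0 xB1] t t0; exists (x / (1 - a * x * t), 0).
    by apply: axis_flow => //; exact: ltW.
  have d1 : 1 <= 1 - a * x * t by rewrite lerBrDr gerDl mulr_le0_ge0// nmulr_rle0// ltW.
  apply: Nle; rewrite divr_ge0 ?(ltW x0) ?(le_trans ler01 d1)//=.
  apply: le_trans xB1; rewrite ler_pdivrMr ?(lt_le_trans ltr01 d1)//.
  by rewrite ler_peMr// ltW.
have nout (x : R) : 0 < x <= xB -> ~ n_out X N (x, 0).
  move=> hx [_ [t t0]] /(_ (t / 2)); apply; last by apply: stay; rewrite // ltW// divr_gt0.
  by rewrite divr_gt0//= ltr_pdivrMr// ltr_pMr// ltr1n.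
exists xB; split => //; split; last by apply: stay; rewrite xB0 lexx.
have [d] := boundary_chart_exists bl bB.
have Dp := (chart_center d).1; have dp := (chart_center d).2.
case: (ltrgtP 0 (chart_speed d X (xB, 0))) => [Vp|Vn|V0].
- by apply: (n_in_of_speed hX Dp) => //; rewrite dp.
- exfalso; apply: (nout xB); rewrite ?xB0 ?lexx//.
  by apply: (n_out_of_speed hX Dp) => //; rewrite dp.
- suff : (n_in X N `&` n_out X N) (xB, 0) by case.
  by case: bl => _ _ _ -> _; split => //; exists d.
Qed.

Definition transit X N p (t : R) c := [/\ 0 <= t, c 0 = p,
  forall s : R, 0 <= s <= t -> is_derive s (1 : R) c (X (c s)) &
  forall s : R, 0 <= s <= t -> N (c s)].

(** [exit_point] provides a separate solution for each intermediate time; uniqueness merges them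
    into one curve that stays in [N]. *)
Lemma exit_transit X N p q : quadratic_field X -> exit_point X N p q ->
  exists t c, transit X N p t c /\ c t = q.
Proof.
move=> hX [t [t0 /(flow_forward _ _ _ t0)[c [c0 ct hc]] hN _]].
exists t, c; split => //; split => // s hs.
have /andP[s0 st] := hs.
have [q' /flow_forward-/(_ s0)[c' [c'0 c's hc']] Nq'] := hN _ hs.
suff -> : c s = c' s by rewrite c's.
apply: (@ode_unique _ X c c' s) => //; rewrite ?c0 ?c'0 ?s0 ?lexx// => u /andP[u0 us].
by apply: hc; rewrite u0 (le_trans us st).
Qed.

Lemma a_in_transit X N p : quadratic_field X -> a_in X N p -> forall t : R, 0 <= t -> exists c, transit X N p t c.
Proof.
move=> hX [_ ap] t t0; have [q /flow_forward-/(_ t0)[c [c0 ct hc]] Nq] := ap _ t0.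
exists c; split => // s /andP[s0 st].
have [q' /flow_forward-/(_ s0)[c' [c'0 c's hc']] Nq'] := ap _ s0.
suff -> : c s = c' s by rewrite c's.
apply: (@ode_unique _ X c c' s) => //; rewrite ?c0 ?c'0 ?s0 ?lexx// => u /andP[u0 us].
by apply: hc; rewrite u0 (le_trans us st).
Qed.

End Blocks.

(** * Passage near a saddle with three characteristic directions *)

Section Passage.
Context {R : realType}.
Implicit Types (X f : plane R -> plane R) (N O : set (plane R)) (c : R -> plane R).

Notation e1 := ((1, 0) : plane R).

Lemma cvg_le_le (T : Type) (F : set_system T) {FF : ProperFilter F} (f g : T -> R) (a b : R) :
  f x @[x --> F] --> a -> g x @[x --> F] --> b -> (\forall x \near F, f x <= g x) -> a <= b.
Proof.
move=> fa gb fg; rewrite -subr_ge0.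
apply: (@cvgr_to_ge _ F FF _ (fun x => g x - f x)); first exact: cvgB.
by apply: filterS fg => x; rewrite subr_ge0.
Qed.

Lemma cvg_ln (T : Type) (F : set_system T) {FF : Filter F} (f : T -> R) (l : R) :
  0 < l -> f x @[x --> F] --> l -> ln (f x) @[x --> F] --> ln l.
Proof. by move=> l0 fl; apply: (continuous_cvg _ (continuous_ln l0)). Qed.

Lemma sign_near0 (g : R -> R) (b : R) : is_derive 0 (1 : R) g b -> g 0 = 0 -> b != 0 ->
  (\forall s \near 0^'+, 0 < b * g s) /\ (\forall s \near 0^'+, b * g (- s) < 0).
Proof.
move=> gd g0 b0.
have H : \forall s \near 0^', 0 < b * (g s / s).
  have b2 : 0 < b * b by rewrite -expr2 exprn_even_gt0.
  apply: (cvgr_gt (b * b)) => //.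
  by apply: cvgM; [exact: cvg_cst|exact: derive_quotient].
have Hr : \forall s \near 0^'+, 0 < b * (g s / s).
  move: H; rewrite /at_right /dnbhs !near_withinE => H.
  by apply: filterS H => s h s0; apply: h; rewrite gt_eqF.
split.
  near=> s; have s0 : 0 < s by near: s; exact: nbhs_right_gt.
  have : 0 < b * (g s / s) by near: s.
  by rewrite mulrA pmulr_lgt0 ?invr_gt0.
have Hl' : \forall s \near 0^'+, 0 < b * (g (- s) / - s).
  have n0 : - (s : R) @[s --> 0^'+] --> (0 : R).
    by rewrite -[X in _ --> X]oppr0; apply: cvgN; apply: cvg_within_filter; exact: cvg_id.
  move: H; rewrite /dnbhs near_withinE => /n0; rewrite near_simpl => H.
  near=> s; have s0 : 0 < s by near: s; exact: nbhs_right_gt.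
  have : - s != 0 -> 0 < b * (g (- s) / - s) by near: s.
  by apply; rewrite oppr_eq0 gt_eqF.
near=> s; have s0 : 0 < s by near: s; exact: nbhs_right_gt.
have : 0 < b * (g (- s) / - s) by near: s.
by rewrite invrN mulrN mulrN oppr_gt0 mulrA pmulr_llt0 ?invr_gt0.
Unshelve. all: by end_near.
Qed.

Lemma boundary_approach X N f p (d : boundary_chart N p) : quadratic_field X ->
  isolating_block X N -> a_in X N p -> (X p).2 = 0 -> {within n_in X N, continuous f} ->
  [/\ chart_curve d s @[s --> (0 : R)] --> p,
      f (chart_curve d s) @[s --> (0 : R)] --> f p,
      \forall s \near (0 : R), n_in X N (chart_curve d s) &
      exists2 b : R, b != 0 & is_derive (0 : R) (1 : R) (fun s => (chart_curve d s).2) b].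
Proof.
move=> hX bl ap X2 fc.
have g0 := chart_curve0 d.
have gc : chart_curve d s @[s --> (0 : R)] --> p.
  by rewrite -[X in _ --> X]g0; apply: chart_curve_cont; exact: chart_cod0.
have nin := n_in_near_a_in d hX bl ap.
split => //.
- have /subspace_continuousP-/(_ p) := fc; case: (ap) => np _ /(_ np) fp.
  move=> A /fp; rewrite /within /= nbhs_filterE => H.
  have : \forall s \near (0 : R), n_in X N (chart_curve d s) -> A (f (chart_curve d s)).
    exact: gc H.
  by move=> H2; apply: filterS2 nin H2 => s n1; apply.
- exists ('D_e1 (chart_inv d) (0, 0)).2.
    by apply: (@chart_curve_transverse _ X N p d) => //; rewrite gt_eqF//; exact: a_in_speed.
  by apply: derive_snd; apply: chart_curve_derive; exact: chart_cod0.
Qed.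

(** The boundary crosses the axis with nonzero vertical speed [b], so one of the two orientations of
    its parameter leads to the side where [sg * y] is positive; [tau] is 1 or -1 accordingly. *)
Lemma approach_both_sides X N f (xB sg : R) (d : boundary_chart N (xB, 0)) : quadratic_field X ->
  isolating_block X N -> a_in X N (xB, 0) -> (X (xB, 0)).2 = 0 -> {within n_in X N, continuous f} ->
  sg != 0 -> exists2 tau : R, tau != 0 & let G s := chart_curve d (tau * s) in
    [/\ G s @[s --> 0^'+] --> ((xB, 0) : plane R), f (G s) @[s --> 0^'+] --> f (xB, 0),
        \forall s \near 0^'+, n_in X N (G s) & \forall s \near 0^'+, 0 < sg * (G s).2].
Proof.
move=> hX bl ap X2 fc sg0.
have [gc fgc nin [b b0 db]] := boundary_approach d hX bl ap X2 fc.
have [hp hn] : (\forall s \near 0^'+, 0 < b * (chart_curve d s).2) /\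
   (\forall s \near 0^'+, b * (chart_curve d (- s)).2 < 0).
  by apply: sign_near0 => //; rewrite chart_curve0.
have r0 (tau : R) : tau * s @[s --> 0^'+] --> (0 : R).
  by rewrite -[X in _ --> X](mulr0 tau); apply: cvgM; [exact: cvg_cst|apply: cvg_within_filter; exact: cvg_id].
have [bs|bs] := ltP 0 (b * sg).
  exists 1; first exact: oner_neq0.
  split => /=.
  - exact: cvg_comp (r0 1) gc.
  - exact: cvg_comp (r0 1) fgc.
  - exact: (r0 1) nin.
  - apply: filterS hp => s h; rewrite mul1r.
    have : 0 < (b * sg) * (b * (chart_curve d s).2) by rewrite mulr_gt0.
    have -> : (b * sg) * (b * (chart_curve d s).2) = b ^+ 2 * (sg * (chart_curve d s).2) by ring.
    by rewrite pmulr_rgt0// exprn_even_gt0.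
have {}bs : b * sg < 0 by rewrite lt_neqAle bs mulf_neq0.
exists (-1); first by rewrite oppr_eq0 oner_neq0.
split => /=.
- exact: cvg_comp (r0 (- 1)) gc.
- exact: cvg_comp (r0 (- 1)) fgc.
- exact: (r0 (- 1)) nin.
- apply: filterS hn => s h; rewrite mulN1r.
  have : 0 < (b * sg) * (b * (chart_curve d (- s)).2) by rewrite nmulr_rgt0.
  have -> : (b * sg) * (b * (chart_curve d (- s)).2) = b ^+ 2 * (sg * (chart_curve d (- s)).2) by ring.
  by rewrite pmulr_rgt0// exprn_even_gt0.
Qed.

(** Otherwise [u] has a zero at some [r]. Gronwall's inequality for [- u ^ 2] on [[0, r]], with
    constant [- 2 K], then contradicts [u 0 <> 0]. *)
Lemma sign_preserved (t K : R) (u k : R -> R) :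
  (forall s : R, 0 <= s <= t -> is_derive s (1 : R) u (k s * u s)) ->
  (forall s : R, 0 <= s <= t -> `|k s| <= K) -> 0 < u 0 ->
  forall s : R, 0 <= s <= t -> 0 < u s.
Proof.
move=> hu hk u0 s /andP[s0 st]; rewrite ltNge; apply/negP => us.
have sub (r : R) : 0 <= r <= s -> 0 <= r <= t by move=> /andP[-> rs]; apply: le_trans st.
have [||r] := @IVT R u 0 s 0 s0.
- by apply: (@within_cont_derive _ _ _ _ (fun r => k r * u r)) => r /sub; apply: hu.
- by rewrite ge_min us orbT le_max ltW.
rewrite in_itv /= => /andP[r0 rs] ur.
have sub2 (v : R) : 0 <= v <= r -> 0 <= v <= t by move=> /andP[v0 vr]; apply: sub; rewrite v0 (le_trans vr).
have := @gronwall _ 0 r (- (2 * K)) (fun v => - (u v ^+ 2)) (fun v => - (2%:R * u v * (k v * u v))) r0.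
rewrite ur expr0n oppr0 => H.
have : 0 <= - u 0 ^+ 2 * expR (- (2 * K) * (r + 0)).
  apply: H => v /sub2 hv.
    by apply: derive_opp; apply: (derive_ext (derive_exp 2 (hu _ hv))).
  have := hk _ hv; rewrite ler_norml => /andP[k1 k2].
  have : 0 <= u v ^+ 2 * (K + k v) by rewrite mulr_ge0 ?sqr_ge0// -lerBlDl sub0r.
  by clear; lra.
rewrite mulNr oppr_ge0 leNgt; apply/negP; rewrite negbK.
by rewrite mulr_gt0 ?exprn_gt0 ?expR_gt0.
Qed.

Section Quadrant.
Variables (a b : R).
Hypotheses (a0 : a < 0) (b0 : 0 < b + 1).

(** Normal form of the flow in the sector between two neighbouring characteristic directions, placed
    on the axes; the third one is the line [u + v = 0]. The characteristic values on the axes are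
    [a] and [- (b + 1)], both negative here. *)
Definition quadrant_orbit (t : R) (u v : R -> R) := [/\ 0 < u 0, 0 < v 0,
  forall s : R, 0 <= s <= t -> is_derive s (1 : R) u (u s * (a * u s + b * v s)) &
  forall s : R, 0 <= s <= t -> is_derive s (1 : R) v (v s * ((a + 1) * u s + (b + 1) * v s))].

(** Logarithm of the first integral [v^(-a) u^(b+1) (u+v)^(a-b)], which is homogeneous of degree
    1. *)
Definition quadrant_log (u v : R) := - a * ln v + (b + 1) * ln u + (a - b) * ln (u + v).

Lemma quadrant_pos t u v : 0 <= t -> quadrant_orbit t u v ->
  forall s : R, 0 <= s <= t -> 0 < u s /\ 0 < v s.
Proof.
move=> t0 [u0 v0 hu hv].
have [M1 M10 B1] := bounded_on_segment t0 (within_cont_derive hu).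
have [M2 M20 B2] := bounded_on_segment t0 (within_cont_derive hv).
have bnd (p q s : R) : 0 <= s <= t -> `|p * u s + q * v s| <= `|p| * M1 + `|q| * M2.
  move=> st; apply: (le_trans (ler_normD _ _)); rewrite !normrM.
  by apply: lerD; apply: ler_wpM2l => //; [exact: B1|exact: B2].
move=> s st; split.
  apply: (@sign_preserved t (`|a| * M1 + `|b| * M2) u (fun s => a * u s + b * v s)) => //.
    by move=> r /hu; rewrite mulrC.
  by move=> r; exact: bnd.
apply: (@sign_preserved t (`|a + 1| * M1 + `|b + 1| * M2) v (fun s => (a + 1) * u s + (b + 1) * v s)) => //.
  by move=> r /hv; rewrite mulrC.
by move=> r; exact: bnd.
Qed.

Lemma quadrant_orbit_le (s t : R) u v : s <= t -> quadrant_orbit t u v -> quadrant_orbit s u v.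
Proof.
move=> st [h1 h2 h3 h4]; split => // r /andP[r0 rs].
  by apply: h3; rewrite r0 (le_trans rs).
by apply: h4; rewrite r0 (le_trans rs).
Qed.

Lemma quadrant_log_const t u v : 0 <= t -> quadrant_orbit t u v ->
  quadrant_log (u 0) (v 0) = quadrant_log (u t) (v t).
Proof.
move=> t0 h; have pos := quadrant_pos t0 h; have [_ _ hu hv] := h.
apply: (@derive0_eq _ 0 t (fun s => quadrant_log (u s) (v s)) (fun=> 0)) => // s st.
have [us vs] := pos _ st.
apply: (derive_ext (derive_add (derive_add
   (derive_mul (derive_const s (- a)) (derive_ln vs (hv _ st)))
   (derive_mul (derive_const s (b + 1)) (derive_ln us (hu _ st))))
   (derive_mul (derive_const s (a - b)) (derive_ln (f := fun s => u s + v s) _ (derive_add (hu _ st) (hv _ st)))))) => //.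
  by rewrite addr_gt0.
by field; rewrite !gt_eqF// addr_gt0.
Qed.

Lemma quadrant_ratio t u v (m : R) : 0 <= t -> quadrant_orbit t u v ->
  (forall s : R, 0 <= s <= t -> m <= u s + v s) ->
  ln (v 0) - ln (u 0) + m * t <= ln (v t) - ln (u t).
Proof.
move=> t0 h hm; have pos := quadrant_pos t0 h; have [_ _ hu hv] := h.
rewrite -lerBrDr.
have := @derive_ge0_le _ 0 t (fun s => ln (v s) - ln (u s) - m * s) (fun s => u s + v s - m) t0.
rewrite mulr0 subr0; apply => s st; last by rewrite subr_ge0; exact: hm.
have [us vs] := pos _ st.
apply: (derive_ext (derive_sub (derive_sub
   (derive_ln vs (hv _ st)) (derive_ln us (hu _ st)))
   (derive_mul (derive_const s m) (derive_var s)))) => //.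
by field; rewrite !gt_eqF.
Qed.

(** The exponents of [u] and [v] are positive and the total degree is 1, so each of [u], [v] may be
    replaced by [u + v]. Hence the level of an orbit bounds [u + v] from below. *)
Lemma quadrant_log_le (u v : R) : 0 < u -> 0 < v -> quadrant_log u v <= ln (u + v).
Proof.
move=> u0 v0; rewrite /quadrant_log.
have h1 : ln v <= ln (u + v) by rewrite ler_ln ?posrE ?addr_gt0// lerDr ltW.
have h2 : ln u <= ln (u + v) by rewrite ler_ln ?posrE ?addr_gt0// lerDl ltW.
have := ler_wpM2l (_ : 0 <= - a) h1; rewrite oppr_ge0 => /(_ (ltW a0)).
have := ler_wpM2l (ltW b0) h2.
by clear; lra.
Qed.

(* The ratio [v / u] would tend to infinity whereas the first integral keeps [u] away from 0. *)
Lemma quadrant_leaves (M u0 v0 : R) : ~ (forall t : R, 0 <= t -> exists u v,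
  [/\ quadrant_orbit t u v, u 0 = u0, v 0 = v0 & forall s : R, 0 <= s <= t -> `|u s| <= M /\ `|v s| <= M]).
Proof.
move=> H.
pose L := quadrant_log u0 v0; pose m := expR L.
have m0 : 0 < m by exact: expR_gt0.
have [u00 [v00 M0]] : 0 < u0 /\ 0 < v0 /\ 0 < M.
  have [u [v [[hu hv _ _] <- <- /(_ 0)]]] := H 0 (lexx 0).
  rewrite lexx => /(_ isT)[uM _]; split => //; split => //.
  by apply: lt_le_trans uM; rewrite gtr0_norm.
pose B := `|a - b| * (`|L| + `|ln (M + M)|).
(* A lower bound of [ln (u t)], obtained by solving the first integral for [ln u]. It does not
   depend on [t], whereas [ln (v / u)] grows at least like [m * t]. *)
pose C := (L + a * ln M - B) / (b + 1).
suff K (t : R) : 0 <= t -> m * t <= ln M - C - (ln v0 - ln u0).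
  have t0 : 0 <= (`|ln M - C - (ln v0 - ln u0)| + 1) / m by rewrite divr_ge0 ?addr_ge0// ltW.
  have := K _ t0; rewrite mulrC divfK ?gt_eqF// => h.
  have := le_trans h (ler_norm _); rewrite leNgt => /negP; apply.
  by rewrite ltrDl ltr01.
move=> t0; have [u [v [orb uE vE bnd]]] := H _ t0.
have pos := quadrant_pos t0 orb.
have logE (s : R) : 0 <= s <= t -> L = quadrant_log (u s) (v s).
  move=> /andP[s0 st]; rewrite /L -uE -vE; apply: quadrant_log_const => //.
  exact: quadrant_orbit_le st orb.
have logle (s : R) : 0 <= s <= t -> L <= ln (u s + v s).
  by move=> st; have [us vs] := pos _ st; rewrite (logE _ st); apply: quadrant_log_le.
rewrite lerBrDl -uE -vE; apply: (le_trans (quadrant_ratio t0 orb _)) => [s st|].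
  have [us vs] := pos _ st.
  by rewrite /m -ler_ln ?posrE ?expR_gt0 ?addr_gt0// expRK logle.
have tt : 0 <= t <= t by rewrite t0 lexx.
have [ut vt] := pos _ tt; have [utM vtM] := bnd _ tt; rewrite !gtr0_norm// in utM vtM.
have l1 : ln (v t) <= ln M by rewrite ler_ln ?posrE.
have l2 : ln (u t + v t) <= ln (M + M) by rewrite ler_ln ?posrE ?addr_gt0// lerD.
have l3 := logle _ tt.
apply: lerB => //; rewrite /C ler_pdivrMr//.
have E := logE _ tt; rewrite /quadrant_log in E.
have absln : `|ln (u t + v t)| <= `|L| + `|ln (M + M)|.
  rewrite ler_norml; apply/andP; split.
    by apply: le_trans l3; rewrite lerNl; apply: (le_trans (ler_norm _)); rewrite normrN lerDl.
  by apply: (le_trans l2); apply: (le_trans (ler_norm _)); rewrite lerDr.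
have : (a - b) * ln (u t + v t) <= B.
  by apply: (le_trans (ler_norm _)); rewrite normrM; apply: ler_wpM2l.
have : 0 <= - a * (ln M - ln (v t)) by rewrite mulr_ge0 ?oppr_ge0 ?(ltW a0)// subr_ge0.
by rewrite E; clear; lra.
Qed.

(** At the entry [- a * ln v] tends to minus infinity; were both limits [u1], [v1] positive, the
    first integral at the exit would converge. If [u1 > 0], then [v1 = 0]. As [v / u] increases
    along an orbit, it is then uniformly small, so that [u] decreases and [u1 <= u0]. *)
Lemma quadrant_limit (F : set_system R) {FF : ProperFilter F} (p1 p2 q1 q2 : R -> R) (u0 u1 v1 : R) :
  0 < u0 -> p1 s @[s --> F] --> u0 -> p2 s @[s --> F] --> (0 : R) ->
  q1 s @[s --> F] --> u1 -> q2 s @[s --> F] --> v1 ->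
  (\forall s \near F, exists t u v, [/\ 0 <= t, quadrant_orbit t u v,
     u 0 = p1 s /\ v 0 = p2 s & u t = q1 s /\ v t = q2 s]) ->
  [/\ 0 <= u1, 0 <= v1 & u1 = 0 \/ (v1 = 0 /\ u1 <= u0)].
Proof.
move=> u00 p1u p20 q1u q2v H.
have posq : \forall s \near F, 0 < q1 s /\ 0 < q2 s.
  apply: filterS H => s [t [u [v [t0 orb _ [<- <-]]]]].
  by apply: (quadrant_pos t0 orb); rewrite t0 lexx.
have u10 : 0 <= u1 by apply: (cvgr_to_ge q1u); apply: filterS posq => s [/ltW].
have v10 : 0 <= v1 by apply: (cvgr_to_ge q2v); apply: filterS posq => s [_ /ltW].
split => //; have [|u1p] := eqVneq u1 0; first by left.
have {}u1p : 0 < u1 by rewrite lt_neqAle eq_sym u1p.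
right; have v1E : v1 = 0.
  apply/eqP/negPn/negP => v1n; have v1p : 0 < v1 by rewrite lt_neqAle eq_sym v1n.
  have lnq : quadrant_log (q1 s) (q2 s) @[s --> F] --> quadrant_log u1 v1.
    have c1 : ln (q1 s) @[s --> F] --> ln u1 by exact: cvg_ln.
    have c2 : ln (q2 s) @[s --> F] --> ln v1 by exact: cvg_ln.
    have c3 : ln (q1 s + q2 s) @[s --> F] --> ln (u1 + v1).
      by apply: cvg_ln; [exact: addr_gt0|exact: cvgD].
    by apply: cvgD; [apply: cvgD|]; apply: cvgM => //; exact: cvg_cst.
  pose G (u v : R) := (b + 1) * ln u + (a - b) * ln (u + v).
  have Gp : G (p1 s) (p2 s) @[s --> F] --> G u0 0.
    have c1 : ln (p1 s) @[s --> F] --> ln u0 by exact: cvg_ln.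
    have u00' : 0 < u0 + 0 by rewrite addr0.
    have c3 : ln (p1 s + p2 s) @[s --> F] --> ln (u0 + 0).
      by apply: cvg_ln => //; exact: cvgD.
    by apply: cvgD; apply: cvgM => //; exact: cvg_cst.
  pose C := (quadrant_log u1 v1 - G u0 0 - 1) / - a.
  have pC : \forall s \near F, p2 s < expR C by apply: (cvgr_lt _ p20); exact: expR_gt0.
  have lnqC : \forall s \near F, quadrant_log u1 v1 - 1 / 2 < quadrant_log (q1 s) (q2 s).
    by apply: (cvgr_gt _ lnq); rewrite ltrBlDr ltrDl divr_gt0.
  have GpC : \forall s \near F, G (p1 s) (p2 s) < G u0 0 + 1 / 2.
    by apply: (cvgr_lt _ Gp); rewrite ltrDl divr_gt0.
  near F => s.
  have : exists t u v, [/\ 0 <= t, quadrant_orbit t u v,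
     u 0 = p1 s /\ v 0 = p2 s & u t = q1 s /\ v t = q2 s] by near: s.
  move=> [t [u [v [t0 orb [uE vE] [uE' vE']]]]].
  have E := quadrant_log_const t0 orb; rewrite uE vE uE' vE' in E.
  have p2pos : 0 < p2 s by rewrite -vE; have [] := orb.
  have h1 : p2 s < expR C by near: s.
  have h2 : quadrant_log u1 v1 - 1 / 2 < quadrant_log (q1 s) (q2 s) by near: s.
  have h3 : G (p1 s) (p2 s) < G u0 0 + 1 / 2 by near: s.
  have h4 : ln (p2 s) < C by rewrite -[C]expRK ltr_ln ?posrE ?expR_gt0.
  have na0 : 0 < - a by rewrite oppr_gt0.
  have h5 : - a * ln (p2 s) < quadrant_log u1 v1 - G u0 0 - 1.
    by rewrite mulrC -ltr_pdivlMr.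
  have E2 : quadrant_log (p1 s) (p2 s) = - a * ln (p2 s) + G (p1 s) (p2 s).
    by rewrite /quadrant_log /G addrA.
  by move: h2 h3 h5; rewrite -E E2; clear; lra.
split => //; rewrite v1E in q2v.
apply: (cvg_le_le q1u p1u).
have q21 : q2 s / q1 s @[s --> F] --> (0 : R).
  by rewrite -(mul0r u1^-1); apply: cvgM => //; apply: cvgV => //; rewrite gt_eqF.
have small : \forall s \near F, `|b| * (q2 s / q1 s) < - a.
  apply: (cvgr_lt (`|b| * 0)); last by rewrite mulr0 oppr_gt0.
  by apply: cvgM => //; exact: cvg_cst.
near=> s.
have : exists t u v, [/\ 0 <= t, quadrant_orbit t u v,
     u 0 = p1 s /\ v 0 = p2 s & u t = q1 s /\ v t = q2 s] by near: s.
move=> [t [u [v [t0 orb [<- _] [uE' vE']]]]]; rewrite -uE'.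
have pos := quadrant_pos t0 orb.
have sm : `|b| * (q2 s / q1 s) < - a by near: s.
rewrite -lerN2; have [_ _ hu hv] := orb.
apply: (derive_ge0_le t0 (f := fun s => - u s) (df := fun s => - (u s * (a * u s + b * v s)))) => r rt.
  by apply: derive_opp; exact: hu.
have [ur vr] := pos _ rt.
rewrite oppr_ge0 pmulr_rle0//.
have ratio : v r / u r <= q2 s / q1 s.
  have /andP[r0 rt'] := rt.
  have orb' : quadrant_orbit (t - r) (fun s => u (s + r)) (fun s => v (s + r)).
    have sh (x : R) : 0 <= x <= t - r -> 0 <= x + r <= t.
      by move=> /andP[x0 xr]; rewrite addr_ge0//= -lerBrDr.
    split; rewrite ?add0r// => x /sh hx.
      have := derive_comp (f := u) (g := fun x => x + r) (hu _ hx) (derive_add (derive_var x) (derive_const x r)).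
      by rewrite addr0 mulr1.
    have := derive_comp (f := v) (g := fun x => x + r) (hv _ hx) (derive_add (derive_var x) (derive_const x r)).
    by rewrite addr0 mulr1.
  have tr0 : 0 <= t - r by rewrite subr_ge0.
  have := quadrant_ratio (m := 0) tr0 orb' _; rewrite !add0r mul0r addr0 subrK.
  have pos' := quadrant_pos tr0 orb'.
  have tt : 0 <= t <= t by rewrite t0 lexx.
  have [ut vt] := pos _ tt.
  rewrite -!ln_div ?posrE// ler_ln ?posrE ?divr_gt0// uE' vE'; apply => x hx.
  by have [h1 h2] := pos' _ hx; rewrite ltW// addr_gt0.
rewrite -(pmulr_lle0 _ (_ : 0 < (u r)^-1)) ?invr_gt0// mulrDl mulfK ?gt_eqF// -mulrA.
have h1 : b * (v r / u r) <= `|b| * (v r / u r).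
  by apply: ler_wpM2r; [rewrite ltW// divr_gt0|exact: ler_norm].
have h2 : `|b| * (v r / u r) <= `|b| * (q2 s / q1 s) by exact: ler_wpM2l.
by move: h1 h2 sm; clear; lra.
Unshelve. all: by end_near.
Qed.

End Quadrant.

(* A linear pair of coordinates [(U, V)], with [V = 0] on the horizontal axis, in which the orbits
   are quadrant orbits: the block map sends the entrance point of the half-axis to [U = 0]. *)
Lemma saddle_sector X N f (a b A B xB sg : R) (U V : plane R -> R) :
  a < 0 -> 0 < b + 1 -> 0 < A -> sg != 0 ->
  quadratic_field X -> isolating_block X N -> block_extension X N f ->
  a_in X N (xB, 0) -> (X (xB, 0)).2 = 0 -> 0 < xB ->
  (forall x : R, 0 < x <= xB -> ~ n_out X N (x, 0)) ->
  (forall z, U z = A * z.1 + B * z.2) -> (forall z, V z = sg * z.2) ->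
  (forall t c, (forall s : R, 0 <= s <= t -> is_derive s (1 : R) c (X (c s))) ->
     0 < U (c 0) -> 0 < V (c 0) -> quadrant_orbit a b t (fun s => U (c s)) (fun s => V (c s))) ->
  [/\ 0 <= U (f (xB, 0)), 0 <= V (f (xB, 0)) & U (f (xB, 0)) = 0].
Proof.
move=> a0 b0 A0 sg0 hX bl [fout fexit fc] aB X2 xB0 nout UE VE orb.
have [d] : inhabited (boundary_chart N (xB, 0)).
  by apply: (boundary_chart_exists bl); case: aB => -[].
have [tau _] := approach_both_sides d hX bl aB X2 fc sg0.
set G := fun s : R => chart_curve d (tau * s); move=> [Gc fGc nin sgG].
have fB := fout _ aB.1.
have linc (K L : R) (p : R -> plane R) (l : plane R) : p s @[s --> 0^'+] --> l ->
    K * (p s).1 + L * (p s).2 @[s --> 0^'+] --> K * l.1 + L * l.2.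
  move=> pl; apply: cvgD; (apply: cvgM; first exact: cvg_cst).
    by apply: (cvg_comp _ fst pl); exact: cvg_fst.
  by apply: (cvg_comp _ snd pl); exact: cvg_snd.
have Uc (p : R -> plane R) (l : plane R) : p s @[s --> 0^'+] --> l -> U (p s) @[s --> 0^'+] --> U l.
  have -> : U = fun z => A * z.1 + B * z.2 by apply/funext.
  exact: linc.
have Vc (p : R -> plane R) (l : plane R) : p s @[s --> 0^'+] --> l -> V (p s) @[s --> 0^'+] --> V l.
  have -> : V = fun z => 0 * z.1 + sg * z.2 by apply/funext => z; rewrite VE mul0r add0r.
  exact: linc.
have UB : U (xB, 0) = A * xB by rewrite UE /= mulr0 addr0.
have VB : V (xB, 0) = 0 by rewrite VE /= mulr0.
have GU : \forall s \near 0^'+, 0 < U (G s).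
  by apply: (cvgr_gt _ (Uc _ _ Gc)); rewrite UB mulr_gt0.
have [M M0 hM] := compact_box (isolating_compact bl).
have [||||||u1 v1 alt] := @quadrant_limit a b a0 ((0 : R)^'+) _ (fun s => U (G s)) (fun s => V (G s))
   (fun s => U (f (G s))) (fun s => V (f (G s))) (A * xB) (U (f (xB, 0))) (V (f (xB, 0))).
- by rewrite mulr_gt0.
- by rewrite -UB; exact: Uc.
- by have := Vc _ _ Gc; rewrite VB.
- exact: Uc.
- exact: Vc.
- near=> s.
  have nG : n_in X N (G s) by near: s.
  have Gu : 0 < U (G s) by near: s.
  have Gv : 0 < V (G s) by rewrite VE; near: s.
  have naG : ~ a_in X N (G s).
    move=> aG; apply: (@quadrant_leaves a b a0 b0 ((`|A| + `|B| + `|sg|) * M) (U (G s)) (V (G s))) => t t0.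
    have [c [_ c0 hc hN]] := a_in_transit hX aG t0.
    exists (fun r => U (c r)), (fun r => V (c r)); split; rewrite ?c0//.
      by apply: orb; rewrite ?c0.
    move=> r /hN/hM[h1 h2]; rewrite UE VE; split.
      apply: (le_trans (ler_normD _ _)); rewrite !normrM !mulrDl -[leLHS]addr0.
      by apply: lerD; [apply: lerD; apply: ler_wpM2l|apply: mulr_ge0 => //; exact: ltW].
    rewrite normrM !mulrDl -[leLHS]add0r; apply: lerD; last exact: ler_wpM2l.
    by rewrite addr_ge0// mulr_ge0// ltW.
  have [t [c [[t0 c0 hc _] ct]]] := exit_transit hX (fexit _ (conj nG naG)).
  exists t, (fun r => U (c r)), (fun r => V (c r)); split; rewrite ?c0 ?ct//.
  by apply: orb; rewrite ?c0.
(* The other alternative puts [f (xB, 0)] on the segment from the origin to [(xB, 0)], where only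
   the origin is not excluded by [nout]; there [U] vanishes too. *)
split => //; case: alt => // -[v0 uB].
case E : (f (xB, 0)) => [x y]; move: fB u1 v0 uB; rewrite E !UE VE /=.
move=> fB u1 /eqP; rewrite mulf_eq0 (negbTE sg0) /= => /eqP y0; rewrite y0 mulr0 addr0 in u1 *.
rewrite ler_pM2l// => xle; have [->|x0] := eqVneq x 0; first by rewrite mulr0.
exfalso; apply: (nout x); last by rewrite -y0.
by rewrite xle andbT lt_neqAle eq_sym x0; rewrite pmulr_rge0 in u1.
Unshelve. all: by end_near.
Qed.

(** The hypotheses say that the characteristic values [a], [b - 1] and [- (a + b)] are negative. The
    image of the entrance point lies on [x = y] by the sector above the axis and on [x = 0] by the
    sector below, so it is the origin, which is interior. *)
Lemma three_saddles X N f (a b : R) : a < 0 -> b < 1 -> 0 < a + b ->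
  (forall z, X z = (z.1 * (a * z.1 + b * z.2), z.2 * ((a + 1) * z.1 + (b - 1) * z.2))) ->
  isolating_block X N -> block_extension X N f -> False.
Proof.
move=> a0 b1 ab XE bl ext.
have hX : quadratic_field X.
  split; [exists a, b, 0|exists 0, (a + 1), (b - 1)] => x y; rewrite XE /=; ring.
have Xe : X e1 = (a, 0) by rewrite XE /= !mulr0 !mul0r mulr1 mul1r addr0.
have [xB [xB0 aB nout]] := entry_point hX bl Xe a0.
have X2 : (X (xB, 0)).2 = 0 by rewrite XE /= mul0r.
have [||||||_ V1 U1] := @saddle_sector X N f a (a + b - 1) 1 (- 1) xB 1
  (fun z => z.1 - z.2) (fun z => z.2) a0 _ _ _ hX bl ext aB X2 xB0 nout _ _.
- by rewrite subrK.
- by [].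
- exact: oner_neq0.
- by move=> z; rewrite mul1r mulN1r.
- by move=> z; rewrite mul1r.
- move=> t c hc u0 v0; split => // s /hc cs; have d1 := derive_fst cs; have d2 := derive_snd cs.
    by apply: (derive_ext (derive_sub d1 d2)) => //; rewrite !XE /=; ring.
  by apply: (derive_ext d2) => //; rewrite !XE /=; ring.
have [||||||_ V2 U2'] := @saddle_sector X N f a (- b) 1 0 xB (- 1)
  (fun z => z.1) (fun z => - z.2) a0 _ _ _ hX bl ext aB X2 xB0 nout _ _.
- by rewrite addrC subr_gt0.
- by [].
- by rewrite oppr_eq0 oner_neq0.
- by move=> z; rewrite mul1r mul0r addr0.
- by move=> z; rewrite mulN1r.
- move=> t c hc u0 v0; split => // s /hc cs; have d1 := derive_fst cs; have d2 := derive_snd cs.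
    by apply: (derive_ext d1) => //; rewrite !XE /=; ring.
  by apply: (derive_ext (derive_opp d2)) => //; rewrite !XE /=; ring.
have fE : f (xB, 0) = 0.
  move: U1 U2'; case: (f (xB, 0)) => [x y] /= + x0; rewrite x0 sub0r => /eqP.
  by rewrite oppr_eq0 => /eqP ->.
have [fout _ _] := ext.
have [[_ nint] _] := fout _ aB.1; apply: nint; rewrite fE.
exact: origin_interior hX bl.
Qed.

End Passage.

(** * Passage near a saddle with one characteristic direction *)

Section HalfPlane.
Context {R : realType}.
Implicit Types (X f : plane R -> plane R) (N O : set (plane R)) (c : R -> plane R).
Variables (k m : R).
Hypothesis k0 : k < 0.

Definition half_plane_orbit (t : R) (x y : R -> R) := [/\ 0 < y 0,
  forall s : R, 0 <= s <= t -> is_derive s (1 : R) x (k * x s ^+ 2 + m * x s * y s - y s ^+ 2) &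
  forall s : R, 0 <= s <= t -> is_derive s (1 : R) y ((k + 1) * x s * y s + m * y s ^+ 2)].

Let al := - k^-1.

Let al0 : 0 < al. Proof. by rewrite oppr_gt0 invr_lt0. Qed.

(** In the upper half plane [atan (x / y)] is [pi / 2 - theta]. Up to a constant this is [al] times
    the logarithm of [r (sin theta)^(-k) exp (- m theta)]. *)
Definition half_plane_log (x y : R) :=
  ln y + (al - 1) / 2 * ln (x ^+ 2 + y ^+ 2) + m * al * atan (x / y).

Lemma half_plane_pos t x y : 0 <= t -> half_plane_orbit t x y ->
  forall s : R, 0 <= s <= t -> 0 < y s.
Proof.
move=> t0 [y0 hx hy].
have [M1 M10 B1] := bounded_on_segment t0 (within_cont_derive hx).
have [M2 M20 B2] := bounded_on_segment t0 (within_cont_derive hy).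
apply: (@sign_preserved _ t (`|k + 1| * M1 + `|m| * M2) y (fun s => (k + 1) * x s + m * y s)) => //.
  by move=> r rt; apply: (derive_ext (hy _ rt)) => //; ring.
move=> s st; apply: (le_trans (ler_normD _ _)); rewrite !normrM.
by apply: lerD; apply: ler_wpM2l => //; [exact: B1|exact: B2].
Qed.

Lemma half_plane_orbit_le (s t : R) x y : s <= t -> half_plane_orbit t x y -> half_plane_orbit s x y.
Proof.
move=> st [h1 h2 h3]; split => // r /andP[r0 rs].
  by apply: h2; rewrite r0 (le_trans rs).
by apply: h3; rewrite r0 (le_trans rs).
Qed.

(** This is [theta' = y] for the polar angle. Its range has length [pi], which bounds the time spent
    with [y] away from 0. *)
Lemma half_plane_angle t x y : 0 <= t -> half_plane_orbit t x y ->
  forall s : R, 0 <= s <= t -> is_derive s (1 : R) (fun s => atan (x s / y s)) (- y s).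
Proof.
move=> t0 h s st; have ys := half_plane_pos t0 h st; have [_ hx hy] := h.
apply: (derive_ext (derive_atan (f := fun s => x s / y s)
   (derive_mul (hx _ st) (derive_inv _ (hy _ st))))) => //; first by rewrite gt_eqF.
have r0 : 0 < x s ^+ 2 + y s ^+ 2 by rewrite ltr_wpDl ?sqr_ge0// exprn_gt0.
have r1 : 1 + (x s / y s) ^+ 2 = (x s ^+ 2 + y s ^+ 2) / y s ^+ 2.
  by field; rewrite gt_eqF.
by rewrite r1; field; rewrite !gt_eqF.
Qed.

Lemma half_plane_log_const t x y : 0 <= t -> half_plane_orbit t x y ->
  half_plane_log (x 0) (y 0) = half_plane_log (x t) (y t).
Proof.
move=> t0 h; have pos := half_plane_pos t0 h; have [_ hx hy] := h.
apply: (@derive0_eq _ 0 t (fun s => half_plane_log (x s) (y s)) (fun=> 0)) => // s st.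
have ys := pos _ st.
have r0 : 0 < x s ^+ 2 + y s ^+ 2 by rewrite ltr_wpDl ?sqr_ge0// exprn_gt0.
apply: (derive_ext (derive_add (derive_add
   (derive_ln ys (hy _ st))
   (derive_mul (derive_const s ((al - 1) / 2)) (derive_ln (f := fun s => x s ^+ 2 + y s ^+ 2) r0
      (derive_add (derive_exp 2 (hx _ st)) (derive_exp 2 (hy _ st))))))
   (derive_mul (derive_const s (m * al)) (half_plane_angle t0 h st)))) => //.
have ysn : y s != 0 by rewrite gt_eqF.
have r0n : x s ^+ 2 + y s ^+ 2 != 0 by rewrite gt_eqF.
have kn : k != 0 by rewrite lt_eqF.
by rewrite /al /= !expr1; field; rewrite ?ysn ?r0n ?kn.
Qed.

(* The angle increases at speed [y], which the first integral keeps away from 0. *)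
Lemma half_plane_leaves (M x0 y0 : R) : ~ (forall t : R, 0 <= t -> exists x y,
  [/\ half_plane_orbit t x y, x 0 = x0, y 0 = y0 & forall s : R, 0 <= s <= t -> `|x s| <= M /\ `|y s| <= M]).
Proof.
move=> H.
pose L := half_plane_log x0 y0.
(* Two lower bounds of [ln y] from the first integral: if [al >= 1], its radial term is bounded
   through [r^2 <= 2 M^2]; if [al < 1], through [r^2 >= y^2]. *)
pose c1 := L - (al - 1) / 2 * ln (M ^+ 2 + M ^+ 2) - `|m * al| * (pi / 2).
pose c2 := (L - `|m * al| * (pi / 2)) / al.
pose C := expR (Num.min c1 c2).
have C0 : 0 < C by exact: expR_gt0.
suff K (t : R) : 0 <= t -> C * t <= pi.
  have t0 : 0 <= (pi + 1) / C by rewrite divr_ge0 ?(ltW C0)// addr_ge0 ?pi_ge0.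
  by have := K _ t0; rewrite mulrC divfK ?gt_eqF// leNgt ltrDl ltr01.
move=> t0; have [x [y [orb xE yE bnd]]] := H _ t0.
have pos := half_plane_pos t0 orb.
have yC (s : R) : 0 <= s <= t -> C <= y s.
  move=> /[dup] st /andP[s0 st']; have ys := pos _ st; have [xM yM] := bnd _ st.
  rewrite /C -[leRHS]lnK ?posrE// ler_expR.
  have LE : L = half_plane_log (x s) (y s).
    rewrite /L -xE -yE; apply: half_plane_log_const => //.
    exact: half_plane_orbit_le st' orb.
  rewrite /half_plane_log in LE.
  have hat : m * al * atan (x s / y s) <= `|m * al| * (pi / 2).
    apply: (le_trans (ler_norm _)); rewrite normrM; apply: ler_wpM2l => //.
    by rewrite ler_norml ltW ?atan_gtNpi2// ltW// atan_ltpi2.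
  have r0 : 0 < x s ^+ 2 + y s ^+ 2 by rewrite ltr_wpDl ?sqr_ge0// exprn_gt0.
  have [a1|a1] := leP 1 al.
    apply: (@le_trans _ _ c1); first by rewrite ge_min lexx.
    have h : ln (x s ^+ 2 + y s ^+ 2) <= ln (M ^+ 2 + M ^+ 2).
      have sqM (u : R) : `|u| <= M -> u ^+ 2 <= M ^+ 2.
        move=> uM; rewrite -[u ^+ 2]real_normK ?num_real//.
        by apply: lerXn2r; rewrite // nnegrE (le_trans _ uM).
      have le : x s ^+ 2 + y s ^+ 2 <= M ^+ 2 + M ^+ 2 by rewrite lerD// sqM.
      by rewrite ler_ln ?posrE// (lt_le_trans r0).
    have a1' : 0 <= (al - 1) / 2 by rewrite divr_ge0// subr_ge0.
    have := ler_wpM2l a1' h; rewrite /c1 LE; move: hat; clear; lra.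
  apply: (@le_trans _ _ c2); first by rewrite ge_min lexx orbT.
  rewrite /c2 ler_pdivrMr//.
  have h : 2 * ln (y s) <= ln (x s ^+ 2 + y s ^+ 2).
    have -> : 2 * ln (y s) = ln (y s ^+ 2) by rewrite lnXn// mulr_natl.
    by rewrite ler_ln ?posrE ?exprn_gt0// lerDr sqr_ge0.
  have a1' : 0 <= (1 - al) / 2 by rewrite divr_ge0// subr_ge0 ltW.
  have := ler_wpM2l a1' h; rewrite LE; move: hat; clear; lra.
have := @derive_ge0_le _ 0 t (fun s => - atan (x s / y s) - C * s) (fun s => y s - C) t0.
rewrite mulr0 subr0 => h.
have {h} : - atan (x 0 / y 0) <= - atan (x t / y t) - C * t.
  apply: h => s st; last by rewrite subr_ge0; exact: yC.
  apply: (derive_ext (derive_sub (derive_opp (half_plane_angle t0 orb st))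
     (derive_mul (derive_const s C) (derive_var s)))) => //.
  by ring.
have := @atan_ltpi2 _ (x 0 / y 0); have := @atan_gtNpi2 _ (x t / y t).
by clear; lra.
Qed.

Lemma cvg_atan_ratio (F : set_system R) {FF : Filter F} (p q : R -> R) (l : R) : 0 < l ->
  p s @[s --> F] --> l -> q s @[s --> F] --> (0 : R) -> (\forall s \near F, 0 < q s) ->
  atan (p s / q s) @[s --> F] --> (pi / 2 : R).
Proof.
move=> l0 pl q0 qpos; apply: (cvg_comp _ _ _ (@cvgy_atan R)).
apply/cvgryPge => A; near=> s.
have ps : l / 2 < p s.
  by near: s; apply: (cvgr_gt _ pl); rewrite ltr_pdivrMr// ltr_pMr// ltr1n.
have qs : q s < l / 2 / (`|A| + 1).
  by near: s; apply: (cvgr_lt _ q0); rewrite !divr_gt0// ltr_wpDl.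
have qs0 : 0 < q s by near: s.
rewrite ler_pdivlMr//; apply: ltW; apply: le_lt_trans ps.
move: qs; rewrite ltr_pdivlMr ?ltr_wpDl// => /ltW; apply: le_trans.
by rewrite mulrC ler_wpM2l ?(ltW qs0)// ler_wpDr// ler_norm.
Unshelve. all: by end_near.
Qed.

(** Equality of the first integrals at both ends expresses [q2 / p2] by the radii and the angle
    swept. It is bounded, so [y1 = 0]. On the positive axis [x / y] decreases along the orbit, which
    keeps [y / x] small and makes [x] decrease; on the negative axis the angle swept tends to
    [pi]. *)
Lemma half_plane_limit (F : set_system R) {FF : ProperFilter F} (p1 p2 q1 q2 : R -> R) (x0 x1 y1 : R) :
  0 < x0 -> p1 s @[s --> F] --> x0 -> p2 s @[s --> F] --> (0 : R) ->
  q1 s @[s --> F] --> x1 -> q2 s @[s --> F] --> y1 -> 0 < x1 ^+ 2 + y1 ^+ 2 ->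
  (\forall s \near F, exists t x y, [/\ 0 <= t, half_plane_orbit t x y,
     x 0 = p1 s /\ y 0 = p2 s & x t = q1 s /\ y t = q2 s]) ->
  [/\ y1 = 0, 0 < x1 -> x1 <= x0 & x1 < 0 -> q2 s / p2 s @[s --> F] -->
     expR ((al - 1) / 2 * (ln (x0 ^+ 2) - ln (x1 ^+ 2)) + m * al * pi)].
Proof.
move=> x00 px py qx qy r1 H.
have pos : \forall s \near F, 0 < p2 s /\ 0 < q2 s.
  apply: filterS H => s [t [x [y [t0 orb [_ <-] [_ <-]]]]].
  by split; apply: (half_plane_pos t0 orb); rewrite ?t0 ?lexx.
have r0 : 0 < x0 ^+ 2 + 0 ^+ 2 by rewrite expr0n addr0 exprn_gt0.
have lnr (f g : R -> R) (a b : R) : f s @[s --> F] --> a -> g s @[s --> F] --> b ->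
    0 < a ^+ 2 + b ^+ 2 -> ln (f s ^+ 2 + g s ^+ 2) @[s --> F] --> ln (a ^+ 2 + b ^+ 2).
  by move=> fa gb ab; apply: cvg_ln => //; rewrite !expr2; apply: cvgD; apply: cvgM.
have lnp := lnr _ _ _ _ px py r0.
have lnq := lnr _ _ _ _ qx qy r1.
pose B s := (al - 1) / 2 * (ln (p1 s ^+ 2 + p2 s ^+ 2) - ln (q1 s ^+ 2 + q2 s ^+ 2)).
have Bc : B s @[s --> F] --> (al - 1) / 2 * (ln (x0 ^+ 2 + 0 ^+ 2) - ln (x1 ^+ 2 + y1 ^+ 2)).
  by apply: cvgM; [exact: cvg_cst|exact: cvgB].
have E : \forall s \near F, q2 s / p2 s = expR (B s + m * al * (atan (p1 s / p2 s) - atan (q1 s / q2 s))).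
  near=> s.
  have [ps qs] : 0 < p2 s /\ 0 < q2 s by near: s.
  have : exists t x y, [/\ 0 <= t, half_plane_orbit t x y,
     x 0 = p1 s /\ y 0 = p2 s & x t = q1 s /\ y t = q2 s] by near: s.
  move=> [t [x [y [t0 orb [xE yE] [xE' yE']]]]].
  have := half_plane_log_const t0 orb; rewrite xE yE xE' yE' /half_plane_log => E.
  rewrite -[LHS]lnK ?posrE ?divr_gt0// ln_div ?posrE//; congr expR.
  by move: E; rewrite /B; clear; lra.
have y1E : y1 = 0.
  pose C := (al - 1) / 2 * (ln (x0 ^+ 2 + 0 ^+ 2) - ln (x1 ^+ 2 + y1 ^+ 2)) + 1 + `|m * al| * pi.
  have qp : \forall s \near F, q2 s <= p2 s * expR C.
    near=> s.
    have [ps qs] : 0 < p2 s /\ 0 < q2 s by near: s.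
    rewrite -ler_pdivrMl// mulrC.
    have -> : q2 s / p2 s = expR (B s + m * al * (atan (p1 s / p2 s) - atan (q1 s / q2 s))) by near: s.
    rewrite ler_expR; apply: lerD.
      by apply: ltW; near: s; apply: (cvgr_lt _ Bc); rewrite ltrDl.
    apply: (le_trans (ler_norm _)); rewrite normrM; apply: ler_wpM2l => //.
    have := @atan_ltpi2 _ (p1 s / p2 s); have := @atan_gtNpi2 _ (p1 s / p2 s).
    have := @atan_ltpi2 _ (q1 s / q2 s); have := @atan_gtNpi2 _ (q1 s / q2 s).
    by rewrite ler_norml => *; apply/andP; split; lra.
  apply/eqP; rewrite eq_le; apply/andP; split.
    apply: (cvg_le_le qy _ qp); rewrite -(mul0r (expR C)).
    by apply: cvgM => //; exact: cvg_cst.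
  by apply: (cvgr_to_ge qy); apply: filterS pos => s [_ /ltW].
split => //; rewrite y1E in qy Bc r1.
  move=> x1p; apply: (cvg_le_le qx px).
  have q21 : q2 s / q1 s @[s --> F] --> (0 : R).
    by rewrite -(mul0r x1^-1); apply: cvgM => //; apply: cvgV => //; rewrite gt_eqF.
  have small : \forall s \near F, `|m| * (q2 s / q1 s) < - k.
    apply: (cvgr_lt (`|m| * 0)); last by rewrite mulr0 oppr_gt0.
    by apply: cvgM => //; exact: cvg_cst.
  have q1pos : \forall s \near F, 0 < q1 s by apply: (cvgr_gt _ qx).
  near=> s.
  have : exists t x y, [/\ 0 <= t, half_plane_orbit t x y,
     x 0 = p1 s /\ y 0 = p2 s & x t = q1 s /\ y t = q2 s] by near: s.
  move=> [t [x [y [t0 orb [<- _] [xE' yE']]]]]; rewrite -xE'.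
  have ypos := half_plane_pos t0 orb.
  have sm : `|m| * (q2 s / q1 s) < - k by near: s.
  have q1s : 0 < q1 s by near: s.
  rewrite -lerN2; have [_ hx hy] := orb.
  apply: (derive_ge0_le t0 (f := fun s => - x s) (df := fun s => - (k * x s ^+ 2 + m * x s * y s - y s ^+ 2))) => r rt.
    by apply: derive_opp; exact: hx.
  have yr := ypos _ rt.
  have /andP[r00 rt'] := rt.
  have tt : 0 <= t <= t by rewrite t0 lexx.
  have q2s : 0 < q2 s by rewrite -yE'; exact: ypos.
  have atle : - atan (x r / y r) <= - atan (x t / y t).
    apply: (derive_ge0_le rt' (f := fun s => - atan (x s / y s)) (df := fun s => - - y s)) => v /andP[rv vt].
      by apply: derive_opp; apply: (half_plane_angle t0 orb); rewrite (le_trans r00).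
    by rewrite opprK ltW// ypos// (le_trans r00).
  have ratio : q1 s / q2 s <= x r / y r.
    rewrite leNgt; apply/negP => /lt_atan; rewrite ltNge -lerN2.
    by rewrite -xE' -yE' atle.
  have xr : 0 < x r.
    have : 0 < x r / y r by apply: lt_le_trans ratio; rewrite divr_gt0.
    by rewrite pmulr_lgt0// invr_gt0.
  have ratio' : y r / x r <= q2 s / q1 s.
    rewrite -[leLHS]invf_div -[leRHS]invf_div lef_pV2 ?posrE ?divr_gt0//.
  have -> : - (k * x r ^+ 2 + m * x r * y r - y r ^+ 2) = x r ^+ 2 * (- k - m * (y r / x r)) + y r ^+ 2.
    by field; rewrite gt_eqF.
  rewrite addr_ge0 ?sqr_ge0// mulr_ge0 ?sqr_ge0//.
  have h1 : m * (y r / x r) <= `|m| * (y r / x r).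
    by apply: ler_wpM2r; [rewrite ltW// divr_gt0|exact: ler_norm].
  have h2 : `|m| * (y r / x r) <= `|m| * (q2 s / q1 s) by exact: ler_wpM2l.
  by move: h1 h2 sm; clear; lra.
move=> x1n.
have atp : atan (p1 s / p2 s) @[s --> F] --> (pi / 2 : R).
  by apply: (cvg_atan_ratio x00 px py); apply: filterS pos => s [].
have atq : atan (q1 s / q2 s) @[s --> F] --> - (pi / 2 : R).
  have x1n' : 0 < - x1 by rewrite oppr_gt0.
  have : atan (- q1 s / q2 s) @[s --> F] --> (pi / 2 : R).
    by apply: (cvg_atan_ratio x1n' (cvgN qx) qy); apply: filterS pos => s [].
  move=> /cvgN; apply: cvg_trans; apply: near_eq_cvg; near=> s.
  by rewrite fctE /= mulNr atanN opprK.
apply: (@cvg_trans _ (expR (B s + m * al * (atan (p1 s / p2 s) - atan (q1 s / q2 s))) @[s --> F])).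
  by apply: near_eq_cvg; apply: filterS E => s ->.
apply: (continuous_cvg _ (@continuous_expR _ _)).
move: Bc; rewrite !expr0n !addr0 => Bc; apply: cvgD => //.
apply: cvgM; first exact: cvg_cst.
have -> : pi = pi / 2 - - (pi / 2) :> R by rewrite opprK -splitr.
exact: cvgB.
Unshelve. all: by end_near.
Qed.

End HalfPlane.

(** * One-sided slopes of the block map of [focus_saddle] *)

Section Saddle.
Context {R : realType}.
Implicit Types (X f : plane R -> plane R) (N : set (plane R)) (c : R -> plane R).

Definition focus_saddle (k m : R) (z : plane R) : plane R :=
  (k * z.1 ^+ 2 + m * z.1 * z.2 - z.2 ^+ 2, (k + 1) * z.1 * z.2 + m * z.2 ^+ 2).

Lemma focus_saddle_quadratic (k m : R) : quadratic_field (focus_saddle k m).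
Proof. by split; [exists k, m, (- 1)|exists 0, (k + 1), m] => x y; rewrite /focus_saddle /=; ring. Qed.

Section Germ.
Variables (k m : R) (N : set (plane R)) (f : plane R -> plane R) (xB : R).
Notation X := (focus_saddle k m).
Hypotheses (k0 : k < 0) (bl : isolating_block X N) (ext : block_extension X N f).
Hypotheses (xB0 : 0 < xB) (aB : a_in X N (xB, 0)).
Hypothesis nout : forall x : R, 0 < x <= xB -> ~ n_out X N (x, 0).
Variable d : boundary_chart N (xB, 0).

(* The upper and the lower half planes are exchanged by [y |-> - y], which changes [m] into [- m]. *)
Lemma focus_saddle_side (sg : R) : sg ^+ 2 = 1 -> exists tau : R,
  [/\ tau != 0, (f (xB, 0)).2 = 0, (f (xB, 0)).1 < 0 &
   (f (chart_curve d (tau * s))).2 / (chart_curve d (tau * s)).2 @[s --> 0^'+] -->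
     expR ((- k^-1 - 1) / 2 * (ln (xB ^+ 2) - ln ((f (xB, 0)).1 ^+ 2)) + sg * m * (- k^-1) * pi)].
Proof.
move=> sg1; have sg0 : sg != 0 by apply: contra_eqN sg1 => /eqP->; rewrite expr0n eq_sym oner_eq0.
have hX := focus_saddle_quadratic k m.
have [fout fexit fc] := ext.
have X2 : (X (xB, 0)).2 = 0 by rewrite /focus_saddle /= expr0n !mulr0 addr0.
have [tau tau0 /=] := approach_both_sides d hX bl aB X2 fc sg0.
set G := fun s : R => chart_curve d (tau * s); move=> [Gc fGc nin sgG].
have fB := fout _ aB.1.
have orb t c : (forall s : R, 0 <= s <= t -> is_derive s (1 : R) c (X (c s))) ->
     0 < sg * (c 0).2 -> half_plane_orbit k (sg * m) t (fun s => (c s).1) (fun s => sg * (c s).2).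
  move=> hc c0; split => // s st; have d1 := derive_fst (hc _ st); have d2 := derive_snd (hc _ st).
    apply: (derive_ext d1) => //; rewrite /focus_saddle /=.
    rewrite -[in RHS](mul1r (_ * _ * (c s).1 * _)).
    transitivity (k * (c s).1 ^+ 2 + sg ^+ 2 * m * (c s).1 * (c s).2 - sg ^+ 2 * (c s).2 ^+ 2).
      by rewrite sg1; ring.
    by ring.
  apply: (derive_ext (derive_mul (derive_const s sg) d2)) => //; rewrite /focus_saddle /=.
  transitivity (sg * (k + 1) * (c s).1 * (c s).2 + sg ^+ 2 * sg * m * (c s).2 ^+ 2); last by ring.
  by rewrite sg1; ring.
have [M M0 hM] := compact_box (isolating_compact bl).
have near_orb : \forall s \near 0^'+, exists t x y, [/\ 0 <= t, half_plane_orbit k (sg * m) t x y,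
     x 0 = (G s).1 /\ y 0 = sg * (G s).2 & x t = (f (G s)).1 /\ y t = sg * (f (G s)).2].
  near=> s.
  have nG : n_in X N (G s) by near: s.
  have Gv : 0 < sg * (G s).2 by near: s.
  have naG : ~ a_in X N (G s).
    move=> aG; apply: (@half_plane_leaves _ k (sg * m) k0 ((1 + `|sg|) * M) (G s).1 (sg * (G s).2)) => t t0.
    have [c [_ c0 hc hN]] := a_in_transit hX aG t0.
    exists (fun r => (c r).1), (fun r => sg * (c r).2); split; rewrite ?c0//.
      by apply: orb; rewrite ?c0.
    move=> r /hN/hM[h1 h2]; split.
      by apply: (le_trans h1); rewrite mulrDl mul1r lerDl mulr_ge0// ltW.
    rewrite normrM mulrDl -[leLHS]add0r; apply: lerD; last exact: ler_wpM2l.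
    by rewrite mul1r ltW.
  have [t [c [[t0 c0 hc _] ct]]] := exit_transit hX (fexit _ (conj nG naG)).
  exists t, (fun r => (c r).1), (fun r => sg * (c r).2); split; rewrite ?c0 ?ct//.
  by apply: orb; rewrite ?c0.
have fstc (p : R -> plane R) (l : plane R) : p s @[s --> 0^'+] --> l -> (p s).1 @[s --> 0^'+] --> l.1.
  by move=> pl; apply: (cvg_comp _ fst pl); exact: cvg_fst.
have sndc (p : R -> plane R) (l : plane R) : p s @[s --> 0^'+] --> l -> sg * (p s).2 @[s --> 0^'+] --> sg * l.2.
  move=> pl; apply: cvgM; first exact: cvg_cst.
  by apply: (cvg_comp _ snd pl); exact: cvg_snd.
have fn0 : 0 < (f (xB, 0)).1 ^+ 2 + (sg * (f (xB, 0)).2) ^+ 2.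
  rewrite lt_neqAle eq_sym addr_ge0 ?sqr_ge0// andbT.
  rewrite paddr_eq0 ?sqr_ge0// !sqrf_eq0 mulf_eq0 (negbTE sg0) /=.
  apply/negP => /andP[/eqP f1 /eqP f2].
  have [[_ nint] _] := fB; apply: nint.
  have -> : f (xB, 0) = 0 by move: f1 f2; case: (f (xB, 0)) => ? ? /= -> ->.
  exact: origin_interior hX bl.
have G2 : sg * (G s).2 @[s --> 0^'+] --> (0 : R) by have := sndc _ _ Gc; rewrite /= mulr0.
have [y1E x1le lim] := half_plane_limit k0 xB0 (fstc _ _ Gc) G2 (fstc _ _ fGc) (sndc _ _ fGc) fn0 near_orb.
have f2 : (f (xB, 0)).2 = 0 by move: y1E => /eqP; rewrite mulf_eq0 (negbTE sg0) => /eqP.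
(* Abscissa 0 would be the origin, which is interior; a positive one would be an exit point on the
   entrance segment. *)
have f1 : (f (xB, 0)).1 < 0.
  rewrite ltNge le_eqVlt; apply/negP => /orP[/eqP f1|f1].
    by move: fn0; rewrite -f1 f2 mulr0 expr0n addr0 ltxx.
  apply: (nout (x := (f (xB, 0)).1)); first by rewrite f1 x1le.
  by move: f2 fB; case: (f (xB, 0)) => ? ? /= ->.
exists tau; split => //.
move: (lim f1); apply: cvg_trans; apply: near_eq_cvg; near=> s.
have Gv : 0 < sg * (G s).2 by near: s.
have Gn : (G s).2 != 0 by apply: contraTneq Gv => ->; rewrite mulr0 ltxx.
by rewrite -/(G s); field; rewrite Gn sg0.
Unshelve. all: by end_near.
Qed.

End Germ.

(** The ratio of the ordinates at exit and entry has limits on both sides of the axis by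
    [focus_saddle_side]. Differentiability of the germ forces them to agree, and they differ by the
    sign of the term in [m]. *)
Lemma focus_saddle_smooth (k m : R) N f : k < 0 ->
  isolating_block (focus_saddle k m) N -> block_extension (focus_saddle k m) N f ->
  (forall p, a_in (focus_saddle k m) N p -> transition_germ smooth_germ N f p) -> m = 0.
Proof.
move=> k0 bl ext germ; have hX := focus_saddle_quadratic k m.
have Xe : focus_saddle k m (1, 0) = (k, 0).
  by rewrite /focus_saddle /= !expr0n !mulr0 expr1n mulr1 subr0 !addr0.
have [xB [xB0 aB nout]] := entry_point hX bl Xe k0.
have [c [d [U [oU U0] smU]]] := germ _ aB.
have [fout fexit fc] := ext.
have X2 : (focus_saddle k m (xB, 0)).2 = 0 by rewrite /focus_saddle /= expr0n !mulr0 addr0.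
have [gc fgc nin [b b0 db]] := boundary_approach c hX bl aB X2 fc.
pose D s := (d (f (chart_curve c s))).1.
have [f0 d0] := chart_center d.
have D0 : D 0 = 0 by rewrite /D chart_curve0 d0.
have Dd : is_derive 0 (1 : R) D ('D_1 D 0).
  by apply: derivableP; apply: diff_derivable; apply: smooth_diff smU U0.
(* Exit points near [f (xB, 0)] lie on the boundary, so [h] is recovered from [D] through the
   boundary curve of [d], and inherits a derivative at 0. *)
pose h s := (f (chart_curve c s)).2.
have hE : \forall s \near (0 : R), (chart_curve d (D s)).2 = h s.
  near=> s.
  have ns : n_in (focus_saddle k m) N (chart_curve c s) by near: s.
  have ds : chart_dom d (f (chart_curve c s)).
    near: s; apply: fgc; exact: chart_dom_nbhs.
  have bds : bd N (f (chart_curve c s)) by have [] := fout _ ns.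
  have d2 : (d (f (chart_curve c s))).2 = 0 by apply/(chart_bd ds).
  have [_ K] := chartK ds.
  rewrite /h -[in RHS]K /chart_curve; congr (chart_inv d _).2.
  by rewrite [RHS]surjective_pairing d2.
pose H := ('D_((1, 0) : plane R) (chart_inv d) (0, 0)).2 * 'D_1 D 0.
have hd : is_derive 0 (1 : R) h H.
  have dd : is_derive (D 0) (1 : R) (fun s => (chart_curve d s).2) ('D_((1, 0) : plane R) (chart_inv d) (0, 0)).2.
    by rewrite D0; apply: derive_snd; apply: chart_curve_derive; exact: chart_cod0.
  exact: near_eq_is_derive hE (derive_comp (g := D) dd Dd).
have g0 := chart_curve0 c.
have h0 : h 0 = (f (xB, 0)).2 by rewrite /h g0.
pose K1 (sg : R) := expR ((- k^-1 - 1) / 2 * (ln (xB ^+ 2) - ln ((f (xB, 0)).1 ^+ 2)) + sg * m * (- k^-1) * pi).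
have side (sg : R) : sg ^+ 2 = 1 -> H / b = K1 sg.
  move=> sg1; have [tau [tau0 f2 _ lim]] := focus_saddle_side k0 bl ext xB0 aB nout c sg1.
  have hq : h s / s @[s --> 0^'] --> H by apply: derive_quotient => //; rewrite h0.
  have gq : (chart_curve c s).2 / s @[s --> 0^'] --> b by apply: derive_quotient; rewrite ?g0.
  have ts : tau * s @[s --> 0^'+] --> 0^'.
    move=> A; rewrite /dnbhs /within /= nbhs_filterE => nA.
    have r0 : tau * s @[s --> 0^'+] --> (0 : R).
      by rewrite -[X in _ --> X](mulr0 tau); apply: cvgM; [exact: cvg_cst|apply: cvg_within_filter; exact: cvg_id].
    have := r0 _ nA; rewrite !near_simpl => H1; near=> s.
    have s0 : 0 < s by near: s; exact: nbhs_right_gt.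
    have : tau * s != 0 -> A (tau * s) by near: s.
    by apply; rewrite mulf_neq0// gt_eqF.
  have L1 : h (tau * s) / (chart_curve c (tau * s)).2 @[s --> 0^'+] --> H / b.
    have : (h (tau * s) / (tau * s)) / ((chart_curve c (tau * s)).2 / (tau * s)) @[s --> 0^'+] --> H / b.
      by apply: cvgM; [exact: cvg_comp ts hq|apply: cvgV => //; exact: cvg_comp ts gq].
    apply: cvg_trans; apply: near_eq_cvg; near=> s.
    have s0 : 0 < s by near: s; exact: nbhs_right_gt.
    have ts0 : tau * s != 0 by rewrite mulf_neq0// gt_eqF.
    by rewrite invf_div mulrA divfK.
  exact: (cvg_unique (@norm_hausdorff _ _) L1 lim).
have E : K1 1 = K1 (-1) by rewrite -!side// ?sqrrN expr1n.
move: E => /expR_inj /addrI; rewrite mul1r mulN1r => /eqP.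
rewrite !mulNr -subr_eq0 opprK -mulr2n mulrn_eq0 /= !mulf_eq0 oppr_eq0 invr_eq0 (lt_eqF k0).
by rewrite (gt_eqF (pi_gt0 R)) !orbF => /eqP.
Unshelve. all: by end_near.
Qed.

End Saddle.

(** * Maps of class C^k *)

Section Smooth.
Context {R : realType}.

Lemma near_eq_differentiable (V W : normedModType R) (f g : V -> W) x :
  (\forall y \near x, f y = g y) -> differentiable f x -> differentiable g x.
Proof.
move=> fg /diff_locallyP[dc df].
have E : g \o shift x = cst (g x) + 'd f x +o_ (0 : V) id.
  apply/eqaddoP => e e0; move/eqaddoP : df => /(_ _ e0).
  have gx : f x = g x by exact: nbhs_singleton fg.
  have sh : {for 0, continuous (shift x : V -> V)} by apply: cvgD; [exact: cvg_id|exact: cvg_cst].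
  have fg' : \forall y \near (0 : V), f (y + x) = g (y + x).
    apply: (@cont_near _ _ (shift x) (0 : V) [set y | f y = g y] sh).
    by rewrite /shift /= add0r; exact: fg.
  move=> H; apply: filterS2 fg' H => y yE.
  by rewrite !fctE /= -yE -gx.
have dE := diff_unique dc E.
by apply/diff_locallyP; rewrite dE.
Qed.

Lemma Ck_onS (V W : normedModType R) k (U : set V) (f : V -> W) : Ck_on k.+1 U f <->
  (forall x, U x -> differentiable f x) /\ (forall v : V, Ck_on k U ('D_v f)).
Proof. by []. Qed.

Lemma Ck_onW (V W : normedModType R) k (U : set V) (f : V -> W) : Ck_on k.+1 U f -> Ck_on k U f.
Proof.
elim: k f => [|k IH] f /Ck_onS [fd fD].
  by move=> x Ux; apply: differentiable_continuous; exact: fd.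
by apply/Ck_onS; split => // v; apply: IH; exact: fD.
Qed.

(** Openness of [U] turns equality on [U] into equality near each of its points, which passes to
    directional derivatives. Derivatives are thereby replaced by their formulas. *)
Lemma Ck_on_ext (V W : normedModType R) k (U : set V) (f g : V -> W) : open U ->
  (forall x, U x -> f x = g x) -> Ck_on k U f -> Ck_on k U g.
Proof.
move=> oU; elim: k f g => [|k IH] f g fg.
  move=> fc x Ux; have nE : \forall y \near x, f y = g y.
    by apply: filterS (open_nbhs_nbhs (conj oU Ux)) => y; exact: fg.
  apply: (@cvg_trans _ (f y @[y --> x])); first by apply: near_eq_cvg; apply: filterS nE => y ->.
  by rewrite -fg//; exact: fc.
move=> /Ck_onS [fd fD]; apply/Ck_onS.
have nE x : U x -> \forall y \near x, f y = g y.
  by move=> Ux; apply: filterS (open_nbhs_nbhs (conj oU Ux)) => y; exact: fg.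
split.
  by move=> x Ux; apply: near_eq_differentiable (nE _ Ux) (fd _ Ux).
by move=> v; apply: (IH ('D_v f)) => // x Ux; apply: near_eq_derive; exact: nE.
Qed.

Lemma Ck_on_cst (V W : normedModType R) k (U : set V) (a : W) : Ck_on k U (cst a : V -> W).
Proof.
elim: k a => [|k IH] a; first by move=> x _; exact: cvg_cst.
apply/Ck_onS; split => [x _|v]; first exact: differentiable_cst.
suff -> : 'D_v (cst a : V -> W) = cst 0 by exact: IH.
by apply/funext => x; rewrite derive_cst.
Qed.

Section Algebra.
Context {V : normedModType R} (U : set V).
Hypothesis oU : open U.

Lemma Ck_on_add k (W : normedModType R) (f g : V -> W) :
  Ck_on k U f -> Ck_on k U g -> Ck_on k U (fun x => f x + g x).
Proof.
elim: k f g => [|k IH] f g; first by move=> fc gc x Ux; apply: cvgD; [exact: fc|exact: gc].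
move=> /Ck_onS [fd fD] /Ck_onS [gd gD]; apply/Ck_onS; split=> [x Ux|v].
  by apply: differentiableD; [exact: fd|exact: gd].
apply: (Ck_on_ext (f := fun x => 'D_v f x + 'D_v g x)) => //; last exact: IH.
by move=> x Ux; rewrite -deriveD//; apply: diff_derivable; [exact: fd|exact: gd].
Qed.

Lemma Ck_on_mul k (f g : V -> R) :
  Ck_on k U f -> Ck_on k U g -> Ck_on k U (fun x => f x * g x).
Proof.
elim: k f g => [|k IH] f g; first by move=> fc gc x Ux; apply: cvgM; [exact: fc|exact: gc].
move=> /[dup] /Ck_onW f' /Ck_onS [fd fD] /[dup] /Ck_onW g' /Ck_onS [gd gD]; apply/Ck_onS; split=> [x Ux|v].
  by apply: differentiableM; [exact: fd|exact: gd].
apply: (Ck_on_ext (f := fun x => f x * 'D_v g x + g x * 'D_v f x)) => //.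
  by move=> x Ux; rewrite -[RHS]/('D_v (f * g) x) deriveM//; apply: diff_derivable; [exact: fd|exact: gd].
by apply: Ck_on_add; apply: IH.
Qed.

Lemma Ck_on_inv k (f : V -> R) : (forall x, U x -> f x != 0) ->
  Ck_on k U f -> Ck_on k U (fun x => (f x)^-1).
Proof.
move=> f0; elim: k => [|k IH]; first by move=> fc x Ux; apply: cvgV; [exact: f0|exact: fc].
move=> /[dup] /Ck_onW f' /Ck_onS [fd fD]; apply/Ck_onS; split=> [x Ux|v].
  by apply: differentiableV; [exact: fd|exact: f0].
apply: (Ck_on_ext (f := fun x => (cst (-1) x * ((f x)^-1 * (f x)^-1)) * 'D_v f x)) => //.
  move=> x Ux; rewrite deriveV ?f0//; last by apply: diff_derivable; exact: fd.
  by rewrite /GRing.scale /= -exprVn expr2 mulN1r.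
by apply: Ck_on_mul => //; apply: Ck_on_mul; [exact: Ck_on_cst|apply: Ck_on_mul; exact: IH].
Qed.

Lemma Ck_on_linear k (W : normedModType R) (f : {linear V -> W}) : continuous f -> Ck_on k U f.
Proof.
move=> fc; case: k => [|k]; first by move=> x _; exact: fc.
apply/Ck_onS; split=> [x Ux|v]; first exact: linear_differentiable.
suff -> : 'D_v f = cst (f v) by exact: Ck_on_cst.
apply/funext => x; rewrite deriveE ?diff_lin//; exact: linear_differentiable.
Qed.

Lemma Ck_on_linear_comp k (W1 W2 : normedModType R) (F : {linear W1 -> W2}) (f : V -> W1) :
  continuous F -> Ck_on k U f -> Ck_on k U (fun x => F (f x)).
Proof.
move=> Fc; elim: k f => [|k IH] f.
  by move=> fc x Ux; apply: (cvg_comp _ F (fc _ Ux)); exact: Fc.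
move=> /Ck_onS [fd fD].
have Fd z : differentiable F z by exact: linear_differentiable.
apply/Ck_onS; split=> [x Ux|v].
  by apply: (@differentiable_comp _ _ _ _ f F); [exact: fd|exact: Fd].
apply: (Ck_on_ext (f := fun x => F ('D_v f x))) => //; last exact: IH.
move=> x Ux; have fxd := fd _ Ux.
rewrite -[RHS]/('D_v (F \o f) x) [RHS]deriveE; last exact: differentiable_comp.
by rewrite [X in _ = X v]diff_comp//= diff_lin//= deriveE.
Qed.

Lemma Ck_on_fst k (f : V -> plane R) : Ck_on k U f -> Ck_on k U (fun x => (f x).1).
Proof.
have lin : linear (fst : plane R -> R) by move=> a u v.
pose L := GRing.isLinear.Build _ _ _ _ (fst : plane R -> R) lin.
pose F : {linear plane R -> R} := HB.pack (fst : plane R -> R) L.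
by apply: (@Ck_on_linear_comp k _ _ F) => z; exact: cvg_fst.
Qed.

Lemma Ck_on_snd k (f : V -> plane R) : Ck_on k U f -> Ck_on k U (fun x => (f x).2).
Proof.
have lin : linear (snd : plane R -> R) by move=> a u v.
pose L := GRing.isLinear.Build _ _ _ _ (snd : plane R -> R) lin.
pose F : {linear plane R -> R} := HB.pack (snd : plane R -> R) L.
by apply: (@Ck_on_linear_comp k _ _ F) => z; exact: cvg_snd.
Qed.

Lemma derive_pairE (f g : V -> R) x v : differentiable f x -> differentiable g x ->
  'D_v (fun y => (f y, g y) : plane R) x = ('D_v f x, 'D_v g x).
Proof.
move=> fd gd; rewrite deriveE; last exact: differentiable_pair.
by rewrite diff_pair//= !deriveE.
Qed.

Lemma Ck_on_pair k (f g : V -> R) : Ck_on k U f -> Ck_on k U g ->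
  Ck_on k U (fun x => (f x, g x) : plane R).
Proof.
elim: k f g => [|k IH] f g; first by move=> fc gc x Ux; exact: (cvg_pair (fc _ Ux) (gc _ Ux)).
move=> /Ck_onS [fd fD] /Ck_onS [gd gD]; apply/Ck_onS; split=> [x Ux|v].
  by apply: differentiable_pair; [exact: fd|exact: gd].
apply: (Ck_on_ext (f := fun x => ('D_v f x, 'D_v g x))) => //; last exact: IH.
by move=> x Ux; rewrite derive_pairE//; [exact: fd|exact: gd].
Qed.

Lemma derive_chain (f : plane R -> R) (g : V -> plane R) x v : differentiable g x ->
  differentiable f (g x) -> 'D_v (fun y => f (g y)) x =
    ('D_v g x).1 * 'D_((1, 0) : plane R) f (g x) + ('D_v g x).2 * 'D_((0, 1) : plane R) f (g x).
Proof.
move=> gd fd; rewrite -[LHS]/('D_v (f \o g) x) deriveE; last exact: differentiable_comp.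
by rewrite diff_comp//= -[X in 'd f _ X]deriveE// -[LHS](deriveE ('D_v g x) fd) derive_plane.
Qed.

(** [Ck_on] differentiates in fixed directions, whereas the chain rule differentiates [f] in the
    varying direction ['D_v g]; the latter is expanded in the basis of the plane. *)
Lemma Ck_on_comp k (O : set (plane R)) (f : plane R -> R) (g : V -> plane R) :
  (forall x, U x -> O (g x)) -> Ck_on k O f -> Ck_on k U g -> Ck_on k U (fun x => f (g x)).
Proof.
move=> UO; elim: k f => [|k IH] f.
  move=> fc gc x Ux; apply: (cvg_comp g f); first exact: gc.
  by apply: fc; exact: UO.
move=> /Ck_onS [fd fD] /[dup] /Ck_onW g' /Ck_onS [gd gD]; apply/Ck_onS; split=> [x Ux|v].
  by apply: differentiable_comp; [exact: gd|apply: fd; exact: UO].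
apply: (Ck_on_ext (f := fun x => ('D_v g x).1 * 'D_((1, 0) : plane R) f (g x) +
    ('D_v g x).2 * 'D_((0, 1) : plane R) f (g x))) => //.
  by move=> x Ux; rewrite [RHS]derive_chain//; [exact: gd|apply: fd; exact: UO].
apply: Ck_on_add; apply: Ck_on_mul.
- exact: Ck_on_fst.
- exact: (IH _ (fD _) g').
- exact: Ck_on_snd.
- exact: (IH _ (fD _) g').
Qed.

End Algebra.

Section Planes.
Implicit Types (U : set (plane R)).

Lemma Ck_on_id k U : Ck_on k U (fun z : plane R => z).
Proof. by apply: (@Ck_on_linear _ U k _ idfun) => z; exact: cvg_id. Qed.

Lemma smooth_on_comp U (O : set (plane R)) (f g : plane R -> plane R) : open U -> open O ->
  (forall x, U x -> O (g x)) -> smooth_on O f -> smooth_on U g -> smooth_on U (fun x => f (g x)).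
Proof.
move=> oU oO UO fs gs k.
have -> : (fun x => f (g x)) = (fun x => ((f (g x)).1, (f (g x)).2)).
  by apply/funext => x; case: (f (g x)).
apply: Ck_on_pair => //.
  by apply: (@Ck_on_comp _ _ oU k O (fun z => (f z).1)) => //; exact: Ck_on_fst.
by apply: (@Ck_on_comp _ _ oU k O (fun z => (f z).2)) => //; exact: Ck_on_snd.
Qed.

Lemma Ck_on_quadratic k U (X : plane R -> plane R) : open U -> quadratic_field X -> Ck_on k U X.
Proof.
move=> oU /quadratic_fieldP[a [b [d [a' [b' [d' h]]]]]].
have Ck1 : Ck_on k U (fun z : plane R => z.1) by apply: Ck_on_fst => //; exact: Ck_on_id.
have Ck2 : Ck_on k U (fun z : plane R => z.2) by apply: Ck_on_snd => //; exact: Ck_on_id.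
have -> : X = fun z => (a * (z.1 * z.1) + b * (z.1 * z.2) + d * (z.2 * z.2),
                   a' * (z.1 * z.1) + b' * (z.1 * z.2) + d' * (z.2 * z.2)).
  by apply/funext => z; rewrite h !expr2 !mulrA.
have mon (u : R) (f g : plane R -> R) : Ck_on k U f -> Ck_on k U g -> Ck_on k U (fun z => u * (f z * g z)).
  by move=> hf hg; apply: Ck_on_mul => //; [exact: Ck_on_cst|exact: Ck_on_mul].
by apply: Ck_on_pair => //; do 2?[apply: Ck_on_add => //]; exact: mon.
Qed.

End Planes.
End Smooth.

Lemma near0_ball (R : realType) (r : R) (P : R -> Prop) : 0 < r -> (forall s, `|s| < r -> P s) ->
  \forall s \near (0 : R), P s.
Proof.
by move=> r0 H; apply/nbhs_ballP; exists r => // s; rewrite /ball /= sub0r normrN; exact: H.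
Qed.

Lemma constant_sign (R : realType) (W : R -> R) (r s1 s : R) :
  (forall x, 0 < x < r -> {for x, continuous W}) -> (forall x, 0 < x < r -> W x != 0) ->
  0 < s1 < r -> 0 < s < r -> W s1 < 0 -> W s < 0.
Proof.
move=> Wc W0 s1r sr W1; rewrite ltNge; apply/negP => Ws.
have /andP[m0 mr] : 0 < Num.min s s1 < r.
  by move: s1r sr => /andP[a b] /andP[c d]; rewrite lt_min a c gt_min d.
have Mr : Num.max s s1 < r by move: s1r sr => /andP[a b] /andP[c d]; rewrite gt_max b d.
have mM : Num.min s s1 <= Num.max s s1 by rewrite ge_min le_max lexx.
have inr x : Num.min s s1 <= x <= Num.max s s1 -> 0 < x < r.
  by move=> /andP[a b]; rewrite (lt_le_trans m0 a) (le_lt_trans b Mr).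
have [||z] := @IVT R W (Num.min s s1) (Num.max s s1) 0 mM.
- apply: continuous_in_subspaceT => x; rewrite inE /= in_itv /= => xI.
  by apply: Wc; exact: inr.
- have [le|lt] := leP s s1; first by rewrite ge_min (ltW W1) orbT le_max Ws.
  by rewrite ge_min (ltW W1) le_max Ws orbT.
rewrite in_itv /= => /inr zr Wz.
by have := W0 _ zr; rewrite Wz eqxx.
Qed.

(** * Exit points of a block *)

Section OutCurve.
Context {R : realType}.
Implicit Types (X f : plane R -> plane R) (N : set (plane R)) (c : R -> plane R).

Notation e1 := ((1, 0) : plane R).
Notation e2 := ((0, 1) : plane R).

Definition line (z v : plane R) (t : R) : plane R := (z.1 + t * v.1, z.2 + t * v.2).

Lemma line0 z v : line z v 0 = z.
Proof. by case: z => x y; rewrite /line /= !mul0r !addr0. Qed.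

Lemma derive_line z v (t : R) : is_derive t (1 : R) (line z v) v.
Proof.
rewrite [v in X in is_derive _ _ _ X]surjective_pairing.
by apply: derive_pair; apply: (derive_ext (derive_add (derive_const t _)
     (derive_mul (derive_var t) (derive_const t _)))) => //; rewrite mulr0 mulr1 !add0r.
Qed.

Lemma line_cont z v (t : R) : {for t, continuous (line z v)}.
Proof. by have [h _] := derive_line z v t; apply/differentiable_continuous/derivable1_diffP. Qed.

Lemma derive_along_line (f : plane R -> plane R) z v : differentiable f z ->
  is_derive 0 (1 : R) (fun t => f (line z v t)) ('D_v f z).
Proof.
move=> fd; rewrite -[X in 'D_v f X](line0 z v); apply: derive_along; last exact: derive_line.
by rewrite line0.
Qed.

Lemma chart_inv_derive N p (d : boundary_chart N p) v w : chart_cod d w ->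
  'D_('D_v (chart_inv d) w) (d : plane R -> plane R) (chart_inv d w) = v.
Proof.
move=> cw; have [Dw Kw] := chart_invK cw.
have h1 := derive_along_line v (smooth_diff (chart_inv_smooth d) cw).
have fd : differentiable (d : plane R -> plane R) (chart_inv d (line w v 0)).
  by rewrite line0; exact: chart_diff.
have := derive_along fd h1; rewrite line0.
have hE : \forall t \near (0 : R), d (chart_inv d (line w v t)) = line w v t.
  have : \forall t \near (0 : R), chart_cod d (line w v t).
    apply: (@cont_near _ _ (line w v) (0 : R) (chart_cod d) (@line_cont w v 0)).
    by rewrite line0; exact: chart_cod_nbhs.
  by apply: filterS => t /chart_invK[].
move=> /(near_eq_is_derive hE)[_ <-].
by have [_ ->] := derive_line w v 0.
Qed.

Definition chart_normal N p (d : boundary_chart N p) (z v : plane R) : R :=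
  ('D_v (d : plane R -> plane R) z).2.

Lemma chart_normal_linear N p (d : boundary_chart N p) z : chart_dom d z ->
  exists a b : R, forall v, chart_normal d z v = v.1 * a + v.2 * b.
Proof.
move=> /chart_diff dd.
exists ('D_e1 (d : plane R -> plane R) z).2, ('D_e2 (d : plane R -> plane R) z).2 => v.
by rewrite /chart_normal [in LHS](derive_plane _ dd).
Qed.

Lemma chart_normalN N p (d : boundary_chart N p) z v : chart_dom d z ->
  chart_normal d z (- v) = - chart_normal d z v.
Proof. by move=> /chart_normal_linear[a [b E]]; rewrite (E (- v)) (E v) /=; ring. Qed.

Lemma chart_normalD N p (d : boundary_chart N p) z (u v : plane R) (e : R) : chart_dom d z ->
  chart_normal d z (u.1 + e * v.1, u.2 + e * v.2) = chart_normal d z u + e * chart_normal d z v.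
Proof.
by move=> /chart_normal_linear[a [b E]]; rewrite (E (_, _)) (E u) (E v) /=; ring.
Qed.

Lemma chart_normal_derive N p (d : boundary_chart N p) z v : chart_dom d z ->
  is_derive 0 (1 : R) (fun t => (d (line z v t)).2) (chart_normal d z v).
Proof. by move=> Dz; exact: derive_snd (derive_along_line v (chart_diff Dz)). Qed.

Lemma chart_dom_line N p (d : boundary_chart N p) z v : chart_dom d z ->
  \forall t \near 0^'+, chart_dom d (line z v t).
Proof.
move=> Dz; have : \forall t \near (0 : R), chart_dom d (line z v t).
  apply: (@cont_near _ _ (line z v) (0 : R) (chart_dom d) (@line_cont z v 0)).
  by rewrite line0; exact: chart_dom_nbhs.
by rewrite /at_right near_withinE; apply: filterS => t Dt _.
Qed.

(** The two charts communicate through [N]: a ray that rises in the first chart is in [N] for small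
    times, so its height in the second chart is nonnegative. *)
Lemma chart_inward N p1 p2 (d1 : boundary_chart N p1) (d2 : boundary_chart N p2) z v :
  chart_dom d1 z -> chart_dom d2 z -> (d1 z).2 = 0 -> (d2 z).2 = 0 ->
  0 < chart_normal d1 z v -> 0 <= chart_normal d2 z v.
Proof.
move=> D1z D2z z1 z2 v1; rewrite leNgt; apply/negP => v2.
have h1 := chart_normal_derive v D1z.
have h2 := chart_normal_derive v D2z.
have [||s1 _] := sign_near0 h1; [by rewrite line0|by rewrite gt_eqF|].
have [||s2 _] := sign_near0 h2; [by rewrite line0|by rewrite lt_eqF|].
have i1 := chart_dom_line v D1z; have i2 := chart_dom_line v D2z.
near ((0 : R)^'+) => t.
have D1t : chart_dom d1 (line z v t) by near: t.
have D2t : chart_dom d2 (line z v t) by near: t.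
have : 0 < chart_normal d1 z v * (d1 (line z v t)).2 by near: t.
rewrite pmulr_rgt0// => /ltW/(chart_slice D1t)/(chart_slice D2t) ge0.
have : 0 < chart_normal d2 z v * (d2 (line z v t)).2 by near: t.
by rewrite ltNge mulr_le0_ge0// ltW.
Unshelve. all: by end_near.
Qed.

(** A vector tangent for [d1] and strictly inward for [d2], corrected by a small multiple of a
    vector [w] outward for [d1], would be inward for [d2] and outward for [d1]. Hence [tangency],
    stated with some chart, can be tested in any chart. *)
Lemma chart_tangent_independent N p1 p2 (d1 : boundary_chart N p1) (d2 : boundary_chart N p2) z v :
  chart_dom d1 z -> chart_dom d2 z -> (d1 z).2 = 0 -> (d2 z).2 = 0 ->
  chart_normal d1 z v = 0 -> chart_normal d2 z v = 0.
Proof.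
move=> D1z D2z z1 z2.
suff pos (u : plane R) : chart_normal d1 z u = 0 -> chart_normal d2 z u <= 0.
  move=> v1; apply/eqP; rewrite eq_le pos//=.
  by have := pos (- v); rewrite (chart_normalN v D1z) (chart_normalN v D2z) v1 oppr0 oppr_le0; apply.
move=> u1; rewrite leNgt; apply/negP => u2.
have [cz Kz] := chartK D1z.
pose w : plane R := 'D_((0, -1) : plane R) (chart_inv d1) (d1 z).
have w1 : chart_normal d1 z w = -1.
  by have := chart_inv_derive (0, -1) cz; rewrite Kz /chart_normal -/w => ->.
pose A : R := chart_normal d2 z u; pose B : R := chart_normal d2 z w.
(* Small enough for [e * |B| < A], so that the correction does not destroy the inward direction in
   [d2]. *)
pose e : R := A / (`|B| + 1) / 2.
have e0 : 0 < e by rewrite !divr_gt0// ltr_wpDl.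
have eB : 0 < A + e * B.
  have : e * `|B| < A.
    have -> : e * `|B| = A * (`|B| / (`|B| + 1) / 2) by rewrite /e; field; rewrite gt_eqF// ltr_wpDl.
    rewrite gtr_pMr// -mulrA -invfM ltr_pdivrMr ?mulr_gt0 ?ltr_wpDl//.
    have := normr_ge0 B; clear; lra.
  have h : - (e * B) <= e * `|B| by rewrite -mulrN ler_wpM2l ?(ltW e0)// -normrN ler_norm.
  by move=> h'; rewrite -[e * B]opprK subr_gt0; exact: le_lt_trans h h'.
have := @chart_inward N p2 p1 d2 d1 z (u.1 + e * w.1, u.2 + e * w.2) D2z D1z z2 z1.
rewrite (chart_normalD u w e D2z) (chart_normalD u w e D1z) u1 w1 -/A -/B => /(_ eB).
by rewrite add0r mulrN1 oppr_ge0 leNgt e0.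
Qed.

(** By homogeneity the orbit is sought as [rho m] times the point [q + m * X q] of a line, which
    leaves a scalar linear equation for [rho]. If [q] and [X q] are collinear, the orbit is radial
    and explicit. *)
Lemma local_orbit X q : quadratic_field X -> exists (e : R) c, [/\ 0 < e, c 0 = q &
  forall s : R, 0 <= s <= e -> is_derive s (1 : R) c (X (c s))].
Proof.
move=> hX; pose v := q; pose w := X q.
have [a [b [d [a' [b' [d' XE]]]]]] := quadratic_fieldP hX.
have scal (k : R) (z : plane R) : X (k * z.1, k * z.2) = (k ^+ 2 * (X z).1, k ^+ 2 * (X z).2).
  by rewrite !XE /=; congr (_, _); ring.
pose det (x y : plane R) := x.1 * y.2 - x.2 * y.1.
have [vw0|vw0] := eqVneq (det v w) 0.
  have [v0|v0] := eqVneq v 0.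
    exists 1, (fun=> 0); split => // s _.
    by rewrite (quadratic0 hX); apply: is_derive_cst.
  have [la [w1 w2]] : exists la, w.1 = la * v.1 /\ w.2 = la * v.2.
    have [x0|x0] := eqVneq v.1 0.
      have y0 : v.2 != 0.
        by apply: contra_neq v0 => y0; rewrite [LHS]surjective_pairing x0 y0.
      exists (w.2 / v.2); rewrite divfK// x0 mulr0; split => //.
      by move: vw0; rewrite /det x0 mul0r sub0r => /eqP; rewrite oppr_eq0 mulf_eq0 (negbTE y0) => /eqP.
    exists (w.1 / v.1); rewrite divfK//; split => //.
    move: vw0; rewrite /det => /eqP; rewrite subr_eq0 => /eqP vw0.
    by apply: (mulfI x0); rewrite vw0; field.
  pose e := 1 / 2 / (`|la| + 1).
  have e0 : 0 < e by rewrite !divr_gt0// ltr_wpDl.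
  exists e, (fun s => ((1 - la * s)^-1 * v.1, (1 - la * s)^-1 * v.2)); split => //.
    by rewrite mulr0 subr0 invr1 !mul1r /v; case: q {v w vw0 v0 w1 w2}.
  move=> s /andP[s0 se].
  have den : 0 < 1 - la * s.
    rewrite subr_gt0; apply: (le_lt_trans (ler_norm _)); rewrite normrM (ger0_norm s0).
    apply: (@le_lt_trans _ _ (`|la| * e)); first exact: ler_wpM2l.
    rewrite /e mulrA ltr_pdivrMr ?ltr_wpDl// mul1r.
    by have := normr_ge0 la; clear; lra.
  rewrite scal /= -/w w1 w2.
  have di : is_derive s (1 : R) (fun s => (1 - la * s)^-1) ((1 - la * s)^-1 ^+ 2 * la).
    apply: (derive_ext (derive_inv (f := fun s => 1 - la * s) _ (derive_sub (derive_const s 1)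
       (derive_mul (derive_const s la) (derive_var s))))) => //; first by rewrite gt_eqF.
    by field; rewrite gt_eqF.
  apply: derive_pair.
    by apply: (derive_ext (derive_mul di (derive_const s v.1))) => //; ring.
  by apply: (derive_ext (derive_mul di (derive_const s v.2))) => //; ring.
pose P m := X (line v w m).
have Pc (m : R) : {for m, continuous P}.
  by apply: continuous_comp; [exact: line_cont|exact: quadratic_continuous].
pose A m := det (P m) w / det v w; pose B m := det v (P m) / det v w.
have PE m : P m = (A m * v.1 + B m * w.1, A m * v.2 + B m * w.2).
  rewrite [LHS]surjective_pairing /A /B /det; congr (_, _); field; exact: vw0.
have P1c (m : R) : {for m, continuous (fun m => (P m).1)}.
  by apply: (cvg_comp _ fst (Pc m)); exact: cvg_fst.
have P2c (m : R) : {for m, continuous (fun m => (P m).2)}.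
  by apply: (cvg_comp _ snd (Pc m)); exact: cvg_snd.
have Ac (m : R) : {for m, continuous A}.
  by apply: cvgM; [apply: cvgB; apply: cvgM => //; [exact: P1c|exact: cvg_cst|exact: P2c|exact: cvg_cst]|exact: cvg_cst].
have Bc (m : R) : {for m, continuous B}.
  by apply: cvgM; [apply: cvgB; apply: cvgM => //; [exact: cvg_cst|exact: P2c|exact: cvg_cst|exact: P1c]|exact: cvg_cst].
(* Writing [X] on the line as [A v + B w], tangency of the curve to [X] reads [rho' / rho = A / h],
   and the speed factor is [rho * h]; both make sense near 0 because [h 0 = 1]. *)
pose h m := B m - m * A m.
have hc (m : R) : {for m, continuous h}.
  by apply: cvgB; [exact: Bc|apply: cvgM; [exact: cvg_id|exact: Ac]].
have P0 : P 0 = w by rewrite /P line0.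
have h0 : h 0 = 1 by rewrite /h mul0r subr0 /B P0 divff.
have : \forall m \near (0 : R), 0 < h m.
  by apply: (@cont_near _ _ h (0 : R) [set x | 0 < x] (hc 0)); rewrite h0; exact: lt_nbhsr.
move=> /nbhs_ballP[r /= r0 rh].
have hpos m : - r < m < r -> 0 < h m.
  by move=> mr; apply: rh; rewrite /ball /= sub0r normrN ltr_norml.
have qc m : - r < m < r -> {for m, continuous (fun m => A m / h m)}.
  move=> mr; apply: cvgM; first exact: Ac.
  by apply: cvgV; [rewrite gt_eqF// hpos|exact: hc].
have r1 : - r < - (r / 2) by rewrite ltrN2 ltr_pdivrMr// ltr_pMr// ltr1n.
have r2 : r / 2 < r by rewrite ltr_pdivrMr// ltr_pMr// ltr1n.
have [F dF] := antiderivative r1 r2 qc.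
pose rho m := expR (F m - F 0).
have drho m : - (r / 2) < m < r / 2 -> is_derive m (1 : R) rho (rho m * (A m / h m)).
  move=> mr; apply: derive_expR.
  by apply: (derive_ext (derive_sub (dF _ mr) (derive_const m (F 0)))) => //; rewrite subr0.
have sub m : - (r / 2) < m < r / 2 -> - r < m < r.
  by move=> /andP[m1 m2]; rewrite (lt_trans r1 m1) (lt_trans m2 r2).
have r40 : 0 < r / 4 by rewrite divr_gt0.
have r42 : r / 4 < r / 2 by move: r0; clear; lra.
have [] := @reparam _ X (fun m => rho m * (line v w m).1) (fun m => rho m * (line v w m).2)
   (fun m => rho m * w.1 + (line v w m).1 * (rho m * (A m / h m)))
   (fun m => rho m * w.2 + (line v w m).2 * (rho m * (A m / h m)))
   (fun m => rho m * h m) (- (r / 2)) (r / 2) 0 (r / 4).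
- by rewrite oppr_lt0 divr_gt0.
- exact: ltW.
- by [].
- by move=> m mr; apply: (derive_mul (drho _ mr) (derive_fst (derive_line v w m))).
- by move=> m mr; apply: (derive_mul (drho _ mr) (derive_snd (derive_line v w m))).
- by move=> m mr; apply: cvgM; [exact: derive_cont (drho _ mr)|exact: hc].
- by move=> m mr; rewrite mulr_gt0 ?expR_gt0// hpos// sub.
- move=> m mr; rewrite scal -/(P m) PE /=.
  have hn : h m != 0 by rewrite gt_eqF// hpos// sub.
  have BE : B m = h m + m * A m by rewrite /h subrK.
  by congr (_, _); rewrite BE; field.
move=> T [c [T0 c0 cT hc' _]].
have rho0 : rho 0 = 1 by rewrite /rho subrr expR0.
have c0' : c 0 = q by rewrite c0 rho0 !mul1r line0 /v; case: q {v w vw0 PE P Pc A B h P1c P2c Ac Bc hc P0 h0 rh hpos qc dF drho c0 cT rho0}.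
exists T, c; split => //.
(* The end of the curve is not collinear with [q], hence differs from it, so the time elapsed is not
   0. *)
rewrite lt_neqAle T0 andbT; apply/negP => /eqP TE.
have : det v (c T) = 0 by rewrite -TE c0' /det mulrC subrr.
move=> /eqP; rewrite cT /det /=.
have -> : v.1 * (rho (r / 4) * (v.2 + r / 4 * w.2)) - v.2 * (rho (r / 4) * (v.1 + r / 4 * w.1)) =
   rho (r / 4) * (r / 4) * det v w by rewrite /det; ring.
by rewrite !mulf_eq0 (negbTE vw0) !gt_eqF ?expR_gt0.
Qed.

Lemma smooth_on_chart_speed X N p (d : boundary_chart N p) : quadratic_field X ->
  smooth_on (chart_cod d) (fun w => chart_speed d X (chart_inv d w)).
Proof.
move=> hX k; have oD := @chart_dom_open _ _ _ d; have oC := @chart_cod_open _ _ _ d.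
apply: (@Ck_on_comp _ _ _ oC k (chart_dom d) (chart_speed d X)).
- by move=> w /chart_invK[].
- apply: (Ck_on_ext (f := fun w => (X w).1 * ('D_e1 (d : plane R -> plane R) w).2 +
                             (X w).2 * ('D_e2 (d : plane R -> plane R) w).2)) => //.
    by move=> w Dw; rewrite /chart_speed [in RHS]derive_plane//; apply: chart_diff.
  apply: Ck_on_add => //; apply: Ck_on_mul => //.
  + by apply: Ck_on_fst => //; exact: Ck_on_quadratic.
  + by apply: Ck_on_snd => //; exact: (smooth_derive e1 (chart_smooth d)).
  + by apply: Ck_on_snd => //; exact: Ck_on_quadratic.
  + by apply: Ck_on_snd => //; exact: (smooth_derive e2 (chart_smooth d)).
- exact: chart_inv_smooth.
Qed.

(** The mean value theorem in the vertical variable only. It yields the differential inequality for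
    the depth below the boundary in [n_out_one_side]. *)
Lemma smooth_vertical_lipschitz (U : set (plane R)) (W : plane R -> R) : open U -> U 0 -> smooth_on U W ->
  exists r L : R, [/\ 0 < r, 0 <= L & forall x y : R, `|x| < r -> - r < y -> y <= 0 ->
     W (x, 0) + L * y <= W (x, y)].
Proof.
move=> oU U0 sW; pose D := 'D_e2 W.
have Dc : {for (0 : plane R), continuous D} by apply: smooth_cont U0; exact: smooth_derive.
have nb : nbhs (0 : plane R) [set z | U z /\ D z < `|D 0| + 1].
  apply: filterI; first exact: open_nbhs_nbhs.
  apply: (@cont_near _ _ D (0 : plane R) [set x : R | x < `|D 0| + 1] Dc).
  by apply: lt_nbhsl; apply: (le_lt_trans (ler_norm _)); rewrite ltrDl.
have [r r0 rP] := nbhs_box nb.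
exists r, (`|D 0| + 1); split => //.
move=> x y xr yr y0.
have inr s : y <= s <= 0 -> U (x, s) /\ D (x, s) < `|D 0| + 1.
  move=> /andP[ys s0]; apply: rP; rewrite /= subr0//.
  by rewrite ler0_norm// ltrNl; apply: lt_le_trans ys.
have [|c /andP[yc c0] E] := @MVT_cc _ y 0 (fun s => W (x, s)) (fun s => D (x, s)) y0.
  move=> s sy; have [Us _] := inr _ sy.
  have Wd : differentiable W (line (x, 0) e2 s).
    by rewrite /line /= mulr0 addr0 mulr1 add0r; exact: smooth_diff Us.
  have := derive_along Wd (derive_line (x, 0) e2 s).
  rewrite /line /= mulr0 addr0 mulr1 add0r => H.
  by apply: (derive_ext H) => // t; rewrite mulr0 addr0 mulr1 add0r.
have [_ Dc'] := inr _ (introT andP (conj yc c0)).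
have -> : W (x, y) = W (x, 0) + D (x, c) * y by move: E; clear; lra.
by rewrite lerD2l ler_wnM2r// ltW.
Qed.

(* If the boundary is nowhere crossed outwards near [q], then Gronwall's inequality for the vertical
   coordinate of the chart keeps the forward orbit of [q] in [N]. *)
Lemma n_out_one_side X N q (d : boundary_chart N q) : quadratic_field X -> n_out X N q ->
  ~ (\forall s \near (0 : R), 0 <= chart_speed d X (chart_curve d s)).
Proof.
move=> hX [bq [t t0 ht]] pos.
have [r [L [r0 L0 lip]]] := smooth_vertical_lipschitz (@chart_cod_open _ _ _ d) (chart_cod0 d)
  (smooth_on_chart_speed d hX).
move: pos => /nbhs_ballP[r' /= r'0 pos].
pose m := Num.min r r'; have m0 : 0 < m by rewrite lt_min r0.
have [Dq dq] := chart_center d.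
have nb : nbhs q [set z | chart_dom d z /\ (`|(d z).1| < m /\ `|(d z).2| < m)].
  apply: filterI; first exact: chart_dom_nbhs.
  apply: (@cont_near _ _ (d : plane R -> plane R) q [set z : plane R | `|z.1| < m /\ `|z.2| < m] (chart_cont Dq)).
  rewrite dq.
  by have := box_nbhs (0 : plane R) m0; apply: filterS => z; rewrite /= !subr0.
have [e e0 near_q] := orbit_stays_near hX nb.
have [T [c [T0 c0 hc]]] := local_orbit q hX.
pose s1 := Num.min (t / 2) (Num.min (e / 2) T).
have s10 : 0 < s1 by rewrite !lt_min !divr_gt0.
have s1t : s1 < t by rewrite gt_min ltr_pdivrMr// ltr_pMr// ltr1n.
have s1e : s1 < e by rewrite !gt_min [e / 2 < e]ltr_pdivrMr// ltr_pMr// ltr1n !orbT.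
have s1T : s1 <= T by rewrite !ge_min lexx !orbT.
have hc1 s : 0 <= s <= s1 -> is_derive s (1 : R) c (X (c s)).
  by move=> /andP[s0 ss]; apply: hc; rewrite s0 (le_trans ss).
have inb := near_q _ _ s1e c0 hc1.
pose u s := (d (c s)).2.
have uneg s : 0 < s <= s1 -> u s < 0.
  move=> /andP[s0 ss]; have sI : 0 <= s <= s1 by rewrite (ltW s0).
  have [Ds _] := inb _ sI; rewrite ltNge; apply/negP => us.
  apply: (ht s); first by rewrite s0 (le_lt_trans ss).
  exists (c s); last exact/(chart_slice Ds).
  apply/(flow_forward _ _ _ (ltW s0)); exists c; split => // v /andP[v0 vs].
  by apply: hc1; rewrite v0 (le_trans vs).
have u0 : u 0 = 0 by rewrite /u c0 dq.
have unonpos s : 0 <= s <= s1 -> u s <= 0.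
  move=> /andP[]; rewrite le_eqVlt => /predU1P[<-|s0 ss]; first by rewrite u0.
  by apply/ltW/uneg; rewrite s0.
have := @gronwall _ 0 s1 L (fun s => - u s) (fun s => - chart_speed d X (c s)) (ltW s10).
rewrite u0 oppr0 mul0r => H.
have : - u s1 <= 0.
  apply: H => s sI; first by apply: derive_opp; have [Ds _] := inb _ sI; exact: chart_speed_lie (hc1 _ sI).
  rewrite mulrN lerN2; have [Ds [x1 x2]] := inb _ sI.
  have [_ K] := chartK Ds; rewrite -K.
  have um : - r < u s.
    have := x2; rewrite lt_min => /andP[x2r _].
    by move: x2r; rewrite ltr_norml => /andP[].
  have x1r : `|(d (c s)).1| < r by move: x1; rewrite lt_min => /andP[].
  have := lip _ _ x1r um (unonpos _ sI).
  rewrite /u -surjective_pairing; apply: le_trans.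
  rewrite lerDr; apply: pos; rewrite /ball /= sub0r normrN.
  by move: x1; rewrite lt_min => /andP[].
by rewrite oppr_le0 leNgt uneg// s10 lexx.
Qed.

(** Even at a tangency one side of [q] on the boundary consists of exit points. This provides the
    room in which the value of a block map is moved by [extension_not_unique]. *)
Lemma n_out_curve X N q : quadratic_field X -> isolating_block X N -> n_out X N q ->
  exists (d : boundary_chart N q) (sg r : R), [/\ sg ^+ 2 = 1, 0 < r &
    forall s : R, 0 <= s < r -> chart_cod d (sg * s, 0) /\ n_out X N (chart_curve d (sg * s))].
Proof.
move=> hX bl qout; have bq : bd N q by case: qout.
have [d] := boundary_chart_exists bl bq; exists d.
have [Dq dq] := chart_center d.
have [W WE] : exists W : R -> R, forall s, W s = chart_speed d X (chart_curve d s).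
  by exists (fun s => chart_speed d X (chart_curve d s)).
have Wc s : chart_cod d (s, 0) -> {for s, continuous W}.
  move=> cs; have [Ds _] := chart_invK cs.
  have -> : W = fun s => chart_speed d X (chart_curve d s) by apply/funext.
  exact: (@continuous_comp _ _ _ (chart_curve d) (chart_speed d X) s (chart_curve_cont cs)
    (chart_speed_cont hX Ds)).
(* If [q] is a tangency, a nearby zero of [W] would be another one, against their isolation;
   otherwise [W 0] is nonzero already. *)
have nz : \forall s \near (0 : R), s != 0 -> W s != 0.
  have [[c ctan]|ntan] := pselect (tangency X N q).
    have [_ _ _ _ iso] := bl; have tq : tangency X N q by split.
    have [U nU UE] := iso _ tq.
    have cU : \forall s \near (0 : R), U (chart_curve d s).
      apply: (cont_near (chart_curve_cont (chart_cod0 d))).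
      by rewrite chart_curve0.
    near=> s => s0; apply/eqP => Ws.
    have [cs Ds ds bs] : [/\ chart_cod d (s, 0), chart_dom d (chart_curve d s),
     d (chart_curve d s) = (s, 0) & bd N (chart_curve d s)] by near: s; exact: chart_curve_near.
    have Us : U (chart_curve d s) by near: s.
    have [d2] := boundary_chart_exists bl bs.
    have [D2 z2] := chart_center d2.
    have : (tangency X N `&` U) (chart_curve d s).
      split => //; split => //; exists d2.
      apply: (@chart_tangent_independent N q (chart_curve d s) d d2 (chart_curve d s)) => //.
      - by rewrite ds.
      - by rewrite z2.
      - by move: Ws; rewrite WE.
    rewrite UE => /= E; move: ds; rewrite E dq => /(congr1 fst) /= /eqP.
    by rewrite eq_sym (negbTE s0).
  have W0 : W 0 != 0.
    apply/eqP => W0; apply: ntan; split => //; exists d.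
    by move: W0; rewrite WE chart_curve0.
  have : \forall s \near (0 : R), W s != 0.
    apply: (@cont_near _ _ W (0 : R) [set x | x != 0] (Wc _ (chart_cod0 d))).
    apply/nbhs_ballP; exists `|W 0|; rewrite /= ?normr_gt0// => x; rewrite /ball /=.
  by apply: contraTneq => ->; rewrite subr0 ltxx.
  by apply: filterS => s Ws _.
have : \forall s \near (0 : R), chart_cod d (s, 0) /\ (s != 0 -> W s != 0).
  near=> s; split; last by near: s.
  have [] : [/\ chart_cod d (s, 0), chart_dom d (chart_curve d s),
     d (chart_curve d s) = (s, 0) & bd N (chart_curve d s)] by near: s; exact: chart_curve_near.
  by [].
move=> /nbhs_ballP[r /= r0 hr].
(* A nonnegative speed all around [q] is excluded by [n_out_one_side]; a parameter [s1] of negative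
   speed designates the side, on which the sign is constant. *)
have [[s1 [s1r s1n W1]]|none] := pselect (exists s1, [/\ `|s1| < r, s1 != 0 & W s1 < 0]); last first.
  exfalso; apply: (n_out_one_side (d := d) hX qout).
  have Wge s : `|s| < r -> s != 0 -> 0 <= W s.
    by move=> sr s0; rewrite leNgt; apply/negP => Ws; apply: none; exists s.
  have W0 : 0 <= W 0.
    have W0c : W s @[s --> 0^'] --> W 0 by apply: cvg_within_filter; exact: (Wc _ (chart_cod0 d)).
    apply: (cvgr_to_ge W0c); rewrite /dnbhs near_withinE.
    by apply/nbhs_ballP; exists r => //= s; rewrite /ball /= sub0r normrN; exact: Wge.
  have Wall (s : R) : `|s| < r -> 0 <= chart_speed d X (chart_curve d s).
    rewrite -WE => sr; have [->|s0] := eqVneq s 0; [exact: W0|exact: Wge].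
  exact: (near0_ball r0 Wall).
pose sg := s1 / `|s1|.
have n0 : 0 < `|s1| by rewrite normr_gt0.
have sg2 : sg ^+ 2 = 1.
  by rewrite /sg expr_div_n real_normK ?num_real// divff// sqrf_eq0.
have sgn : `|sg| = 1 by rewrite /sg normrM normfV normr_id divff// gt_eqF.
have s1E : s1 = sg * `|s1| by rewrite /sg divfK// gt_eqF.
have sgr (s : R) : 0 <= s < r -> `|sg * s| < r.
  by move=> /andP[s0 sr]; rewrite normrM sgn mul1r ger0_norm.
have inr (s : R) : 0 <= s < r -> chart_cod d (sg * s, 0) /\ (sg * s != 0 -> W (sg * s) != 0).
  by move=> /sgr sr; apply: hr; rewrite /ball /= sub0r normrN.
have sgn0 : sg != 0 by rewrite -normr_gt0 sgn.
have Wneg (s : R) : 0 < s < r -> W (sg * s) < 0.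
  move=> sr; apply: (@constant_sign _ (fun s => W (sg * s)) r `|s1| s) => //.
  - move=> x /andP[x0 xr]; have [cx _] : chart_cod d (sg * x, 0) /\ (sg * x != 0 -> W (sg * x) != 0).
      by apply: inr; rewrite (ltW x0).
    have mc : {for x, continuous (fun x => sg * x)} by apply: cvgM; [exact: cvg_cst|exact: cvg_id].
    exact: (@continuous_comp _ _ _ (fun x => sg * x) W x mc (Wc _ cx)).
  - move=> x /andP[x0 xr]; have [|_] := inr x; first by rewrite (ltW x0).
    by apply; rewrite mulf_neq0// gt_eqF.
  - by rewrite n0.
  - by rewrite -s1E.
exists sg, r; split => // s /[dup] sr /andP[s0 sr'].
have [cs _] := inr _ sr; split => //.
move: s0; rewrite le_eqVlt => /predU1P[<-|s0]; first by rewrite mulr0 chart_curve0.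
have [Ds ds] := chart_invK cs.
apply: (n_out_of_speed (d := d) hX Ds); first by rewrite ds.
by have := WE (sg * s); rewrite /chart_curve => <-; apply: Wneg; rewrite s0.
Unshelve. all: by end_near.
Qed.

End OutCurve.

(** * Positive characteristic values *)

Section Node.
Context {R : realType}.
Implicit Types (X f : plane R -> plane R) (N : set (plane R)) (c : R -> plane R).

(** If [c s = 0], the reversed curve [- c (s - u)] is a solution issued from the origin, hence
    zero. *)
Lemma orbit_nonzero X c (t : R) : quadratic_field X ->
  (forall s : R, 0 <= s <= t -> is_derive s (1 : R) c (X (c s))) ->
  c 0 != 0 -> forall s : R, 0 <= s <= t -> c s != 0.
Proof.
move=> hX hc c0 s /andP[s0 st]; apply: contra_neq c0 => cs.
have sol u : 0 <= u <= s -> is_derive u (1 : R) (fun u => - c (s - u)) (X (- c (s - u))).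
  move=> /andP[u0 us]; rewrite (quadratic_even hX).
  have hr : is_derive (u - s) (1 : R) (fun v => - c (- v)) (X (c (- (u - s)))).
    by apply: derive_reverse; apply: hc; rewrite opprB subr_ge0 us/= lerBlDr ler_wpDr.
  have sh : is_derive u (1 : R) (fun u => u - s) 1.
    by apply: (derive_ext (derive_sub (derive_var u) (derive_const u s))) => //; rewrite subr0.
  have d1 := derive_comp (g := fun u => u - s) (derive_fst hr) sh.
  have d2 := derive_comp (g := fun u => u - s) (derive_snd hr) sh.
  have := derive_pair d1 d2; rewrite !mulr1 -surjective_pairing opprB.
  suff -> : (fun v => ((- c (- (v - s))).1, (- c (- (v - s))).2)) = (fun u => - c (s - u)) by [].
  by apply/funext => v; rewrite -surjective_pairing opprB.
have zero u : 0 <= u <= s -> is_derive u (1 : R) (fun=> 0 : plane R) (X 0).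
  by move=> _; rewrite quadratic0//; apply: is_derive_cst.
have := ode_unique hX sol zero; rewrite subr0 cs oppr0 => /(_ erefl s).
rewrite s0 lexx subrr => /(_ isT) /eqP; rewrite oppr_eq0 => /eqP //.
Qed.

Lemma cont_ge0_left (g : R -> R) (s : R) : 0 < s -> {for s, continuous g} ->
  (forall u : R, 0 <= u < s -> 0 <= g u) -> 0 <= g s.
Proof.
move=> s0 gc gu; rewrite leNgt; apply/negP => gs.
have : \forall u \near s, g u < 0.
  by apply: (@cont_near _ _ g s [set x | x < 0] gc); exact: lt_nbhsl.
move=> /nbhs_ballP[e /= e0 He].
pose u := Num.max 0 (s - e / 2).
have u0 : 0 <= u by rewrite le_max lexx.
have us : u < s by rewrite gt_max s0 ltrBlDr ltrDl divr_gt0.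
have : g u < 0.
  apply: He; rewrite /ball /= gtr0_norm ?subr_gt0// ltrBlDr -ltrBlDl.
  rewrite lt_max; apply/orP; right; rewrite ltrD2l ltrN2.
  by rewrite ltr_pdivrMr// ltr_pMr// ltr1n.
by rewrite ltNge gu// u0.
Qed.

Section Cone.
Variables (a b k d e : R).
Hypotheses (a0 : a < 0) (da : d < a).

(** A quadratic field with a characteristic direction on [y = 0]; its value there is [a / (d - a)],
    positive under the hypotheses of the section. *)
Definition node_field (z : plane R) : plane R :=
  (a * z.1 ^+ 2 + b * z.1 * z.2 + k * z.2 ^+ 2, z.2 * (d * z.1 + e * z.2)).

Lemma node_field_quadratic : quadratic_field node_field.
Proof. by split; [exists a, b, k|exists 0, d, e] => x y; rewrite /node_field /=; ring. Qed.

(* In the cone both [x] and the slope [|y| / x] decrease along the orbits. *)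
Lemma node_cone : exists2 del : R, 0 < del & forall t c,
  (forall s : R, 0 <= s <= t -> is_derive s (1 : R) c (node_field (c s))) ->
  0 < (c 0).1 -> `|(c 0).2| < del * (c 0).1 -> 0 <= t ->
  [/\ 0 < (c t).1, (c t).1 <= (c 0).1 & `|(c t).2| * (c 0).1 <= `|(c 0).2| * (c t).1].
Proof.
pose A : R := `|b| + `|k|; pose B : R := `|e - b| + `|k|.
have A0 : 0 <= A by rewrite addr_ge0.
have B0 : 0 <= B by rewrite addr_ge0.
(* In the cone [|y| <= del * x], the bounds [del * A <= - a] and [del * B <= a - d] let the leading
   terms of [x'] and of [x y' - y x'] dominate, and [del <= 1] gives [|y| <= x]. *)
pose del := Num.min 1 (Num.min (- a / (A + 1)) ((a - d) / (B + 1))).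
have del0 : 0 < del.
  have d1 : 0 < - a / (A + 1) by rewrite divr_gt0// ?oppr_gt0// ltr_wpDl.
  have d2 : 0 < (a - d) / (B + 1) by rewrite divr_gt0// ?subr_gt0// ltr_wpDl.
  by rewrite !lt_min ltr01 d1 d2.
have del1 : del <= 1 by rewrite ge_min lexx.
have delA : del * A <= - a.
  apply: (@le_trans _ _ (- a / (A + 1) * (A + 1))); last by rewrite divfK// gt_eqF// ltr_wpDl.
  by apply: ler_pM => //; [exact: ltW|rewrite /del !ge_min lexx !orbT|rewrite lerDl].
have delB : del * B <= a - d.
  apply: (@le_trans _ _ ((a - d) / (B + 1) * (B + 1))); last by rewrite divfK// gt_eqF// ltr_wpDl.
  by apply: ler_pM => //; [exact: ltW|rewrite /del !ge_min lexx !orbT|rewrite lerDl].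
have cone2 (u v x y : R) : 0 < x -> `|y| <= del * x -> `|u * x * y + v * y ^+ 2| <= del * (`|u| + `|v|) * x ^+ 2.
  move=> x0 yx; apply: (le_trans (ler_normD _ _)); rewrite !expr2 !normrM (gtr0_norm x0).
  have yx' : `|y| <= x by apply: (le_trans yx); rewrite ger_pMl.
  have h1 : `|u| * x * `|y| <= `|u| * x * (del * x).
    by apply: ler_wpM2l => //; rewrite mulr_ge0// ltW.
  have h2 : `|v| * (`|y| * `|y|) <= `|v| * (del * x * x).
    by apply: ler_wpM2l => //; apply: ler_pM.
  by apply: (le_trans (lerD h1 h2)); rewrite le_eqVlt; apply/orP; left; apply/eqP; ring.
exists del => // t c hc x00 y00 t0.
pose x s := (c s).1; pose y s := (c s).2.
have hX := node_field_quadratic.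
have dx s : 0 <= s <= t -> is_derive s (1 : R) x (node_field (c s)).1.
  by move=> /hc; exact: derive_fst.
have dy s : 0 <= s <= t -> is_derive s (1 : R) y (node_field (c s)).2.
  by move=> /hc; exact: derive_snd.
pose P s := 0 < x s /\ `|y s| < del * x s.
have mono s : 0 <= s <= t -> (forall u : R, 0 <= u <= s -> P u) ->
    x s <= x 0 /\ `|y s| * x 0 <= `|y 0| * x s.
  move=> /andP[s0 st] Pu.
  have sub (u : R) : 0 <= u <= s -> 0 <= u <= t by move=> /andP[-> us]; apply: le_trans st.
  have pos u : 0 <= u <= s -> 0 < x u by move=> /Pu[].
  have xx : x s <= x 0.
    rewrite -lerN2; apply: (derive_ge0_le s0 (f := fun s => - x s) (df := fun s => - (node_field (c s)).1)) => u us.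
      by apply: derive_opp; apply: dx; exact: sub.
    have [xu yu] := Pu _ us; have := cone2 b k _ _ xu (ltW yu).
    rewrite ler_norml => /andP[_ h]; rewrite oppr_ge0 /node_field /= -/(x u) -/(y u).
    have : del * A * x u ^+ 2 <= - a * x u ^+ 2 by rewrite ler_wpM2r ?sqr_ge0.
    by move: h; rewrite -/A; clear; lra.
  split => //.
  pose r s := y s / x s.
  pose D z := z.1 * (node_field z).2 - z.2 * (node_field z).1.
  have dr u : 0 <= u <= s -> is_derive u (1 : R) (fun u => r u ^+ 2) (2 * (y u / x u ^+ 3) * D (c u)).
    move=> us; have xu := pos _ us; have us' := sub _ us.
    apply: (derive_ext (derive_exp 2 (derive_mul (dy _ us') (derive_inv _ (dx _ us'))))) => //.
      by rewrite gt_eqF.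
    by rewrite /D -/(x u) -/(y u) /= expr1; field; rewrite gt_eqF.
  have : r s ^+ 2 <= r 0 ^+ 2.
    rewrite -lerN2; apply: (derive_ge0_le s0 (f := fun s => - r s ^+ 2) (df := fun u => - (2 * (y u / x u ^+ 3) * D (c u)))) => u us.
      by apply: derive_opp; apply: dr.
    have [xu yu] := Pu _ us; have := cone2 (e - b) (- k) _ _ xu (ltW yu).
    rewrite normrN ler_norml => /andP[_ h].
    have -> : - (2 * (y u / x u ^+ 3) * D (c u)) = 2 * (y u / x u) ^+ 2 / x u *
         - ((d - a) * x u ^+ 2 + ((e - b) * x u * y u + - k * y u ^+ 2)).
      by rewrite /D /node_field /= -/(x u) -/(y u); field; rewrite gt_eqF.
    rewrite mulr_ge0//; first by rewrite divr_ge0 ?(ltW xu)// mulr_ge0 ?sqr_ge0.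
    have : del * B * x u ^+ 2 <= (a - d) * x u ^+ 2 by rewrite ler_wpM2r ?sqr_ge0.
    by move: h; rewrite -/B; clear; lra.
  have x0p : 0 < x 0 by apply: pos; rewrite lexx.
  have xsp : 0 < x s by apply: pos; rewrite s0 lexx.
  rewrite -[X in X <= _]real_normK ?num_real// -[X in _ <= X]real_normK ?num_real//.
  rewrite ler_sqr ?nnegrE// /r !normrM !normfV (gtr0_norm x0p) (gtr0_norm xsp).
  by rewrite ler_pdivrMr// mulrAC ler_pdivlMr.
have Pall : forall s : R, 0 <= s <= t -> P s.
  (* The strict inequalities persist by continuity. At a limit time the slope bound survives, and
     [x s = 0] would then force [c s = 0], impossible for a nonzero orbit. *)
  apply: real_induction => //.
  - move=> s st [xs ys].
    have xc : {for s, continuous x} by exact: derive_cont (dx _ st).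
    have yc : {for s, continuous y} by exact: derive_cont (dy _ st).
    have n1 : \forall u \near s, 0 < x u.
      by apply: (@cont_near _ _ x s [set v | 0 < v] xc); exact: lt_nbhsr.
    have wc : {for s, continuous (fun u => del * x u - `|y u|)}.
      by apply: cvgB; [apply: cvgM => //; exact: cvg_cst|exact: cvg_norm].
    have n2 : \forall u \near s, 0 < del * x u - `|y u|.
      apply: (@cont_near _ _ (fun u => del * x u - `|y u|) s [set v | 0 < v] wc).
      by apply: lt_nbhsr; rewrite subr_gt0.
    have : \forall u \near s, 0 < x u /\ 0 < del * x u - `|y u| by exact: filterI n1 n2.
    move=> /nbhs_ballP[r /= r0 rP].
    exists r => // u /andP[su us] _.
    have [h1 h2] : 0 < x u /\ 0 < del * x u - `|y u|.
      by apply: rP; rewrite /ball /= distrC ger0_norm ?subr_ge0// ltrBlDl.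
    by split => //; rewrite -subr_gt0.
  - move=> s /[dup] s0t /andP[s0 st] Pu.
    have sI : 0 <= s <= t by rewrite (ltW s0).
    have xc : {for s, continuous x} by exact: derive_cont (dx _ sI).
    have yc : {for s, continuous y} by exact: derive_cont (dy _ sI).
    have mono' u : 0 <= u < s -> x u <= x 0 /\ `|y u| * x 0 <= `|y 0| * x u.
      move=> /andP[u0 us]; apply: mono; first by rewrite u0 (le_trans (ltW us)).
      by move=> v /andP[v0 vu]; apply: Pu; rewrite v0 (le_lt_trans vu).
    have xge : 0 <= x s.
      by apply: (cont_ge0_left s0 xc) => u /Pu[/ltW].
    have cone : `|y s| * x 0 <= `|y 0| * x s.
      rewrite -subr_ge0; apply: (@cont_ge0_left (fun s => `|y 0| * x s - `|y s| * x 0) s s0).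
        apply: cvgB; first by apply: cvgM => //; exact: cvg_cst.
        by apply: cvgM; [exact: cvg_norm|exact: cvg_cst].
      by move=> u /mono'[_]; rewrite subr_ge0.
    have xs : 0 < x s.
      rewrite lt_neqAle xge andbT eq_sym; apply/negP => /eqP xs0.
      have cn0 : c 0 != 0.
        apply: contraTneq x00 => ->; by rewrite /= ltxx.
      have := orbit_nonzero hX hc cn0 sI.
      move: cone; rewrite xs0 mulr0 pmulr_lle0// normr_le0 => /eqP ys0.
      by rewrite [c s]surjective_pairing -/(x s) -/(y s) xs0 ys0 eqxx.
    split => //; rewrite -(ltr_pM2r x00); apply: (le_lt_trans cone).
    by rewrite mulrAC (ltr_pM2r xs).
have tt : 0 <= t <= t by rewrite t0 lexx.
have [h1 h2] := mono _ tt Pall; have [h3 _] := Pall _ tt.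
by split.
Qed.

(** If entry points that do leave the block accumulated at [(xA, 0)], their exit points would remain
    in thinner and thinner cones, so [f (xA, 0)] would be on the segment from the origin to
    [(xA, 0)], which contains no exit point. *)
Lemma node_entry_near N f xA (c : boundary_chart N (xA, 0)) :
  isolating_block node_field N -> block_extension node_field N f ->
  0 < xA -> a_in node_field N (xA, 0) -> (forall x : R, 0 < x <= xA -> ~ n_out node_field N (x, 0)) ->
  \forall s \near (0 : R), a_in node_field N (chart_curve c s).
Proof.
move=> bl [fout fexit fc] xA0 aA nout; have hX := node_field_quadratic.
have X2 : (node_field (xA, 0)).2 = 0 by rewrite /node_field /= mul0r.
have [gc fgc nin _] := boundary_approach c hX bl aA X2 fc.
have fA := fout _ aA.1.
pose B := [set s : R | ~ a_in node_field N (chart_curve c s)].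
have [//|notnear] := pselect (\forall s \near (0 : R), a_in node_field N (chart_curve c s)).
(* The filter is proper exactly because the claim is supposed to fail; limits are taken along the
   entry points that leave the block. *)
pose F := within B (nbhs (0 : R)).
have FP : ProperFilter F.
  apply: Build_ProperFilter_ex => P; rewrite /F /within /= => FP.
  apply: contrapT => noP; apply: notnear; apply: filterS FP => s Ps.
  by apply: contrapT => ns; apply: noP; exists s; exact: Ps.
have gcF : chart_curve c s @[s --> F] --> ((xA, 0) : plane R) by apply: cvg_within_filter.
have fgcF : f (chart_curve c s) @[s --> F] --> f (xA, 0) by apply: cvg_within_filter.
have ninF : \forall s \near F, n_in node_field N (chart_curve c s) by apply: cvg_within nin.
have BF : \forall s \near F, B s by exact: withinT.
have fstc (p : R -> plane R) (l : plane R) : p s @[s --> F] --> l -> (p s).1 @[s --> F] --> l.1.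
  by move=> pl; apply: (cvg_comp _ fst pl); exact: cvg_fst.
have sndc (p : R -> plane R) (l : plane R) : p s @[s --> F] --> l -> (p s).2 @[s --> F] --> l.2.
  by move=> pl; apply: (cvg_comp _ snd pl); exact: cvg_snd.
have [del del0 cone] := node_cone.
have gpos : \forall s \near F, 0 < (chart_curve c s).1 by apply: (cvgr_gt _ (fstc _ _ gcF)).
have gcone : \forall s \near F, 0 < del * (chart_curve c s).1 - `|(chart_curve c s).2|.
  apply: (cvgr_gt (del * xA - `|0|)); last by rewrite normr0 subr0 mulr_gt0.
  apply: cvgB; first by apply: cvgM; [exact: cvg_cst|exact: (fstc _ _ gcF)].
  by apply: cvg_norm; exact: (sndc _ _ gcF).
have near_orb : \forall s \near F, [/\ 0 < (f (chart_curve c s)).1,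
   (f (chart_curve c s)).1 <= (chart_curve c s).1 &
   `|(f (chart_curve c s)).2| * (chart_curve c s).1 <= `|(chart_curve c s).2| * (f (chart_curve c s)).1].
  near=> s.
  have ns : n_in node_field N (chart_curve c s) by near: s.
  have Bs : ~ a_in node_field N (chart_curve c s) by near: s.
  have [t [w [[t0 w0 hw _] <-]]] := exit_transit hX (fexit _ (conj ns Bs)).
  rewrite -w0; apply: cone => //.
    by rewrite w0; near: s.
  by rewrite w0 -subr_gt0; near: s.
have f1 : 0 <= (f (xA, 0)).1.
  by apply: (cvgr_to_ge (fstc _ _ fgcF)); apply: filterS near_orb => s [/ltW].
have f1le : (f (xA, 0)).1 <= xA.
  by apply: (cvg_le_le (fstc _ _ fgcF) (fstc _ _ gcF)); apply: filterS near_orb => s [].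
have f2 : (f (xA, 0)).2 = 0.
  suff : `|(f (xA, 0)).2| * xA <= `|0 : R| * (f (xA, 0)).1.
    by rewrite normr0 mul0r pmulr_lle0// normr_le0 => /eqP.
  apply: (@cvg_le_le _ _ F _ (fun s => `|(f (chart_curve c s)).2| * (chart_curve c s).1)
     (fun s => `|(chart_curve c s).2| * (f (chart_curve c s)).1)).
  - by apply: cvgM; [apply: cvg_norm; exact: (sndc _ _ fgcF)|exact: (fstc _ _ gcF)].
  - by apply: cvgM; [apply: cvg_norm; exact: (sndc _ _ gcF)|exact: (fstc _ _ fgcF)].
  - by apply: filterS near_orb => s [].
move: f1; rewrite le_eqVlt => /predU1P[f10|f1].
  exfalso; have [[_ nint] _] := fA; apply: nint.
  have -> : f (xA, 0) = 0 by rewrite [LHS]surjective_pairing -f10 f2.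
  exact: origin_interior hX bl.
exfalso; apply: (nout (f (xA, 0)).1); first by rewrite f1 f1le.
by move: f2 fA; case: (f (xA, 0)) => ? ? /= ->.
Unshelve. all: by end_near.
Qed.

End Cone.

(* The block map can be deformed near an entrance point all of whose neighbours are asymptotic to
   the origin: the boundary curve is collapsed near this point, and the constant part is moved along
   the exit boundary. *)
Lemma extension_not_unique X N f p : quadratic_field X -> isolating_block X N ->
  block_extension X N f -> a_in X N p ->
  (forall c : boundary_chart N p, \forall s \near (0 : R), a_in X N (chart_curve c s)) ->
  exists2 g, block_extension X N g & g p <> f p.
Proof.
move=> hX bl [fout fexit fc] ap near_a.
have [c] : inhabited (boundary_chart N p) by apply: (boundary_chart_exists bl); case: ap => -[].
have pin := ap.1.
have [d [sg [rho [sg1 rho0 eta]]]] := n_out_curve hX bl (fout _ pin).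
have [Dp cp] := chart_center c; have [Dq dq] := chart_center d.
have : \forall s \near (0 : R), a_in X N (chart_curve c s) /\ [/\ chart_cod c (s, 0),
    chart_dom c (chart_curve c s), c (chart_curve c s) = (s, 0) & bd N (chart_curve c s)].
  by exact: filterI (near_a c) (chart_curve_near c).
move=> /nbhs_ballP[r /= r0 hr].
have {}hr (s : R) : `|s| < r -> a_in X N (chart_curve c s) /\ [/\ chart_cod c (s, 0),
     chart_dom c (chart_curve c s) & c (chart_curve c s) = (s, 0)].
  move=> sr; have [|as_ [h1 h2 h3 _]] := hr s; last by [].
  by rewrite /ball /= sub0r normrN.
(* [v] is at least 1 for [|s| >= r / 2] and negative for [|s| < r / 4]. So [chi] is the identity far
   from 0 and 0 near it, and the bump [k], of height [rho / 2] at 0, lives where [chi] is 0: the two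
   deformations never act together. *)
pose v (s : R) := 4 * `|s| / r - 1.
pose chi (s : R) := s * Num.min 1 (Num.max 0 (v s)).
pose k (s : R) := rho / 2 * Num.max 0 (- v s).
pose G (s : R) := f (chart_curve c (chi s)) + (chart_curve d (sg * k s) - f p).
(* A closed arc. At its ends [G] already agrees with [f], so the two definitions of [g] glue
   continuously. *)
pose K := [set z | chart_dom c z /\ (bd N z /\ `|(c z).1| <= r / 2)].
pose g z := if `[< K z >] then G (c z).1 else f z.
have gK z : K z -> g z = G (c z).1 by rewrite /g; case: asboolP.
have gN z : ~ K z -> g z = f z by rewrite /g; case: asboolP.
have r2 : r / 2 < r by rewrite ltr_pdivrMr// ltr_pMr// ltr1n.
have curveE z : chart_dom c z -> bd N z -> chart_curve c (c z).1 = z.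
  move=> Dz /(chart_bd Dz) z2; have [_ Kz] := chartK Dz.
  by rewrite /chart_curve -z2 -surjective_pairing.
have chi_le s : `|chi s| <= `|s|.
  rewrite /chi normrM ler_piMr// ger0_norm ?ge_min ?lexx//.
  by rewrite le_min ler01 le_max lexx.
have k_lt s : 0 <= k s < rho.
  rewrite /k mulr_ge0 ?divr_ge0 ?(ltW rho0) ?le_max ?lexx//=.
  have : Num.max 0 (- v s) <= 1.
    rewrite ge_max ler01 /= /v opprB lerBlDr lerDl divr_ge0 ?(ltW r0)// mulr_ge0//.
  move=> h; apply: (@le_lt_trans _ _ (rho / 2)); first by rewrite ger_pMr// divr_gt0.
  by rewrite ltr_pdivrMr// ltr_pMr// ltr1n.
have v_ge s : r / 2 <= `|s| -> 1 <= v s.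
  move=> h; rewrite /v lerBrDr ler_pdivlMr//; move: h; clear; lra.
have far s : r / 2 <= `|s| -> chi s = s /\ k s = 0.
  move=> /v_ge vs; have v0 : 0 <= v s by apply: le_trans vs.
  rewrite /chi /k (max_idPr v0) (min_idPl vs) mulr1; split => //.
  by rewrite (max_idPl _) ?mulr0// oppr_le0.
have curve0 : chart_curve d (sg * 0) = f p by rewrite mulr0 chart_curve0.
have Gfar s : r / 2 <= `|s| -> G s = f (chart_curve c s).
  by move=> /far[h1 h2]; rewrite /G h1 h2 curve0 subrr addr0.
have Gout s : `|s| < r -> n_out X N (G s).
  move=> sr; have [v0|v0] := leP (v s) 0.
    rewrite /G /chi (max_idPl v0) (min_idPr ler01) mulr0 chart_curve0 addrC subrK.
    by have [_] := eta _ (k_lt s).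
  rewrite /G /k (max_idPl _) ?oppr_le0 ?(ltW v0)// mulr0 curve0 subrr addr0; apply: fout.
  by have [[]] := hr (chi s) (le_lt_trans (chi_le s) sr).
have Kin z : K z -> `|(c z).1| < r by move=> [_ [_ h]]; exact: le_lt_trans h r2.
have gOE z : chart_dom c z -> bd N z -> g z = G (c z).1.
  move=> Dz bz; have [/gK//|nK] := pselect (K z); rewrite (gN _ nK).
  have [h|h] := leP `|(c z).1| (r / 2); first by exfalso; apply: nK; split.
  by rewrite (Gfar _ (ltW h)) curveE.
have vc (s : R) : {for s, continuous v}.
  apply: cvgB; last exact: cvg_cst.
  apply: cvgM; last exact: cvg_cst.
  by apply: cvgM; [exact: cvg_cst|apply: cvg_norm; exact: cvg_id].
have max0c (h : R -> R) (s : R) : {for s, continuous h} -> {for s, continuous (fun x => Num.max 0 (h x))}.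
  by move=> hc; apply: continuous_max => //; exact: cvg_cst.
have chic (s : R) : {for s, continuous chi}.
  have mc : {for s, continuous (fun x : R => Num.min 1 (Num.max 0 (v x)))}.
    by apply: continuous_min; [exact: cvg_cst|exact: max0c].
  by apply: cvgM; [exact: cvg_id|exact: mc].
have kc (s : R) : {for s, continuous k}.
  have mc : {for s, continuous (fun x : R => Num.max 0 (- v x))}.
    by apply: max0c; apply: cvgN; exact: vc.
  by apply: cvgM; [exact: cvg_cst|exact: mc].
have fcurve (s : R) : `|s| < r -> {for s, continuous (fun s => f (chart_curve c s))}.
  move=> sr; have [as_ [cs Ds _]] := hr _ sr.
  have /subspace_continuousP-/(_ _ as_.1) fs := fc.
  move=> A /fs; rewrite /within /= nbhs_filterE => nA.
  have nA' := cont_near (chart_curve_cont cs) nA.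
  have n_in_near : \forall x \near s, n_in X N (chart_curve c x).
    apply/nbhs_ballP; exists (r - `|s|); rewrite /= ?subr_gt0// => x; rewrite /ball /= => xs.
    suff xr : `|x| < r by have [[]] := hr x xr.
    rewrite -[x](subrK s) addrC; apply: (le_lt_trans (ler_normD _ _)).
    by rewrite -ltrBrDl distrC.
  by apply: filterS2 nA' n_in_near => x; exact.
have Gc (s : R) : `|s| < r -> {for s, continuous G}.
  move=> sr; apply: cvgD.
    apply: (@continuous_comp _ _ _ chi (fun s => f (chart_curve c s)) s (chic s)).
    by apply: fcurve; exact: le_lt_trans (chi_le s) sr.
  apply: cvgB; last exact: cvg_cst.
  have [cs _] := eta _ (k_lt s).
  have mc : {for s, continuous (fun s => sg * k s)} by apply: cvgM; [exact: cvg_cst|exact: kc].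
  exact: (@continuous_comp _ _ _ (fun s => sg * k s) (chart_curve d) s mc (chart_curve_cont cs)).
have KE : K = chart_curve c @` `[- (r / 2), r / 2].
  rewrite eqEsubset; split => z.
    move=> [Dz [bz zr]]; exists (c z).1; last exact: curveE.
    by rewrite /= in_itv /= -ler_norml.
  move=> [s /=]; rewrite in_itv /= -ler_norml => sr <-.
  have [as_ [cs Ds ds]] := hr _ (le_lt_trans sr r2).
  by split => //; split; [case: as_ => -[]|rewrite ds].
have Kclosed : closed K.
  apply: compact_closed; first exact: norm_hausdorff.
  rewrite KE; apply: continuous_compact; last exact: segment_compact.
  apply: continuous_in_subspaceT => s; rewrite inE /= in_itv /= -ler_norml => sr.
  have [_ [cs _ _]] := hr _ (le_lt_trans sr r2).
  exact: chart_curve_cont.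
have c1c z : chart_dom c z -> {for z, continuous (fun z => (c z).1)}.
  by move=> Dz; apply: (cvg_comp _ fst (chart_cont Dz)); exact: cvg_fst.
exists g; last first.
  have Kp : chart_dom c p by [].
  rewrite gOE//; last by case: pin.
  rewrite cp /= => E.
  have v0 : v 0 = -1 by rewrite /v normr0 mulr0 mul0r sub0r.
  have k0 : k 0 = rho / 2 by rewrite /k v0 opprK (max_idPr ler01) mulr1.
  have : chart_curve d (sg * (rho / 2)) = f p.
    rewrite -[RHS]E /G /chi mul0r chart_curve0 k0 addrC subrK //.
  have rho2 : 0 <= rho / 2 < rho by rewrite divr_ge0 ?(ltW rho0)//= ltr_pdivrMr// ltr_pMr// ltr1n.
  have [cs _] := eta _ rho2; move=> Ed; have [_ Kd] := chart_invK cs.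
  move: Kd; rewrite -/(chart_curve d (sg * (rho / 2))) Ed dq => /(congr1 fst) /= /esym /eqP.
  rewrite !mulf_eq0 (gt_eqF rho0) invr_eq0 orbC /= pnatr_eq0 /= => /eqP sg0.
  by move: sg1; rewrite sg0 expr0n => /esym/eqP; rewrite oner_eq0.
split.
- move=> z nz; have [Kz|/gN ->] := pselect (K z); last exact: fout.
  rewrite (gK _ Kz).
  by apply: Gout; exact: Kin.
(* Every point of [K] is asymptotic to the origin, so the exit condition does not constrain [g]
   there. *)
- move=> z [nz naz]; have [Kz|/gN ->] := pselect (K z); last exact: fexit.
  exfalso; apply: naz; have [Dz [bz _]] := Kz.
  by have [] := hr _ (Kin _ Kz); rewrite curveE.
- apply/subspace_continuousP => z nz.
  change (g x @[x --> within (n_in X N) (nbhs z)] --> g z).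
  have [Kz|nKz] := pselect (K z).
    have [Dz [bz _]] := Kz.
    rewrite gOE//; apply: (@cvg_trans _ (G (c y).1 @[y --> within (n_in X N) (nbhs z)])).
      apply: near_eq_cvg; rewrite near_withinE; near=> y => ny.
      by rewrite gOE//; [near: y; exact: chart_dom_nbhs|case: ny].
    apply: cvg_within_filter.
    exact: (@continuous_comp _ _ _ (fun z => (c z).1) G z (c1c _ Dz) (Gc _ (Kin _ Kz))).
  rewrite (gN _ nKz).
  apply: (@cvg_trans _ (f y @[y --> within (n_in X N) (nbhs z)])); last by move/subspace_continuousP : fc; exact.
  apply: near_eq_cvg; rewrite near_withinE; near=> y => ny.
  rewrite gN//; near: y.
  by apply: open_nbhs_nbhs; split => //; exact: closed_openC.
Unshelve. all: by end_near.
Qed.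

Lemma node_not_regularisable C (a b k d e : R) : a < 0 -> d < a -> ~ regularisable C (node_field a b k d e).
Proof.
move=> a0 da [N bl [f [ext uniq _]]]; have hX := node_field_quadratic a b k d e.
have Xe : node_field a b k d e (1, 0) = (a, 0).
  by rewrite /node_field /= !expr0n !mulr0 expr1n mulr1 !addr0 mul0r.
have [xA [xA0 aA nout]] := entry_point hX bl Xe a0.
have [g gext] := extension_not_unique hX bl ext aA (fun c0 : boundary_chart N (xA, 0) => node_entry_near a0 da c0 bl ext xA0 aA nout).
by apply; apply: uniq => //; case: aA.
Qed.

End Node.

(** * Linear equivalence *)

Section Linear.
Context {R : realType}.
Implicit Types (T : {linear plane R -> plane R}).

Lemma plane_linearE T z : T z = (z.1 * (T (1, 0)).1 + z.2 * (T (0, 1)).1,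
                                 z.1 * (T (1, 0)).2 + z.2 * (T (0, 1)).2).
Proof. by rewrite {1}[z]plane_basis linearD !linearZ. Qed.

Lemma plane_linear_cont T : continuous T.
Proof.
move=> z; apply: (@cvg_trans _ ((fun w : plane R => (w.1 * (T (1, 0)).1 + w.2 * (T (0, 1)).1,
    w.1 * (T (1, 0)).2 + w.2 * (T (0, 1)).2)) @ z)).
  by apply: near_eq_cvg; apply: nearW => w; rewrite (plane_linearE T w).
rewrite [T z]plane_linearE.
have c1 (l : R) : (w : plane R).1 * l @[w --> z] --> z.1 * l.
  by apply: cvgM; [exact: cvg_fst|exact: cvg_cst].
have c2 (l : R) : (w : plane R).2 * l @[w --> z] --> z.2 * l.
  by apply: cvgM; [exact: cvg_snd|exact: cvg_cst].
exact: (cvg_pair (cvgD (c1 _) (c2 _)) (cvgD (c1 _) (c2 _))).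
Qed.

Lemma derive_plane_linear T (c : R -> plane R) (s : R) v : is_derive s (1 : R) c v ->
  is_derive s (1 : R) (fun u => T (c u)) (T v).
Proof.
move=> hc; have d1 := derive_fst hc; have d2 := derive_snd hc.
have D l1 l2 := derive_add (derive_mul d1 (derive_const s l1)) (derive_mul d2 (derive_const s l2)).
have := derive_pair (D (T (1, 0)).1 (T (0, 1)).1) (D (T (1, 0)).2 (T (0, 1)).2).
rewrite !mulr0 !add0r -[(_, _)]/(_, _).
suff -> : T v = (v.1 * (T (1, 0)).1 + v.2 * (T (0, 1)).1, v.1 * (T (1, 0)).2 + v.2 * (T (0, 1)).2).
  suff -> : (fun u => T (c u)) = fun u => ((c u).1 * (T (1, 0)).1 + (c u).2 * (T (0, 1)).1, (c u).1 * (T (1, 0)).2 + (c u).2 * (T (0, 1)).2).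
    by rewrite ![v.1 * _]mulrC ![v.2 * _]mulrC.
  by apply/funext => u; rewrite plane_linearE.
exact: plane_linearE.
Qed.

Lemma plane_linear_smooth T U (f : plane R -> plane R) : open U -> smooth_on U f -> smooth_on U (fun z => T (f z)).
Proof. by move=> oU fs k; apply: Ck_on_linear_comp => //; exact: plane_linear_cont. Qed.

Lemma smooth_plane_linear T U (f : plane R -> plane R) : open U -> smooth_on U f -> smooth_on (T @^-1` U) (fun z => f (T z)).
Proof.
move=> oU fs; have oU' : open (T @^-1` U).
  by apply: open_comp => // z _; exact: plane_linear_cont.
apply: (smooth_on_comp (O := U)) => // k.
by apply: Ck_on_linear; exact: plane_linear_cont.
Qed.

End Linear.

(** * Transport of flows and blocks by a linear isomorphism *)

Section FlowTransport.
Context {R : realType}.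
Variables (T T' : {linear plane R -> plane R}) (X Y : plane R -> plane R).
Hypotheses (TK : cancel T T') (T'K : cancel T' T) (YE : forall z, Y z = T (X (T' z))).

Lemma flow_linear p (t : R) q : flow X p t q -> flow Y (T p) t (T q).
Proof.
move=> [c [c0 ct hc]]; exists (fun u => T (c u)); rewrite c0 ct; split => // s /hc h.
by rewrite YE TK; exact: derive_plane_linear.
Qed.

End FlowTransport.

Section BlockTransport.
Context {R : realType}.
Variables (T T' : {linear plane R -> plane R}) (X Y : plane R -> plane R).
Hypotheses (TK : cancel T T') (T'K : cancel T' T) (YE : forall z, Y z = T (X (T' z))).

Let XE z : X z = T' (Y (T z)).
Proof. by rewrite YE !TK. Qed.

Lemma flow_linearE p (t : R) q : flow Y p t q <-> flow X (T' p) t (T' q).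
Proof.
split=> [|/(flow_linear TK YE)]; last by rewrite !T'K.
exact: flow_linear T'K XE p t q.
Qed.

Variable N : set (plane R).
Let M : set (plane R) := T' @^-1` N.

Lemma flow_in_linear p (t : R) : flow_in Y M p t <-> flow_in X N (T' p) t.
Proof.
split=> [[q /flow_linearE h Mq]|[q h Nq]]; first by exists (T' q).
by exists (T q); [apply/flow_linearE; rewrite TK|rewrite /M /= TK].
Qed.

Lemma interior_linear p : M° p <-> N° (T' p).
Proof.
split=> h; last by apply: (@plane_linear_cont _ T' p).
have hM : \forall w \near T' p, M (T w) by apply: (@plane_linear_cont _ T (T' p)); rewrite T'K.
by apply: filterS hM => w; rewrite /M /= TK.
Qed.

Lemma bd_linear p : bd M p <-> bd N (T' p).
Proof. by split=> -[h1 h2]; split => // /interior_linear. Qed.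

Lemma n_in_linear p : n_in Y M p <-> n_in X N (T' p).
Proof.
split=> -[/bd_linear b [t t0 h]]; split => //; exists t => // s /h hs; first by move/flow_in_linear.
by move/flow_in_linear.
Qed.

Lemma n_out_linear p : n_out Y M p <-> n_out X N (T' p).
Proof.
split=> -[/bd_linear b [t t0 h]]; split => //; exists t => // s /h hs; first by move/flow_in_linear.
by move/flow_in_linear.
Qed.

Lemma a_in_linear p : a_in Y M p <-> a_in X N (T' p).
Proof. by split=> -[/n_in_linear h1 h2]; split => // t /h2 /flow_in_linear. Qed.

Lemma exit_point_linear p q : exit_point X N p q -> exit_point Y M (T p) (T q).
Proof.
move=> [t [t0 fl fi no]]; exists t; split => //; first by apply/flow_linearE; rewrite !TK.
  by move=> s /fi h; apply/flow_in_linear; rewrite TK.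
by apply/n_out_linear; rewrite TK.
Qed.

(** The equation [T' q = p] is an argument because the transported image point [T (f _)] is sent
    back by [T'] to [f _] only up to a proved equality. It ends with [Defined] so that the
    underlying maps compute. *)
Definition linear_chart p q (d : boundary_chart N p) (E : T' q = p) : boundary_chart M q.
Proof.
apply: (@BoundaryChart _ M q (T' @^-1` chart_dom d) (chart_cod d) (fun z => d (T' z))
   (fun w => T (chart_inv d w))).
- by apply: open_comp; [move=> z _; exact: plane_linear_cont|exact: chart_dom_open].
- exact: chart_cod_open.
- by apply: smooth_plane_linear; [exact: chart_dom_open|exact: chart_smooth].
- by apply: plane_linear_smooth; [exact: chart_cod_open|exact: chart_inv_smooth].
- by move=> z /chartK[h1 h2]; rewrite h2 T'K.
- by move=> w /chart_invK[h1 h2]; rewrite /= TK h2.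
- by rewrite /= E; exact: chart_center.
- by move=> z /(chart_slice (b := d)).
Defined.

(** Both normal derivatives are derivatives at 0 of the same function, since the transported chart
    along a line is the old chart along the image line. *)
Lemma tangency_linear p : tangency X N (T' p) -> tangency Y M p.
Proof.
move=> [/bd_linear b [d dX]]; split => //; exists (linear_chart d erefl).
have [Dp _] := chart_center d.
have h1 := derive_along_line (Y p) (chart_diff (d := linear_chart d erefl) Dp).
have h2 := derive_along_line (X (T' p)) (chart_diff Dp).
suff E : (fun t => linear_chart d erefl (line p (Y p) t)) = (fun t => d (line (T' p) (X (T' p)) t)).
  by move: h1; rewrite E => h1; rewrite -(derive_val (is_derive := h1)) (derive_val (is_derive := h2)).
apply/funext => t /=; congr (d _).
have -> (z v : plane R) : line z v t = z + t *: v by [].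
by rewrite linearD linearZ YE TK.
Qed.

Lemma block_extension_linear f : block_extension X N f -> block_extension Y M (fun z => T (f (T' z))).
Proof.
move=> [fout fexit fc]; split.
- by move=> p /n_in_linear /fout h; apply/n_out_linear; rewrite TK.
- move=> p [/n_in_linear h1 h2]; rewrite -{1}[p]T'K; apply: exit_point_linear; apply: fexit.
  by split => // /a_in_linear.
- apply/subspace_continuousP => p /n_in_linear np.
  have /subspace_continuousP/(_ _ np) := fc.
  change (f x @[x --> within (n_in X N) (nbhs (T' p))] --> f (T' p) ->
    T (f (T' x)) @[x --> within (n_in Y M) (nbhs p)] --> T (f (T' p))) => h.
  have h' : f (T' x) @[x --> within (n_in Y M) (nbhs p)] --> f (T' p).
    move=> A /h; rewrite /within /= => nA.
    have {}nA : nbhs (T' p) [set w | n_in X N w -> A (f w)] by exact: nA.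
    have hA : \forall z \near p, n_in X N (T' z) -> A (f (T' z)) by exact: (@plane_linear_cont _ T' p _ nA).
    by apply: filterS hA => z hz /n_in_linear; exact: hz.
  by apply: (cvg_comp _ T h'); exact: plane_linear_cont.
Qed.

Lemma linear_preimage : M = T @` N.
Proof.
rewrite eqEsubset; split => z; first by move=> Mz; exists (T' z); rewrite ?T'K.
by move=> [w Nw <-]; rewrite /M /= TK.
Qed.

End BlockTransport.

Section IsolatingTransport.
Context {R : realType}.
Variables (T T' : {linear plane R -> plane R}) (X Y : plane R -> plane R).
Hypotheses (TK : cancel T T') (T'K : cancel T' T) (YE : forall z, Y z = T (X (T' z))).
Variable N : set (plane R).
Let M : set (plane R) := T' @^-1` N.

Let XE z : X z = T' (Y (T z)).
Proof. by rewrite YE !TK. Qed.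

Let NE : N = T @^-1` M.
Proof. by apply/funext => z; rewrite /M /= TK. Qed.

Lemma tangency_linearE p : tangency Y M p <-> tangency X N (T' p).
Proof.
split; last exact: tangency_linear TK T'K YE N p.
by move=> h; rewrite NE; apply: (tangency_linear T'K TK XE); rewrite T'K.
Qed.

Lemma isolating_block_linear : isolating_block X N -> isolating_block Y M.
Proof.
move=> [Nc Ns Ninv Nt Ni]; split.
- rewrite /M (linear_preimage TK T'K); apply: continuous_compact => //.
  by apply: continuous_subspaceT; exact: plane_linear_cont.
- move=> p /Ns[h|[d]]; [left; exact/(interior_linear TK T'K)|right].
  by split; exact: linear_chart TK T'K _ _ _ d erefl.
- rewrite eqEsubset; split => p /=.
    move=> h; have : [set p | forall t : R, flow_in X N p t] (T' p).
      by move=> t; apply/(flow_in_linear TK T'K YE); exact: h.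
    by rewrite Ninv /= => /(congr1 T); rewrite T'K linear0.
  move=> -> t; apply/(flow_in_linear TK T'K YE); rewrite linear0.
  have : [set 0] (0 : plane R) by [].
  by rewrite -Ninv; exact.
- rewrite eqEsubset; split => p.
    move=> [/(n_in_linear TK T'K YE) h1 /(n_out_linear TK T'K YE) h2].
    by apply/tangency_linearE; rewrite -Nt.
  move=> /tangency_linearE; rewrite -Nt => -[h1 h2].
  by split; [apply/(n_in_linear TK T'K YE)|apply/(n_out_linear TK T'K YE)].
- move=> p /tangency_linearE /Ni [U nU UE].
  exists (T' @^-1` U); first exact: (@plane_linear_cont _ T' p).
  rewrite eqEsubset; split => q.
    move=> [/tangency_linearE h1 h2]; have : (tangency X N `&` U) (T' q) by [].
    by rewrite UE /= => /(congr1 T); rewrite !T'K.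
  move=> ->; have : [set T' p] (T' p) by [].
  by rewrite -UE => -[h1 h2]; split => //; apply/tangency_linearE.
Qed.

End IsolatingTransport.

Section Regularisable.
Context {R : realType}.
Implicit Types X Y : plane R -> plane R.

(** In transported charts the transition germ is literally the same function, so nothing is asked of
    [C]. Uniqueness is obtained by transporting a competitor back by [T']. *)
Lemma regularisable_linear C X Y : linearly_equivalent X Y -> regularisable C X -> regularisable C Y.
Proof.
move=> [T [T' [TK T'K YE]]] [N bl [f [ext uniq germ]]].
have XE z : X z = T' (Y (T z)) by rewrite YE !TK.
have NE : N = T @^-1` (T' @^-1` N) by apply/funext => z; rewrite /= TK.
exists (T' @^-1` N); first exact: isolating_block_linear TK T'K YE N bl.
exists (fun z => T (f (T' z))); split.
- exact: block_extension_linear TK T'K YE N f ext.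
- move=> g /(block_extension_linear T'K TK XE); rewrite -NE => /uniq gE p /(n_in_linear TK T'K YE) /gE.
  by rewrite T'K => /(congr1 T); rewrite T'K.
- move=> p /(a_in_linear TK T'K YE) /germ [c [d Cd]].
  exists (linear_chart TK T'K c erefl), (linear_chart TK T'K d (TK _)).
  by move: Cd; congr C; apply/funext => s /=; rewrite !TK.
Qed.

Lemma linearly_equivalent_sym X Y : linearly_equivalent X Y -> linearly_equivalent Y X.
Proof.
by move=> [T [T' [TK T'K YE]]]; exists T', T; split => // z; rewrite YE !TK.
Qed.

Lemma linearly_equivalent_trans X Y Z : linearly_equivalent X Y -> linearly_equivalent Y Z ->
  linearly_equivalent X Z.
Proof.
move=> [T [T' [TK T'K YE]]] [S [S' [SK S'K ZE]]].
exists (S \o T : {linear plane R -> plane R}), (T' \o S' : {linear plane R -> plane R}); split => z /=.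
- by rewrite SK TK.
- by rewrite T'K S'K.
- by rewrite ZE YE.
Qed.

Lemma linearly_equivalent_ext X Y : X =1 Y -> linearly_equivalent X Y.
Proof. by move=> XY; exists (idfun : {linear plane R -> plane R}), idfun; split => // z; rewrite XY. Qed.

Lemma matrix_linear (a b c d : R) : linear (fun z : plane R => (a * z.1 + b * z.2, c * z.1 + d * z.2) : plane R).
Proof.
move=> k [u1 u2] [v1 v2].
rewrite -[LHS]/(a * (k * u1 + v1) + b * (k * u2 + v2), c * (k * u1 + v1) + d * (k * u2 + v2)).
rewrite -[RHS]/(k * (a * u1 + b * u2) + (a * v1 + b * v2), k * (c * u1 + d * u2) + (c * v1 + d * v2)).
by congr pair; ring.
Qed.

Lemma linearly_equivalent_matrix X Y (a b c d a' b' c' d' : R) :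
  let T z : plane R := (a * z.1 + b * z.2, c * z.1 + d * z.2) in
  let T' z : plane R := (a' * z.1 + b' * z.2, c' * z.1 + d' * z.2) in
  cancel T T' -> cancel T' T -> (forall z, Y (T z) = T (X z)) -> linearly_equivalent X Y.
Proof.
move=> T T' TK T'K YE.
have lT : linear T := matrix_linear a b c d.
have lT' : linear T' := matrix_linear a' b' c' d'.
pose L := HB.pack T (GRing.isLinear.Build _ _ _ _ T lT) : {linear plane R -> plane R}.
pose L' := HB.pack T' (GRing.isLinear.Build _ _ _ _ T' lT') : {linear plane R -> plane R}.
by exists L, L'; split => // z; rewrite -[LHS](congr1 Y (T'K z)) YE.
Qed.

End Regularisable.

(** * The unit disc *)

Section Disc.
Context {R : realType}.
Implicit Types (z w q : plane R).

Notation rr z := (z.1 ^+ 2 + z.2 ^+ 2).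

Definition disc : set (plane R) := [set z | rr z <= 1].

Lemma fst_cont : continuous (fst : plane R -> R).
Proof. by move=> z; exact: cvg_fst. Qed.

Lemma snd_cont : continuous (snd : plane R -> R).
Proof. by move=> z; exact: cvg_snd. Qed.

Lemma sqnorm_cont : continuous (fun z : plane R => rr z).
Proof.
move=> z; apply: cvgD; rewrite ?expr2.
  by apply: cvgM; exact: fst_cont.
by apply: cvgM; exact: snd_cont.
Qed.

Lemma disc_compact : compact disc.
Proof.
have sub : disc `<=` `[(-1 : R), 1] `*` `[(-1 : R), 1].
  move=> [x y] /=; rewrite /disc /= !in_itv /= -!ler_norml => h.
  have sq (u v : R) : u ^+ 2 + v ^+ 2 <= 1 -> `|u| <= 1.
    move=> uv; rewrite -(@ler_pXn2r _ 2) ?nnegrE// real_normK ?num_real// expr1n.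
    by apply: le_trans uv; rewrite lerDl sqr_ge0.
  by split; [exact: sq h|rewrite addrC in h; exact: sq h].
apply: (subclosed_compact _ _ sub); last by apply: compact_setX; exact: segment_compact.
apply: (@preimage_closed _ _ (fun z : plane R => rr z) [set x | x <= 1]).
  by move=> z _; exact: sqnorm_cont.
exact: closed_le.
Qed.

(* In complex notation, [i (1 - z) / (1 + z)] and its inverse [(i - w) / (i + w)]. *)
Definition moebius z : plane R :=
  (2 * z.2 / ((1 + z.1) ^+ 2 + z.2 ^+ 2), (1 - rr z) / ((1 + z.1) ^+ 2 + z.2 ^+ 2)).
Definition moebius_inv w : plane R :=
  ((1 - rr w) / (w.1 ^+ 2 + (1 + w.2) ^+ 2), 2 * w.1 / (w.1 ^+ 2 + (1 + w.2) ^+ 2)).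

Definition moebius_dom : set (plane R) := [set z | (1 + z.1) ^+ 2 + z.2 ^+ 2 != 0].
Definition moebius_cod : set (plane R) := [set w | w.1 ^+ 2 + (1 + w.2) ^+ 2 != 0].

Let smooth_fst k U : open U -> Ck_on k U (fun z : plane R => z.1).
Proof. by move=> oU; apply: Ck_on_fst => //; exact: Ck_on_id. Qed.
Let smooth_snd k U : open U -> Ck_on k U (fun z : plane R => z.2).
Proof. by move=> oU; apply: Ck_on_snd => //; exact: Ck_on_id. Qed.

Ltac smooth := do ![exact: smooth_fst|exact: smooth_snd|exact: Ck_on_cst|
  apply: Ck_on_add; first by []|apply: Ck_on_mul; first by []|apply: Ck_on_pair; first by []].

Lemma moebius_dom_open : open moebius_dom.
Proof.
apply: (@open_comp _ _ (fun z : plane R => (1 + z.1) ^+ 2 + z.2 ^+ 2) [set x | x != 0]); last exact: open_neq.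
move=> z _; rewrite /= /continuous_at; under [X in X @ _ --> _]eq_fun do rewrite !expr2; rewrite !expr2; apply: cvgD; last by apply: cvgM; exact: snd_cont.
by apply: cvgM; (apply: cvgD; [exact: cvg_cst|exact: fst_cont]).
Qed.

Lemma moebius_cod_open : open moebius_cod.
Proof.
apply: (@open_comp _ _ (fun z : plane R => z.1 ^+ 2 + (1 + z.2) ^+ 2) [set x | x != 0]); last exact: open_neq.
move=> z _; rewrite /= /continuous_at; under [X in X @ _ --> _]eq_fun do rewrite !expr2; rewrite !expr2; apply: cvgD; first by apply: cvgM; exact: fst_cont.
by apply: cvgM; (apply: cvgD; [exact: cvg_cst|exact: snd_cont]).
Qed.

Lemma moebius_smooth : smooth_on moebius_dom moebius.
Proof.
move=> k; have oU := moebius_dom_open.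
have den : Ck_on k moebius_dom (fun z : plane R => (1 + z.1) * (1 + z.1) + z.2 * z.2).
  by smooth.
have den' : Ck_on k moebius_dom (fun z : plane R => ((1 + z.1) ^+ 2 + z.2 ^+ 2)^-1).
  exact: Ck_on_inv.
apply: Ck_on_pair => //; apply: Ck_on_mul => //; first by smooth.
apply: (Ck_on_ext (f := fun z => 1 + (cst (-1) z * (z.1 * z.1 + z.2 * z.2)))) => //.
  by move=> z _ /=; ring.
by smooth.
Qed.

Lemma moebius_inv_smooth : smooth_on moebius_cod moebius_inv.
Proof.
move=> k; have oU := moebius_cod_open.
have den : Ck_on k moebius_cod (fun z : plane R => z.1 * z.1 + (1 + z.2) * (1 + z.2)).
  by smooth.
have den' : Ck_on k moebius_cod (fun z : plane R => (z.1 ^+ 2 + (1 + z.2) ^+ 2)^-1).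
  exact: Ck_on_inv.
apply: Ck_on_pair => //; apply: Ck_on_mul => //; last by smooth.
apply: (Ck_on_ext (f := fun z => 1 + (cst (-1) z * (z.1 * z.1 + z.2 * z.2)))) => //.
  by move=> z _ /=; ring.
by smooth.
Qed.

Lemma moebiusK z : moebius_dom z -> moebius_cod (moebius z) /\ moebius_inv (moebius z) = z.
Proof.
rewrite /moebius_dom /moebius_cod /moebius_inv /moebius /= => h.
set D := (1 + z.1) ^+ 2 + z.2 ^+ 2 in h *.
have E : (2 * z.2 / D) ^+ 2 + (1 + (1 - rr z) / D) ^+ 2 = 4 / D.
  by rewrite /D; field.
rewrite E; split; first by rewrite mulf_neq0 ?invr_eq0// pnatr_eq0.
rewrite [RHS]surjective_pairing; congr pair; rewrite /D; field; rewrite -/D.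
  by rewrite h.
by rewrite h.
Qed.

Lemma moebius_invK w : moebius_cod w -> moebius_dom (moebius_inv w) /\ moebius (moebius_inv w) = w.
Proof.
rewrite /moebius_dom /moebius_cod /moebius_inv /moebius /= => h.
set D := w.1 ^+ 2 + (1 + w.2) ^+ 2 in h *.
have E : (1 + (1 - rr w) / D) ^+ 2 + (2 * w.1 / D) ^+ 2 = 4 / D.
  by rewrite /D; field.
rewrite E; split; first by rewrite mulf_neq0 ?invr_eq0// pnatr_eq0.
rewrite [RHS]surjective_pairing; congr pair; rewrite /D; field; rewrite -/D.
  by rewrite h.
by rewrite h.
Qed.

Section Chart.
Variables (q : plane R).
Hypothesis q1 : rr q = 1.

(** In complex notation, multiplication by the conjugate of [q] for [s = 1], which moves [q] to 1,
    and by [q] for [s = -1]. *)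
Definition rot (s : R) z : plane R := (q.1 * z.1 + s * q.2 * z.2, q.1 * z.2 - s * q.2 * z.1).

Lemma rotK (s : R) z : s ^+ 2 = 1 -> rot s (rot (- s) z) = z.
Proof.
move=> s1; rewrite /rot [RHS]surjective_pairing /=; congr pair.
  transitivity ((q.1 ^+ 2 + s ^+ 2 * q.2 ^+ 2) * z.1); first by ring.
  by rewrite s1 mul1r q1 mul1r.
transitivity ((q.1 ^+ 2 + s ^+ 2 * q.2 ^+ 2) * z.2); first by ring.
by rewrite s1 mul1r q1 mul1r.
Qed.

Lemma rot_norm (s : R) z : s ^+ 2 = 1 -> rr (rot s z) = rr z.
Proof.
move=> s1; rewrite /rot /=; transitivity ((q.1 ^+ 2 + s ^+ 2 * q.2 ^+ 2) * rr z); first by ring.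
by rewrite s1 mul1r q1 mul1r.
Qed.

Lemma rot_smooth (s : R) U : open U -> smooth_on U (rot s).
Proof.
move=> oU k; apply: (Ck_on_ext (f := fun z => (cst q.1 z * z.1 + cst (s * q.2) z * z.2, cst q.1 z * z.2 + cst (- (s * q.2)) z * z.1))) => //.
  by move=> z _; rewrite /rot /= mulNr.
by smooth.
Qed.

Lemma rot_cont (s : R) : continuous (rot s).
Proof. by move=> z; apply: (smooth_cont (@rot_smooth s setT openT)). Qed.

Let s1 : (1 : R) ^+ 2 = 1.
Proof. by rewrite expr1n. Qed.
Let sN1 : (-1 : R) ^+ 2 = 1.
Proof. by rewrite sqrrN expr1n. Qed.

Definition disc_chart_map z := moebius (rot 1 z).
Definition disc_chart_inv w := rot (-1) (moebius_inv w).

Lemma disc_chart_open : open (rot 1 @^-1` moebius_dom).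
Proof. by apply: open_comp; [move=> z _; exact: rot_cont|exact: moebius_dom_open]. Qed.

Lemma disc_chart_smooth : smooth_on (rot 1 @^-1` moebius_dom) disc_chart_map.
Proof.
have oD := disc_chart_open; apply: (smooth_on_comp (O := moebius_dom)) => //.
- exact: moebius_dom_open.
- exact: moebius_smooth.
- exact: rot_smooth.
Qed.

Lemma disc_chart_inv_smooth : smooth_on moebius_cod disc_chart_inv.
Proof.
have oD := moebius_cod_open; apply: (smooth_on_comp (O := setT)) => //.
- exact: openT.
- by apply: rot_smooth; exact: openT.
- exact: moebius_inv_smooth.
Qed.

Lemma disc_chartK z : (rot 1 @^-1` moebius_dom) z ->
  moebius_cod (disc_chart_map z) /\ disc_chart_inv (disc_chart_map z) = z.
Proof. by move=> /moebiusK[h1 h2]; rewrite /disc_chart_inv h2 -[X in rot _ (rot X _)]opprK rotK. Qed.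

Lemma disc_chart_invK w : moebius_cod w ->
  (rot 1 @^-1` moebius_dom) (disc_chart_inv w) /\ disc_chart_map (disc_chart_inv w) = w.
Proof. by move=> /moebius_invK[h1 h2]; rewrite /disc_chart_map /= rotK. Qed.

Lemma disc_chart_center : (rot 1 @^-1` moebius_dom) q /\ disc_chart_map q = 0.
Proof.
have E : rot 1 q = (1, 0).
  by rewrite /rot; congr pair; [rewrite -[RHS]q1; ring|ring].
rewrite /disc_chart_map /= E /moebius_dom /moebius /=; split; last first.
  by rewrite expr0n expr1n /= !addr0 subrr mulr0 !mul0r.
by rewrite expr0n addr0 /= sqrf_eq0 -(natrD _ 1 1) pnatr_eq0.
Qed.

Lemma disc_chart_slice z : (rot 1 @^-1` moebius_dom) z -> disc z <-> 0 <= (disc_chart_map z).2.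
Proof.
move=> h; rewrite /disc /= -(rot_norm z s1) pmulr_lge0 ?subr_ge0//.
by rewrite invr_gt0 lt_neqAle eq_sym h addr_ge0// sqr_ge0.
Qed.

Definition disc_chart : boundary_chart disc q :=
  BoundaryChart disc_chart_open moebius_cod_open disc_chart_smooth disc_chart_inv_smooth
    disc_chartK disc_chart_invK disc_chart_center disc_chart_slice.

Lemma disc_chart_dom : chart_dom disc_chart q.
Proof. by have [] := chart_center disc_chart. Qed.

(** The height is a quotient whose numerator vanishes at [q], so only the derivative [- 2 (q . v)]
    of the numerator and the value 4 of the denominator matter. *)
Lemma disc_chart_normal v : chart_normal disc_chart q v = - (q.1 * v.1 + q.2 * v.2) / 2.
Proof.
have := chart_normal_derive v disc_chart_dom.
pose num t := 1 - rr (rot 1 (line q v t)).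
pose den t := (1 + (rot 1 (line q v t)).1) ^+ 2 + (rot 1 (line q v t)).2 ^+ 2.
have numE t : num t = - t * (2 * (q.1 * v.1 + q.2 * v.2)) - t ^+ 2 * rr v.
  rewrite /num rot_norm ?expr1n// /line /=.
  transitivity (1 - rr q - t * (2 * (q.1 * v.1 + q.2 * v.2)) - t ^+ 2 * rr v); first by ring.
  by rewrite q1 subrr sub0r mulNr.
have denE t : den t = 4 + t * (4 * (q.1 * v.1 + q.2 * v.2)) + t ^+ 2 * rr v.
  rewrite /den /rot /line /=.
  transitivity (1 + 2 * (rr q) + rr q ^+ 2 + t * ((2 + 2 * rr q) * (q.1 * v.1 + q.2 * v.2)) + t ^+ 2 * (rr q * rr v)); first by ring.
  by rewrite q1 expr1n !mulr1 mul1r; congr (_ + _ + _); [ring|congr (_ * _); ring].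
have dt2 (l : R) := derive_mul (derive_exp 2 (derive_var (0 : R))) (derive_const (0 : R) l).
have dt1 (l : R) := derive_mul (derive_var (0 : R)) (derive_const (0 : R) l).
have dnum : is_derive 0 (1 : R) num (- (2 * (q.1 * v.1 + q.2 * v.2))).
  apply: (derive_ext (derive_sub (derive_opp (dt1 (2 * (q.1 * v.1 + q.2 * v.2)))) (dt2 (rr v)))) => [t|].
    by rewrite numE mulNr.
  by rewrite /=; ring.
have dden : is_derive 0 (1 : R) den (4 * (q.1 * v.1 + q.2 * v.2)).
  apply: (derive_ext (derive_add (derive_add (derive_const 0 4) (dt1 (4 * (q.1 * v.1 + q.2 * v.2)))) (dt2 (rr v)))) => [t|].
    by rewrite denE.
  by rewrite /=; ring.
have den0 : den 0 = 4 by rewrite denE expr0n !mul0r !addr0.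
have num0 : num 0 = 0 by rewrite numE oppr0 expr0n !mul0r subr0.
have := derive_mul dnum (derive_inv _ dden); rewrite den0 num0 pnatr_eq0 => /(_ isT) H1 H2.
have E : (fun t => (disc_chart (line q v t)).2) = (fun t => num t / den t) by apply/funext.
move: H2; rewrite E => H2.
by rewrite -(derive_val (is_derive := H2)) (derive_val (is_derive := H1)) mul0r add0r; field.
Qed.

End Chart.

Lemma disc_interior z : rr z < 1 -> disc° z.
Proof.
move=> z1; have : \forall w \near z, rr w < 1.
  by apply: (@cont_near _ _ (fun z : plane R => rr z) z [set x | x < 1] (@sqnorm_cont z)); exact: lt_nbhsl.
by apply: filterS => w /ltW.
Qed.

Lemma disc_bd z : bd disc z <-> rr z = 1.
Proof.
split=> [[zN nint]|z1].
  by apply/eqP; rewrite eq_le zN leNgt; apply/negP => /disc_interior.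
have [Dz z0] := chart_center (disc_chart z1).
by apply/(chart_bd Dz); rewrite z0.
Qed.

Lemma disc_smooth : smooth_domain disc.
Proof.
move=> z; rewrite /disc /= le_eqVlt => /predU1P[z1|]; last by left; exact: disc_interior.
by right; split; exact: disc_chart z1.
Qed.

Lemma disc_tangency X z : tangency X disc z <-> rr z = 1 /\ z.1 * (X z).1 + z.2 * (X z).2 = 0.
Proof.
split=> [[/disc_bd z1 [c cX]]|[z1 zX]].
  split=> //; have [Dz z0] := chart_center (disc_chart z1); have [Dz' z0'] := chart_center c.
  have := @chart_tangent_independent _ _ _ _ c (disc_chart z1) z (X z) Dz' Dz.
  rewrite z0 z0' => /(_ erefl erefl cX); rewrite disc_chart_normal => /eqP.
  by rewrite mulf_eq0 invr_eq0 pnatr_eq0 orbF oppr_eq0 => /eqP.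
split; first exact/disc_bd.
by exists (disc_chart z1); have := disc_chart_normal z1 (X z); rewrite zX oppr0 mul0r.
Qed.

End Disc.

(** * The flow on the unit disc *)

Section DiscFlow.
Context {R : realType}.
Implicit Types (z p q : plane R) (b s t u : R).

Notation rr z := (z.1 ^+ 2 + z.2 ^+ 2).

(** Rational parametrisation of the unit circle by the tangent of half the angle; it misses only
    [(-1, 0)]. *)
Definition circ s : plane R := ((1 - s ^+ 2) / (1 + s ^+ 2), 2 * s / (1 + s ^+ 2)).
Definition half_tan z : R := z.2 / (1 + z.1).

Lemma one_sqr_gt0 s : 0 < 1 + s ^+ 2.
Proof. by rewrite ltr_pwDl// sqr_ge0. Qed.

Lemma circ_norm s : rr (circ s) = 1.
Proof. by rewrite /circ /=; field; rewrite gt_eqF// one_sqr_gt0. Qed.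

Lemma circ0 : circ 0 = (1, 0).
Proof. by rewrite /circ expr0n mulr0 subr0 addr0 divr1 mul0r. Qed.

Lemma half_tanK s : half_tan (circ s) = s.
Proof.
rewrite /half_tan /circ /=; have s0 := one_sqr_gt0 s.
have -> : 1 + (1 - s ^+ 2) / (1 + s ^+ 2) = 2 / (1 + s ^+ 2) by field; rewrite gt_eqF.
by field; rewrite gt_eqF.
Qed.

Lemma polar_half_tan (r : R) z : 0 < r -> rr z = r ^+ 2 -> r + z.1 != 0 ->
  z = (r * (circ (z.2 / (r + z.1))).1, r * (circ (z.2 / (r + z.1))).2).
Proof.
case: z => x y /= r0 rz rx.
have sE : 1 + (y / (r + x)) ^+ 2 = 2 * r / (r + x).
  transitivity ((r ^+ 2 + 2 * r * x + (x ^+ 2 + y ^+ 2)) / (r + x) ^+ 2); first by field.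
  by rewrite rz; field.
have sE' : 1 - (y / (r + x)) ^+ 2 = 2 * x / (r + x).
  transitivity ((r ^+ 2 - (x ^+ 2 + y ^+ 2) + 2 * x * (r + x)) / (r + x) ^+ 2); first by field.
  by rewrite rz; field.
by rewrite sE sE'; congr pair; field; rewrite rx gt_eqF.
Qed.

Lemma circK z : rr z = 1 -> 1 + z.1 != 0 -> circ (half_tan z) = z.
Proof.
move=> z1 zn; rewrite [RHS](polar_half_tan (r := 1)) ?ltr01 ?expr1n// !mul1r.
by rewrite -surjective_pairing.
Qed.

Lemma circN s : circ (- s) = ((circ s).1, - (circ s).2).
Proof. by rewrite /circ /= sqrrN mulrN mulNr. Qed.

Lemma circV s : s != 0 -> circ (- s^-1) = - circ s.
Proof.
move=> s0; rewrite /circ; have := one_sqr_gt0 s => s1.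
have E : 1 + (- s^-1) ^+ 2 = (1 + s ^+ 2) / s ^+ 2 by field.
rewrite E [RHS]surjective_pairing /=; congr pair; field; rewrite s0 (gt_eqF s1)//.
Qed.

(* On an orbit in the upper half plane [ln |z| - k * log_profile b s] is constant, where [s] is the
   tangent of half the argument of [z]; [profile b] is twice the exponential of [log_profile b], and
   also covers the lower half plane. *)
Definition log_profile b u : R := ln u - ln (1 + u ^+ 2) - 2 * b * atan u.
Definition profile b s : R := 2 * s / (1 + s ^+ 2) * expR (- (2 * b * atan s)).
(** Up to a positive factor, the radial component of the field at [circ s] ([radial_circ]), and up
    to a negative one the derivative of [profile b]: the extrema of the profile are the
    tangencies. *)
Definition tangency_poly b s : R := s ^+ 2 + 2 * b * s - 1.

Lemma derive_log_profile b u : 0 < u ->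
  is_derive u (1 : R) (log_profile b) (- tangency_poly b u / (u * (1 + u ^+ 2))).
Proof.
move=> u0; have u1 := one_sqr_gt0 u.
have d2 := derive_add (derive_const u 1) (derive_exp 2 (derive_var u)).
have l1 := derive_ln (f := fun y : R => y) u0 (derive_var u).
have l2 := derive_ln (f := fun y : R => 1 + y ^+ 2) u1 d2.
apply: (derive_ext (derive_sub (derive_sub l1 l2)
   (derive_mul (derive_const u (2 * b)) (derive_atan (derive_var u))))) => //.
by rewrite /tangency_poly expr1; field; rewrite !gt_eqF.
Qed.

Lemma derive_profile b s : is_derive s (1 : R) (profile b)
  (- 2 * tangency_poly b s / (1 + s ^+ 2) ^+ 2 * expR (- (2 * b * atan s))).
Proof.
have s1 := one_sqr_gt0 s.
have d2 := derive_add (derive_const s 1) (derive_exp 2 (derive_var s)).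
apply: (derive_ext (derive_mul (derive_mul (derive_mul (derive_const s 2) (derive_var s))
    (derive_inv _ d2)) (derive_expR (derive_opp (derive_mul (derive_const s (2 * b)) (derive_atan (derive_var s))))))) => //.
  by rewrite gt_eqF.
by rewrite /tangency_poly expr1; field; rewrite !gt_eqF.
Qed.

Lemma profileE b u : 0 < u -> profile b u = 2 * expR (log_profile b u).
Proof.
move=> u0; have u1 := one_sqr_gt0 u.
rewrite /profile /log_profile -ln_div// expRD lnK ?posrE ?divr_gt0//.
by rewrite !mulrA.
Qed.

Lemma profile_inj_log b u v : 0 < u -> 0 < v -> profile b u = profile b v ->
  log_profile b u = log_profile b v.
Proof. by move=> u0 v0; rewrite !profileE// => /mulfI/expR_inj -> //; rewrite pnatr_eq0. Qed.

Lemma profileN b s : profile (- b) (- s) = - profile b s.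
Proof. rewrite /profile sqrrN atanN.
have -> : 2 * - b * - atan s = 2 * b * atan s by ring.
by ring. Qed.

Lemma atanV s : 0 < s -> atan s + atan s^-1 = pi / 2.
Proof.
move=> s0; pose F u : R := atan u + atan u^-1.
have dF u : 0 < u -> is_derive u (1 : R) F 0.
  move=> u0; have u1 := one_sqr_gt0 u.
  apply: (derive_ext (derive_add (derive_atan (derive_var u)) (derive_atan (derive_inv _ (derive_var u))))) => //.
    by rewrite gt_eqF.
  have u2 := one_sqr_gt0 u^-1.
  rewrite mulr1 mulrA mulrN -invfM.
  have -> : (1 + u^-1 ^+ 2) * u ^+ 2 = 1 + u ^+ 2 by field; rewrite gt_eqF.
  by rewrite mulr1 subrr.
have F1 : F 1 = pi / 2 by rewrite /F invr1 atan1; field.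
rewrite -F1 -/(F s); have [s1|s1] := leP s 1.
  by apply: (derive0_eq s1 (df := fun=> 0)) => // u /andP[su _]; apply: dF; exact: lt_le_trans su.
apply/esym; apply: (derive0_eq (ltW s1) (df := fun=> 0)) => // u /andP[su _]; apply: dF.
exact: lt_le_trans su.
Qed.

(** [- s^-1] parametrises the point opposite to [circ s]. Its arctangent is shifted by [pi / 2],
    whence the exponential factor. *)
Lemma profileV_pos b s : 0 < s -> profile b (- s^-1) = - expR (b * pi) * profile b s.
Proof.
move=> s0; have s1 := one_sqr_gt0 s; rewrite /profile.
have -> : atan (- s^-1) = atan s - pi / 2 by rewrite atanN -(atanV s0); ring.
have -> : - (2 * b * (atan s - pi / 2)) = - (2 * b * atan s) + b * pi by field.
rewrite expRD; have E : 1 + (- s^-1) ^+ 2 = (1 + s ^+ 2) / s ^+ 2 by field; rewrite gt_eqF.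
by rewrite E; field; rewrite !gt_eqF.
Qed.

Lemma profileV_neg b s : s < 0 -> profile b (- s^-1) = - expR (- (b * pi)) * profile b s.
Proof.
move=> s0; have := @profileV_pos (- b) (- s); rewrite oppr_gt0 => /(_ s0).
by rewrite invrN !profileN => E; apply: oppr_inj; rewrite E -(mulNr b); ring.
Qed.

Section Field.
Variable (k : R).
Hypothesis k0 : k < 0.
(** With [m = - k b] the radial factor [k x + m y] is [k (x - b y)], so the tangencies and the
    profiles depend on [b] only. *)
Notation X b := (focus_saddle k (- (k * b))).
Notation radial b z := (k * (z.1 - b * z.2)).

(* In polar coordinates [r' = r radial z] and [theta' = z.2]. *)
Lemma focus_saddle_polar b z :
  X b z = (radial b z * z.1 - z.2 * z.2, radial b z * z.2 + z.2 * z.1).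
Proof. by rewrite /focus_saddle; congr pair; ring. Qed.

Lemma focus_saddle_radial b z : z.1 * (X b z).1 + z.2 * (X b z).2 = radial b z * rr z.
Proof. by rewrite focus_saddle_polar /=; ring. Qed.

Lemma radial_circ b s : radial b (circ s) = - k * tangency_poly b s / (1 + s ^+ 2).
Proof. by rewrite /circ /tangency_poly /=; field; rewrite gt_eqF// one_sqr_gt0. Qed.

Lemma lie_sqnorm b : lie_derivative (X b) setT (fun z => rr z) (fun z => 2 * (radial b z * rr z)).
Proof.
move=> c s _ hc.
apply: (derive_ext (derive_add (derive_exp 2 (derive_fst hc)) (derive_exp 2 (derive_snd hc)))) => //.
by rewrite -focus_saddle_radial !expr1; ring.
Qed.

Lemma lie_radial b : lie_derivative (X b) setT (fun z => - radial b z) (fun z => - radial b (X b z)).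
Proof.
move=> c s _ hc.
apply: (derive_ext (derive_opp (derive_mul (derive_const s k) (derive_sub (derive_fst hc) (derive_mul (derive_const s b) (derive_snd hc)))))) => //.
by ring.
Qed.

Lemma radial_cont b : continuous (fun z : plane R => radial b z).
Proof.
move=> z; apply: cvgM; first exact: cvg_cst.
by apply: cvgB; [exact: fst_cont|apply: cvgM; [exact: cvg_cst|exact: snd_cont]].
Qed.

(** A negative radial factor makes the norm decrease, so the orbit stays in the disc for a while; a
    positive one makes the orbit leave at once. The tangencies need a second-order argument. *)
Lemma disc_n_out b z : n_out (X b) disc z <-> rr z = 1 /\ 0 <= radial b z.
Proof.
have hX := focus_saddle_quadratic k (- (k * b)).
split=> [[/disc_bd z1 [t0 t00 nfl]]|[z1 rz]].
  split=> //; rewrite leNgt; apply/negP => rz.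
  have nb : nbhs z [set w | 2 * (radial b w * rr w) < 0].
    have fc : {for z, continuous (fun w : plane R => 2 * (radial b w * rr w))}.
      by apply: cvgM; [exact: cvg_cst|apply: cvgM; [exact: radial_cont|exact: sqnorm_cont]].
    apply: (@cont_near _ _ (fun w : plane R => 2 * (radial b w * rr w)) z [set x | x < 0] fc).
    by apply: lt_nbhsl; rewrite z1 mulr1 pmulr_rlt0.
  have [||e e0 he] := decreasing_forward hX nb (g := fun z => rr z) (W := fun w => 2 * (radial b w * rr w)).
  - by move=> c s _; exact: lie_sqnorm.
  - by [].
  have [e1 [c [e10 c0 hc]]] := local_orbit z hX.
  pose s := Num.min (t0 / 2) (Num.min (e / 2) e1).
  have s0 : 0 < s by rewrite !lt_min !divr_gt0.
  have st : s < t0 by rewrite gt_min ltr_pdivrMr// ltr_pMr// ltr1n.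
  have se : s < e by rewrite !gt_min (_ : e / 2 < e) ?orbT// ltr_pdivrMr// ltr_pMr// ltr1n.
  have se1 : s <= e1 by rewrite !ge_min lexx !orbT.
  have fl : flow (X b) z s (c s).
    apply/(flow_forward _ _ _ (ltW s0)); exists c; split => // u /andP[u0 us].
    by apply: hc; rewrite u0 (le_trans us).
  apply: (nfl s); first by rewrite s0.
  exists (c s) => //; have [|_] := he s _ _ fl; first by rewrite s0.
  by rewrite z1 => /ltW.
move: rz; rewrite le_eqVlt => /predU1P[rz|rz]; last first.
  have [Dz z0] := chart_center (disc_chart z1).
  apply: (n_out_of_speed hX Dz); first by rewrite z0.
  have := disc_chart_normal z1 (X b z); rewrite focus_saddle_radial z1 mulr1 /chart_speed => E.
  have {}E : ('D_(X b z) (disc_chart z1 : plane R -> plane R) z).2 = - radial b z / 2 := E.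
  by rewrite E mulNr oppr_lt0 divr_gt0.
(* At a tangency the radial factor vanishes, but its derivative along the field is [- k > 0]. It is
   positive right after, so the norm increases: the contact with the circle is exterior. *)
split; first exact/disc_bd.
have xE : z.1 = b * z.2.
  by move/esym/eqP: rz; rewrite mulf_eq0 lt_eqF//= subr_eq0 => /eqP.
have W0 : radial b (X b z) = - k.
  rewrite focus_saddle_polar -rz /= !mul0r sub0r add0r.
  transitivity (- k * (z.2 ^+ 2 + b * z.2 * z.1)); first by ring.
  by rewrite -[RHS]mulr1 -z1; congr (_ * _); rewrite xE; ring.
have nb : nbhs z [set w | - radial b (X b w) < 0].
  have fc : {for z, continuous (fun w : plane R => - radial b (X b w))}.
    apply: cvgN; have Xc := quadratic_continuous hX (x := z).
    exact: (cvg_comp _ _ Xc (@radial_cont b (X b z))).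
  apply: (@cont_near _ _ (fun w : plane R => - radial b (X b w)) z [set x | x < 0] fc).
  by apply: lt_nbhsl; rewrite W0 opprK.
have [||e e0 he] := decreasing_forward hX nb (g := fun z => - radial b z) (W := fun w => - radial b (X b w)).
- by move=> c s _; exact: lie_radial.
- by [].
exists e => // s /andP[s0 se] [q fl qN].
have [c [c0 cs hc]] := (flow_forward _ _ _ (ltW s0)).1 fl.
have pos u : 0 < u <= s -> 0 < radial b (c u).
  move=> /andP[u0 us]; have flu : flow (X b) z u (c u).
    apply/(flow_forward _ _ _ (ltW u0)); exists c; split => // v /andP[v0 vu].
    by apply: hc; rewrite v0 (le_trans vu).
  have [|_] := he u _ _ flu; first by rewrite u0 (le_lt_trans us).
  by rewrite -rz oppr0 oppr_lt0.
have [v /andP[v0 vs] E] := MVT_oo (f := fun u => rr (c u)) (df := fun u => 2 * (radial b (c u) * rr (c u))) s0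
   (fun u us => @lie_sqnorm b c u Logic.I (hc u us)).
have rv : 0 < radial b (c v) by apply: pos; rewrite v0 ltW.
have cv : 0 < rr (c v).
  rewrite lt_neqAle addr_ge0 ?sqr_ge0// andbT eq_sym paddr_eq0 ?sqr_ge0// !sqrf_eq0.
  apply/negP => /andP[/eqP c1 /eqP c2]; move: rv.
  by rewrite c1 c2 mulr0 subrr mulr0 ltxx.
have : 0 < rr (c s) - rr (c 0) by rewrite E subr0 (mulr_gt0 _ s0)// (mulr_gt0 _ (mulr_gt0 rv cv))// ltr0n.
by rewrite cs c0 z1 subr_gt0 ltNge qN.
Qed.

Lemma disc_bdN z : bd disc (- z) <-> bd (disc : set (plane R)) z.
Proof. by split=> /disc_bd h; apply/disc_bd; move: h; rewrite /= !sqrrN. Qed.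

Lemma disc_flow_inN b z t : flow_in (X b) disc (- z) (- t) <-> flow_in (X b) disc z t.
Proof.
have hX := focus_saddle_quadratic k (- (k * b)).
have discN w : disc (- w) <-> disc w by rewrite /disc /= !sqrrN.
split=> -[q h qN]; exists (- q); rewrite ?discN//; last exact: flow_opp.
by move: (flow_opp hX h); rewrite !opprK.
Qed.

Lemma disc_n_in b z : n_in (X b) disc z <-> rr z = 1 /\ radial b z <= 0.
Proof.
have -> : (rr z = 1 /\ radial b z <= 0) <-> n_out (X b) disc (- z).
  rewrite disc_n_out /= !sqrrN; suff -> : k * (- z.1 - b * - z.2) = - radial b z by rewrite oppr_ge0.
  by ring.
split=> -[zb [t t0 h]]; (split; first exact/disc_bdN); exists t => // s /andP[s0 st].
  by rewrite -(opprK s) disc_flow_inN; apply: h; rewrite ltrN2 st oppr_lt0.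
by rewrite -disc_flow_inN; apply: h; rewrite oppr_gt0 st ltrNl s0.
Qed.

End Field.
End DiscFlow.

(** * Explicit orbits and exit points *)

Section DiscOrbits.
Context {R : realType}.
Implicit Types (z p q : plane R) (b s t u : R) (N : set (plane R)).

Notation rr z := (z.1 ^+ 2 + z.2 ^+ 2).

Lemma flow_shift Y p q w t s : quadratic_field Y -> 0 <= t -> 0 <= s ->
  flow Y p t q -> flow Y p (t + s) w -> flow Y q s w.
Proof.
move=> hY t0 s0 fl fw; have ts0 : 0 <= t + s by rewrite addr_ge0.
have [c [c0 cs hc]] := (flow_forward _ _ _ ts0).1 fw.
apply/flow_forward => //; exists (fun u => c (u + t)); split.
- rewrite add0r; apply: (@flow_unique _ Y p t) => //; apply/flow_forward => //.
  exists c; split => // u /andP[u0 ut]; apply: hc; rewrite u0.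
  by rewrite (le_trans ut)// lerDl.
- by rewrite addrC.
- move=> u /andP[u0 us]; have hct : is_derive (u + t) (1 : R) c (Y (c (u + t))).
    by apply: hc; rewrite addr_ge0//= addrC lerD2l.
  have sh : is_derive u (1 : R) (fun u => u + t) 1.
    by apply: (derive_ext (derive_add (derive_var u) (derive_const u t))); rewrite ?addr0.
  have := derive_pair (derive_comp (g := fun u => u + t) (derive_fst hct) sh)
     (derive_comp (g := fun u => u + t) (derive_snd hct) sh).
  rewrite !mulr1 -surjective_pairing.
  suff -> : (fun v => ((c (v + t)).1, (c (v + t)).2)) = (fun v => c (v + t)) by [].
  by apply/funext => v; rewrite -surjective_pairing.
Qed.

(** Right after an exit point the orbit is outside [N], so an orbit cannot have stayed in [N] for
    longer. This makes exit times, hence exit points, unique. *)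
Lemma n_out_leaves Y N p t q t' : quadratic_field Y -> 0 <= t -> flow Y p t q -> n_out Y N q ->
  (forall s, 0 <= s <= t' -> flow_in Y N p s) -> t' <= t.
Proof.
move=> hY t0 fl [_ [e e0 he]] fi; rewrite leNgt; apply/negP => tt.
pose s := Num.min (t' - t) (e / 2).
have s0 : 0 < s by rewrite lt_min subr_gt0 tt divr_gt0.
have se : s < e by rewrite gt_min (_ : e / 2 < e) ?orbT// ltr_pdivrMr// ltr_pMr// ltr1n.
have [|w fw Nw] := fi (t + s).
  by rewrite addr_ge0 ?(ltW s0)//= -lerBrDl ge_min lexx.
apply: (he s); first by rewrite s0.
by exists w => //; apply: flow_shift fw => //; exact: ltW.
Qed.

Lemma exit_not_a_in Y N p q : quadratic_field Y -> exit_point Y N p q -> ~ a_in Y N p.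
Proof.
move=> hY [t [t0 fl _ no]] [_ ha].
have : t + 1 <= t by apply: (n_out_leaves hY t0 fl no) => s /andP[s0 _]; exact: ha.
by rewrite gerDl ler10.
Qed.

Lemma exit_point_unique Y N p q q' : quadratic_field Y -> exit_point Y N p q ->
  exit_point Y N p q' -> q = q'.
Proof.
move=> hY [t [t0 fl fi no]] [t' [t0' fl' fi' no']].
have tt : t = t'.
  apply/eqP; rewrite eq_le (n_out_leaves hY t0' fl' no' fi)//=.
  exact: (n_out_leaves hY t0 fl no fi').
by apply: (flow_unique hY fl); rewrite tt.
Qed.

Lemma disc_circ (r u : R) : disc ((r * (circ u).1, r * (circ u).2) : plane R) <-> r ^+ 2 <= 1.
Proof.
have E : (r * (circ u).1) ^+ 2 + (r * (circ u).2) ^+ 2 = r ^+ 2.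
  by have := circ_norm u; move: (circ u) => [x y] /= h; rewrite !exprMn -mulrDr h mulr1.
by rewrite -E.
Qed.

Section Field.
Variable (k : R).
Hypothesis k0 : k < 0.
Notation X b := (focus_saddle k (- (k * b))).

(** The radius is determined by the first integral. As [theta' = y], the half-angle tangent [u] has
    velocity [u * rho u], the speed factor given to [reparam]. *)
Lemma upper_orbit b (r s0 s1 : R) : 0 < s0 -> s0 <= s1 ->
  let rho u := r * expR (k * (log_profile b u - log_profile b s0)) in
  let zeta u : plane R := (rho u * (circ u).1, rho u * (circ u).2) in
  0 < r -> exists (T : R) (c : R -> plane R), [/\ 0 <= T, c 0 = zeta s0, c T = zeta s1,
    forall s, 0 <= s <= T -> is_derive s (1 : R) c (X b (c s)) &
    forall s, 0 <= s <= T -> exists2 u, s0 <= u <= s1 & c s = zeta u].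
Proof.
move=> s00 s01 rho zeta r0.
pose drho u := rho u * (k * (- tangency_poly b u / (u * (1 + u ^+ 2)))).
have rho0 u : 0 < rho u by rewrite mulr_gt0// expR_gt0.
have drhoE u : 0 < u < s1 + 1 -> is_derive u (1 : R) rho (drho u).
  move=> /andP[u0 _]; have h := derive_sub (derive_log_profile b u0) (derive_const u (log_profile b s0)).
  apply: (derive_ext (derive_mul (derive_const u r) (derive_expR (derive_mul (derive_const u k) h)))) => //.
  by rewrite /drho /rho; ring.
have dden u := derive_inv (f := fun u : R => 1 + u ^+ 2) (lt0r_neq0 (one_sqr_gt0 u)) (derive_add (derive_const u 1) (derive_exp 2 (derive_var u))).
have dx u : is_derive u (1 : R) (fun u => (circ u).1) (- (4 * u) / (1 + u ^+ 2) ^+ 2).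
  apply: (derive_ext (derive_mul (derive_sub (derive_const u 1) (derive_exp 2 (derive_var u))) (dden u))) => //.
  by rewrite expr1; field; rewrite gt_eqF// one_sqr_gt0.
have dy u : is_derive u (1 : R) (fun u => (circ u).2) (2 * (1 - u ^+ 2) / (1 + u ^+ 2) ^+ 2).
  apply: (derive_ext (derive_mul (derive_mul (derive_const u 2) (derive_var u)) (dden u))) => //.
  by rewrite expr1; field; rewrite gt_eqF// one_sqr_gt0.
have d1 u (hu : 0 < u < s1 + 1) := derive_mul (drhoE u hu) (dx u).
have d2 u (hu : 0 < u < s1 + 1) := derive_mul (drhoE u hu) (dy u).
have s11 : s1 < s1 + 1 by rewrite ltrDl.
have [|||T [c [T0 c0 cT hc hz]]] := @reparam _ (X b) (fun u => (zeta u).1) (fun u => (zeta u).2) _ _ (fun u => u * rho u) 0 (s1 + 1) s0 s1 s00 s01 s11 d1 d2.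
- move=> u hu; apply: cvgM; first exact: cvg_id.
  exact: (derive_cont (drhoE u hu)).
- by move=> u /andP[u0 _]; rewrite mulr_gt0.
- move=> u /andP[u0 _]; rewrite focus_saddle_polar /zeta /drho /=.
  have u1 := one_sqr_gt0 u; move: (rho u) => ro; rewrite /tangency_poly.
  by congr pair; field; rewrite !gt_eqF.
exists T, c; split => //.
by move=> s /hz[u [hu E _ _]]; exists u.
Qed.

Lemma log_profile_le b s t : 0 < s -> s <= t -> (forall u, s <= u <= t -> tangency_poly b u <= 0) ->
  log_profile b s <= log_profile b t.
Proof.
move=> s0 st h; apply: (derive_ge0_le st (df := fun u => - tangency_poly b u / (u * (1 + u ^+ 2)))) => u ust.
  by apply: derive_log_profile; move: ust => /andP[su _]; exact: lt_le_trans su.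
rewrite divr_ge0 ?oppr_ge0 ?h//; move: ust => /andP[su _].
by rewrite mulr_ge0 ?(ltW (one_sqr_gt0 _))// ltW// (lt_le_trans s0).
Qed.

Lemma log_profile_ge b s t : 0 < s -> s <= t -> (forall u, s <= u <= t -> 0 <= tangency_poly b u) ->
  log_profile b t <= log_profile b s.
Proof.
move=> s0 st h; rewrite -lerN2.
apply: (derive_ge0_le st (f := fun u => - log_profile b u) (df := fun u => - (- tangency_poly b u / (u * (1 + u ^+ 2))))) => u ust.
  by apply/derive_opp/derive_log_profile; move: ust => /andP[su _]; exact: lt_le_trans su.
rewrite mulNr opprK divr_ge0 ?h//; move: ust => /andP[su _].
by rewrite mulr_ge0 ?(ltW (one_sqr_gt0 _))// ltW// (lt_le_trans s0).
Qed.

(** [tangency_poly b u / u = u + 2 b - 1 / u] is increasing for [u > 0], so the sign changes only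
    once, from negative to positive. *)
Lemma tangency_poly_sign b u v : 0 < u -> u <= v -> u * tangency_poly b v >= v * tangency_poly b u.
Proof.
move=> u0 uv; rewrite -subr_ge0 /tangency_poly.
have -> : u * (v ^+ 2 + 2 * b * v - 1) - v * (u ^+ 2 + 2 * b * u - 1) = (v - u) * (u * v + 1) by ring.
by rewrite mulr_ge0 ?subr_ge0// addr_ge0// mulr_ge0 ?(ltW u0)// (le_trans (ltW u0)).
Qed.

(** Equal profiles give radius 1 at both ends. In between [log_profile] first increases and then
    decreases, so it stays above its common end value, and [k < 0] keeps the radius at most 1. *)
Lemma upper_exit b s t : 0 < s -> 0 < t -> tangency_poly b s <= 0 -> 0 <= tangency_poly b t ->
  profile b s = profile b t -> exit_point (X b) disc (circ s) (circ t).
Proof.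
move=> s0 t0 ps pt st.
have up u v : 0 < u -> u <= v -> 0 <= tangency_poly b u -> 0 <= tangency_poly b v.
  move=> u0 uv pu; have := tangency_poly_sign b u0 uv.
  move=> /(le_trans _) h; rewrite -(pmulr_rge0 _ u0); apply: h.
  by rewrite mulr_ge0// (le_trans (ltW u0)).
have down u v : 0 < u -> u <= v -> tangency_poly b v <= 0 -> tangency_poly b u <= 0.
  move=> u0 uv pv; rewrite leNgt; apply/negP => pu.
  have v0 := lt_le_trans u0 uv.
  have := tangency_poly_sign b u0 uv; rewrite leNgt => /negP; apply.
  by apply: (@le_lt_trans _ _ 0); [rewrite pmulr_rle0|rewrite mulr_gt0].
have les : s <= t.
  rewrite leNgt; apply/negP => ts.
  have E : s * tangency_poly b t - t * tangency_poly b s = (t - s) * (s * t + 1).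
    by rewrite /tangency_poly; ring.
  have : 0 <= s * tangency_poly b t - t * tangency_poly b s.
    by rewrite subr_ge0; apply: (@le_trans _ _ 0); [rewrite pmulr_rle0|rewrite mulr_ge0// ltW].
  rewrite E leNgt => /negP; apply.
  by rewrite pmulr_llt0 ?subr_lt0// addr_gt0// mulr_gt0.
have Lst : log_profile b t = log_profile b s by apply/esym/profile_inj_log.
have [T [c [T0 c0 cT hc hz]]] := upper_orbit b s0 les ltr01.
rewrite Lst !subrr mulr0 expR0 mulr1 !mul1r -!surjective_pairing in c0 cT.
exists T; split => //.
- by apply/flow_forward => //; exists c.
- move=> u /andP[u0 uT]; exists (c u).
    apply/flow_forward => //; exists c; split => // v /andP[v0 vu].
    by apply: hc; rewrite v0 (le_trans vu).
  have [|v /andP[sv vt] ->] := hz u; first by rewrite u0.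
  apply/disc_circ; rewrite mul1r expr_le1 ?expR_ge0// expR_le1 nmulr_rle0// subr_ge0.
  have [pv|pv] := leP (tangency_poly b v) 0.
    apply: log_profile_le => // w /andP[sw wv]; apply: down pv => //; exact: lt_le_trans sw.
  rewrite -Lst; apply: log_profile_ge => //; first exact: lt_le_trans sv.
  move=> w /andP[vw wt]; apply: (up v) => //; last exact: ltW.
  exact: lt_le_trans sv.
- apply/disc_n_out => //; split; first exact: circ_norm.
  by rewrite radial_circ divr_ge0 ?(ltW (one_sqr_gt0 _))// mulr_ge0// oppr_ge0 ltW.
Qed.

End Field.

(* Written in the shape of [matrix_linear], from which it inherits its linear structure. *)
Definition reflect z : plane R := (1 * z.1 + 0 * z.2, 0 * z.1 + (-1) * z.2).
HB.instance Definition _ := GRing.isLinear.Build R (plane R) (plane R) _ reflect (matrix_linear 1 0 0 (-1)).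

Lemma reflectE z : reflect z = (z.1, - z.2).
Proof. by rewrite /reflect !mul1r !mul0r addr0 add0r mulN1r. Qed.

Lemma reflectK : involutive reflect.
Proof. by move=> z; rewrite !reflectE /= opprK -surjective_pairing. Qed.

Lemma reflect_field k b z : focus_saddle k (- (k * - b)) z = reflect (focus_saddle k (- (k * b)) (reflect z)).
Proof. by rewrite !reflectE /focus_saddle /=; congr pair; ring. Qed.

Lemma reflect_disc : reflect @^-1` disc = disc.
Proof. by apply/funext => z; rewrite /disc /= !mul1r !mul0r addr0 add0r mulN1r sqrrN. Qed.

Lemma reflect_circ s : reflect (circ s) = circ (- s).
Proof. by rewrite reflectE circN. Qed.

Section LowerHalfPlane.
Variable (k : R).
Hypothesis k0 : k < 0.
Notation X b := (focus_saddle k (- (k * b))).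

Lemma lower_exit b s t : s < 0 -> t < 0 -> tangency_poly b s <= 0 -> 0 <= tangency_poly b t ->
  profile b s = profile b t -> exit_point (X b) disc (circ s) (circ t).
Proof.
move=> s0 t0 ps pt st; rewrite -[b]opprK -[s]opprK -[t]opprK -2!(reflect_circ (- _)) -reflect_disc.
apply: (exit_point_linear reflectK reflectK (reflect_field k (- b))).
have pN u : tangency_poly (- b) (- u) = tangency_poly b u by rewrite /tangency_poly; ring.
by apply: upper_exit; rewrite ?oppr_gt0 ?pN// !profileN st.
Qed.

Lemma axis_orbit b x t : 0 < 1 - k * x * t -> flow (X b) (x, 0) t (x / (1 - k * x * t), 0).
Proof.
move=> h; exists (fun s => (x / (1 - k * x * s), 0)); split => //.
  by rewrite mulr0 subr0 divr1.
move=> s /andP[s1 s2]; have p : 0 < 1 - k * x * s.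
  have [t0|t0] := leP 0 t.
    move: s1 s2; rewrite (min_idPl t0) (max_idPr t0) => s1 s2.
    have [kx|kx] := leP (k * x) 0; first by rewrite ltr_wpDr// oppr_ge0 mulr_le0_ge0.
    by apply: (lt_le_trans h); rewrite lerD2l lerN2 ler_pM2l.
  move: s1 s2; rewrite (min_idPr (ltW t0)) (max_idPl (ltW t0)) => s1 s2.
  have [kx|kx] := leP 0 (k * x); first by rewrite ltr_wpDr// oppr_ge0 mulr_ge0_le0.
  by apply: (lt_le_trans h); rewrite lerD2l lerN2 ler_nM2l.
have d := derive_mul (derive_const s x) (derive_inv (f := fun s : R => 1 - k * x * s) (lt0r_neq0 p) (derive_sub (derive_const s 1) (derive_mul (derive_const s (k * x)) (derive_var s)))).
have := derive_pair d (derive_const s 0).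
rewrite (_ : (_, _) = X b (x / (1 - k * x * s), 0))//.
by rewrite /focus_saddle /=; congr pair; field; rewrite gt_eqF.
Qed.

Lemma upper_leaves b z : 0 < z.2 -> exists t, ~ flow_in (X b) disc z t.
Proof.
case: z => x y /= y0; pose r : R := Num.sqrt (x ^+ 2 + y ^+ 2).
have rr0 : 0 < x ^+ 2 + y ^+ 2 by rewrite ltr_wpDl ?sqr_ge0// exprn_gt0.
have r0 : 0 < r by rewrite sqrtr_gt0.
have rE : x ^+ 2 + y ^+ 2 = r ^+ 2 by rewrite sqr_sqrtr// ltW.
have rx : 0 < r + x.
  rewrite -[x]opprK subr_gt0; apply: (le_lt_trans (ler_norm _)); rewrite normrN -sqrtr_sqr ltr_sqrt// ltrDl exprn_gt0//.
pose s0 := y / (r + x); have s00 : 0 < s0 by rewrite divr_gt0.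
have zE := @polar_half_tan _ r (x, y) r0 rE (lt0r_neq0 rx).
(* The value of [log_profile] at which the orbit has radius 1. As [log_profile] tends to minus
   infinity with growing argument, [V] is taken so large that it is below [B], that is, the radius
   exceeds 1. *)
pose B : R := log_profile b s0 + ln r / (- k).
pose V := Num.max (ln s0) (`|b| * pi - B + 1).
have s01 : s0 <= expR V by rewrite -ler_ln ?posrE ?expR_gt0// expRK le_max lexx.
have [T [c [T0 c0 cT hc _]]] := upper_orbit k b s00 s01 r0.
exists T => -[q fq qN].
have fl : flow (X b) (x, y) T (c T).
  by apply/flow_forward => //; exists c; split => //; rewrite c0 subrr mulr0 expR0 mulr1 zE.
move: qN; rewrite (flow_unique (focus_saddle_quadratic _ _) fq fl) cT disc_circ.
apply/negP; rewrite -ltNge exprn_egt1//.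
have u0 := expR_gt0 V; have u1 := one_sqr_gt0 (expR V).
have Lu : log_profile b (expR V) < B.
  have h1 : ln (expR V) <= ln (1 + expR V ^+ 2) - V.
    rewrite expRK lerBrDr -[Y in Y <= _](expRK (V + V)) ler_ln ?posrE ?expR_gt0// expRD -expr2.
    by rewrite lerDr.
  have h2 : - (2 * b * atan (expR V)) <= `|b| * pi.
    apply: (le_trans (ler_norm _)); rewrite normrN !normrM (@ger0_norm _ 2)// [2 * _]mulrC -mulrA ler_wpM2l//.
    have := atan_ltpi2 (expR V); have := lt_atan u0; rewrite atan0 => a1 a2.
    by rewrite gtr0_norm// mulrC -ler_pdivlMr// ltW.
  have h3 : `|b| * pi - B + 1 <= V by rewrite le_max lexx orbT.
  rewrite /log_profile; move: h1 h2 h3; clear; lra.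
rewrite -[Y in Y * _](lnK (x := r)) ?posrE// -expRD expR_gt1.
have -> : ln r = (- k) * (B - log_profile b s0) by rewrite /B; field; rewrite lt_eqF.
have -> : - k * (B - log_profile b s0) + k * (log_profile b (expR V) - log_profile b s0) = - k * (B - log_profile b (expR V)) by ring.
by rewrite mulr_gt0 ?oppr_gt0 ?subr_gt0.
Qed.

Lemma disc_invariant b z : (forall t, flow_in (X b) disc z t) -> z = 0.
Proof.
move=> h; have [y0|y0|y0] := ltrgtP 0 z.2.
- by have [t] := upper_leaves b y0.
- exfalso; have [|t] := @upper_leaves (- b) (reflect z); first by rewrite reflectE /= oppr_gt0.
  apply; rewrite -reflect_disc; apply/(flow_in_linear reflectK reflectK (reflect_field k b)).
  by have := h t; rewrite -{1}(reflectK z).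
- have zE : z = (z.1, 0) by rewrite y0 -surjective_pairing.
  have [x0|x0] := eqVneq z.1 0; first by rewrite zE x0.
  (* The time, of either sign, at which the orbit on the axis is at distance 2 from the origin. *)
  exfalso; pose t := (1 - `|z.1| / 2) / (k * z.1).
  have E : 1 - k * z.1 * t = `|z.1| / 2 by rewrite /t; field; rewrite x0 lt_eqF.
  have [q fq qN] := h t; move: qN.
  have fl := @axis_orbit b z.1 t; rewrite E -zE in fl.
  rewrite (flow_unique (focus_saddle_quadratic _ _) fq (fl _)) ?divr_gt0 ?normr_gt0// /disc /= expr0n addr0.
  have -> : (z.1 / (`|z.1| / 2)) ^+ 2 = 4.
    rewrite !expr_div_n real_normK ?num_real//; field.
    exact: x0.
  by rewrite (ler_nat R 4 1).
Qed.

End LowerHalfPlane.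
End DiscOrbits.

(** * The block map of the unit disc *)

Section BlockMap.
Context {R : realType}.
Variable (b : R).
Implicit Types (z p q : plane R) (s t u v : R) (N : set (plane R)).

Notation rr z := (z.1 ^+ 2 + z.2 ^+ 2).

(** The roots of [tangency_poly b] are the parameters of the two tangencies, which bound the
    entrance arc. Their product is -1: the tangencies are opposite points. *)
Definition tan_max : R := Num.sqrt (b ^+ 2 + 1) - b.
Definition tan_min : R := - Num.sqrt (b ^+ 2 + 1) - b.

Let sq : Num.sqrt (b ^+ 2 + 1) ^+ 2 = b ^+ 2 + 1.
Proof. by rewrite sqr_sqrtr// addr_ge0// sqr_ge0. Qed.

Let sqb : `|b| < Num.sqrt (b ^+ 2 + 1).
Proof. by rewrite -sqrtr_sqr ltr_sqrt ?ltrDl// ltr_wpDl ?sqr_ge0. Qed.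

Lemma tan_max_gt0 : 0 < tan_max.
Proof. by rewrite subr_gt0 (le_lt_trans (ler_norm b)). Qed.

Lemma tan_min_lt0 : tan_min < 0.
Proof. by rewrite /tan_min subr_lt0 ltrNl (le_lt_trans (ler_norm _))// normrN. Qed.

Lemma tan_le : tan_min <= tan_max.
Proof. by rewrite ltW// (lt_trans tan_min_lt0 tan_max_gt0). Qed.

Lemma tan_minE : tan_min = - tan_max^-1.
Proof.
apply: (mulIf (lt0r_neq0 tan_max_gt0)); rewrite mulNr mulVf ?gt_eqF ?tan_max_gt0//.
rewrite /tan_min /tan_max; transitivity (b ^+ 2 - Num.sqrt (b ^+ 2 + 1) ^+ 2); first by ring.
by rewrite sq; ring.
Qed.

Lemma tangency_polyE s : tangency_poly b s = (s - tan_min) * (s - tan_max).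
Proof.
rewrite /tan_min /tan_max.
transitivity ((s + b) ^+ 2 - Num.sqrt (b ^+ 2 + 1) ^+ 2); last by ring.
by rewrite sq /tangency_poly; ring.
Qed.

Lemma tangency_poly_le0 s : (tangency_poly b s <= 0) = (tan_min <= s <= tan_max).
Proof.
rewrite tangency_polyE; have := tan_le; have [h1|h1] := leP tan_min s => hle.
  have [h2|h2] := leP s tan_max; first by rewrite mulr_ge0_le0 ?subr_ge0 ?subr_le0.
  apply/negbTE; rewrite -ltNge mulr_gt0 ?subr_gt0//; exact: le_lt_trans h2.
apply/negbTE; rewrite -ltNge nmulr_rgt0 ?subr_lt0//; exact: lt_le_trans h1 hle.
Qed.

Lemma profile_lt u v : tan_min <= u -> u < v -> v <= tan_max -> profile b u < profile b v.
Proof.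
move=> u1 uv v1; have [c /andP[uc cv] E] := MVT_oo uv (fun s _ => derive_profile b s).
rewrite -subr_gt0 E pmulr_lgt0 ?subr_gt0// mulr_gt0 ?expR_gt0//.
rewrite divr_gt0 ?exprn_gt0 ?one_sqr_gt0// mulNr oppr_gt0 pmulr_rlt0// tangency_polyE.
by rewrite pmulr_rlt0 ?subr_lt0 ?subr_gt0 ?(lt_le_trans cv)// (le_lt_trans u1).
Qed.

Lemma profile_inj u v : tan_min <= u <= tan_max -> tan_min <= v <= tan_max ->
  profile b u = profile b v -> u = v.
Proof.
move=> /andP[u1 u2] /andP[v1 v2] E; case: (ltgtP u v) => // h.
  by have := profile_lt u1 h v2; rewrite E ltxx.
by have := profile_lt v1 h u2; rewrite E ltxx.
Qed.

Lemma profile_le u v : tan_min <= u -> u <= v -> v <= tan_max -> profile b u <= profile b v.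
Proof. by move=> u1; rewrite le_eqVlt => /predU1P[->//|uv v1]; apply/ltW/profile_lt. Qed.

Lemma profile0 : profile b 0 = 0.
Proof. by rewrite /profile mulr0 mul0r mul0r. Qed.

Lemma profile_gt0 s : 0 < s -> 0 < profile b s.
Proof. by move=> s0; rewrite mulr_gt0 ?expR_gt0// divr_gt0 ?one_sqr_gt0// mulr_gt0. Qed.

Lemma profile_lt0 s : s < 0 -> profile b s < 0.
Proof. by move=> s0; rewrite pmulr_llt0 ?expR_gt0// pmulr_llt0 ?invr_gt0 ?one_sqr_gt0// pmulr_rlt0. Qed.

Definition profile_inv (y : R) : R := xget 0 [set s | tan_min <= s <= tan_max /\ profile b s = y].

Lemma profileK s : tan_min <= s <= tan_max -> profile_inv (profile b s) = s.
Proof.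
move=> hs; rewrite /profile_inv; case: xgetP => [u _ [u1 u2]|/(_ s)]; first exact: profile_inj.
by case.
Qed.

Lemma profile_cont : {within `[tan_min, tan_max], continuous (profile b)}.
Proof. by apply: within_cont_derive => s _; exact: derive_profile. Qed.

Lemma profile_invK y : profile b tan_min <= y <= profile b tan_max ->
  tan_min <= profile_inv y <= tan_max /\ profile b (profile_inv y) = y.
Proof.
move=> hy; have pp := profile_le (lexx _) tan_le (lexx _).
have [|s] := IVT tan_le profile_cont (v := y); first by rewrite (min_idPl pp) (max_idPr pp).
by rewrite in_itv /= => hs <-; rewrite profileK.
Qed.

Lemma profile_inv_cont : {within `[profile b tan_min, profile b tan_max], continuous profile_inv}.
Proof.
apply: (segment_can_le_continuous tan_le profile_cont) => s.
by rewrite in_itv /=; exact: profileK.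
Qed.

(* The level of the first integral, read at the point opposite to the exit point. *)
Definition opposite_level s : R :=
  expR (- (b * pi)) * Num.max 0 (- profile b s) - expR (b * pi) * Num.max 0 (profile b s).

Lemma opposite_level_ge0 s : 0 <= s -> opposite_level s = - expR (b * pi) * profile b s.
Proof.
rewrite /opposite_level le_eqVlt => /predU1P[<-|/profile_gt0 s0].
  by rewrite profile0 oppr0 maxxx !mulr0 subr0.
by rewrite (max_idPl _) ?oppr_le0 ?ltW// (max_idPr (ltW s0)) mulr0 sub0r mulNr.
Qed.

Lemma opposite_level_le0 s : s <= 0 -> opposite_level s = - expR (- (b * pi)) * profile b s.
Proof.
rewrite /opposite_level le_eqVlt => /predU1P[->|/profile_lt0 s0].
  by rewrite profile0 oppr0 maxxx !mulr0 subr0.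
by rewrite (max_idPr _) ?oppr_ge0 ?ltW// (max_idPl (ltW s0)) mulr0 subr0 mulrN mulNr.
Qed.

Lemma max0_cont (h : R -> R) s : {for s, continuous h} -> {for s, continuous (fun x => Num.max 0 (h x))}.
Proof. by move=> hc; apply: continuous_max => //; exact: cvg_cst. Qed.

Lemma opposite_level_cont s : {for s, continuous opposite_level}.
Proof.
have pc : {for s, continuous (profile b)} by exact: derive_cont (derive_profile b s).
have m1 : {for s, continuous (fun x : R => Num.max 0 (- profile b x))}.
  by apply: max0_cont; exact: cvgN.
have m2 : {for s, continuous (fun x : R => Num.max 0 (profile b x))} by exact: max0_cont.
by apply: cvgB; apply: cvgM; [exact: cvg_cst|exact: m1|exact: cvg_cst|exact: m2].
Qed.

(** The ends of the entrance arc are opposite, so [profile b tan_min] is [- expR (b * pi)] times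
    [profile b tan_max]; the extreme values are exchanged, and monotonicity gives the rest. *)
Lemma opposite_level_range s : tan_min <= s <= tan_max ->
  profile b tan_min <= opposite_level s <= profile b tan_max.
Proof.
move=> /andP[s1 s2]; have E := profileV_pos b tan_max_gt0; rewrite -tan_minE in E.
have p1 := profile_lt0 tan_min_lt0; have p2 := profile_gt0 tan_max_gt0.
have [s0|/ltW s0] := leP 0 s.
  rewrite opposite_level_ge0// E !mulNr lerN2 ler_pM2l ?expR_gt0// profile_le// ?(le_trans (ltW tan_min_lt0))//=.
  apply: (@le_trans _ _ 0); last exact: ltW.
  by rewrite oppr_le0 mulr_ge0 ?expR_ge0// -profile0 profile_le// ltW// tan_min_lt0.
rewrite opposite_level_le0//.
have E' : profile b tan_max = - expR (- (b * pi)) * profile b tan_min.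
  by rewrite E mulrA mulrNN -expRD addNr expR0 mul1r.
rewrite E' !mulNr lerN2 ler_pM2l ?expR_gt0// profile_le// andbT.
apply: (@le_trans _ _ 0); first exact: ltW.
by rewrite oppr_ge0 mulr_ge0_le0 ?expR_ge0// -profile0 profile_le// ltW// tan_max_gt0.
Qed.

(** The orbit entering at [circ s] leaves at the opposite of [circ (opposite_tan s)]. Passing to the
    opposite point brings the exit arc back to the entrance arc, where [profile b] is injective, and
    avoids the infinite parameter of [(-1, 0)]. *)
Definition opposite_tan s : R := profile_inv (opposite_level s).

Lemma opposite_tanP s : tan_min <= s <= tan_max ->
  tan_min <= opposite_tan s <= tan_max /\ profile b (opposite_tan s) = opposite_level s.
Proof. by move=> /opposite_level_range /profile_invK. Qed.

Lemma opposite_tan0 : opposite_tan 0 = 0.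
Proof.
rewrite /opposite_tan opposite_level_ge0// profile0 mulr0 -[in LHS]profile0 profileK//.
by rewrite !ltW ?tan_min_lt0 ?tan_max_gt0.
Qed.

Lemma opposite_tan_pos s : 0 < s -> s <= tan_max -> opposite_tan s < 0.
Proof.
move=> s0 s1; have sI : tan_min <= s <= tan_max by rewrite s1 (le_trans (ltW tan_min_lt0))// ltW.
have [_ E] := opposite_tanP sI; rewrite ltNge; apply/negP; rewrite le_eqVlt => /predU1P[h|/profile_gt0].
  have := profile_gt0 s0; move: E; rewrite -h profile0 opposite_level_ge0 ?ltW// => /esym/eqP.
  by rewrite mulf_eq0 oppr_eq0 gt_eqF ?expR_gt0//= => /eqP ->; rewrite ltxx.
rewrite E opposite_level_ge0 ?ltW// mulNr oppr_gt0 => h.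
by have := mulr_gt0 (expR_gt0 (b * pi)) (profile_gt0 s0); rewrite ltNge (ltW h).
Qed.

Lemma opposite_tan_neg s : s < 0 -> tan_min <= s -> 0 < opposite_tan s.
Proof.
move=> s0 s1; have sI : tan_min <= s <= tan_max by rewrite s1 (le_trans (ltW s0))// ltW// tan_max_gt0.
have [_ E] := opposite_tanP sI; rewrite ltNge; apply/negP; rewrite le_eqVlt => /predU1P[h|/profile_lt0].
  have := profile_lt0 s0; move: E; rewrite h profile0 opposite_level_le0 ?ltW// => /esym/eqP.
  by rewrite mulf_eq0 oppr_eq0 gt_eqF ?expR_gt0//= => /eqP ->; rewrite ltxx.
rewrite E opposite_level_le0 ?ltW// mulNr oppr_lt0 ltNge => /negP; apply.
by rewrite mulr_ge0_le0 ?expR_ge0// ltW// profile_lt0.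
Qed.

Lemma opposite_tan_cont s : tan_min <= s <= tan_max ->
  forall A, nbhs (opposite_tan s) A -> \forall u \near s, tan_min <= u <= tan_max -> A (opposite_tan u).
Proof.
move=> sI A nA; have h := opposite_level_range sI.
have /subspace_continuousP/(_ (opposite_level s)) := profile_inv_cont.
rewrite /= in_itv /= => /(_ h).
change (profile_inv x @[x --> within `[profile b tan_min, profile b tan_max] (nbhs (opposite_level s))] -->
  profile_inv (opposite_level s) -> \forall u \near s, tan_min <= u <= tan_max -> A (opposite_tan u)).
move=> /(_ _ nA) nA'.
have {}nA' : nbhs (opposite_level s) [set y | y \in `[profile b tan_min, profile b tan_max] -> A (profile_inv y)] by exact: nA'.
have nA2 : \forall u \near s, opposite_level u \in `[profile b tan_min, profile b tan_max] ->
    A (profile_inv (opposite_level u)) by exact: (opposite_level_cont nA').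
apply: filterS nA2 => u hu uI; apply: hu.
by rewrite in_itv /=; exact: opposite_level_range.
Qed.

Lemma max0_lipschitz (x y : R) : `|Num.max 0 x - Num.max 0 y| <= `|x - y|.
Proof.
have [x0|x0] := leP 0 x; have [y0|y0] := leP 0 y => //.
- by rewrite subr0 ger0_norm// ler_normr; apply/orP; left; rewrite lerDl oppr_ge0 ltW.
- by rewrite sub0r normrN ger0_norm// distrC ler_normr; apply/orP; left; rewrite lerDl oppr_ge0 ltW.
- by rewrite subrr normr0.
Qed.

(** [profile b] has derivative 2 at 0, so it is bi-Lipschitz there, and [opposite_level] is a
    Lipschitz function of the profile because [max 0] is. The two slopes at 0 differ unless
    [b = 0]. *)
Lemma opposite_tan_lipschitz : lipschitz_germ opposite_tan.
Proof.
pose dp s : R := - 2 * tangency_poly b s / (1 + s ^+ 2) ^+ 2 * expR (- (2 * b * atan s)).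
have dpc : {for 0, continuous dp}.
  have tp := derive_sub (derive_add (derive_exp 2 (derive_var (0 : R))) (derive_mul (derive_const 0 (2 * b)) (derive_var (0 : R)))) (derive_const (0 : R) 1).
  have d2 := derive_exp 2 (derive_add (derive_const (0 : R) 1) (derive_exp 2 (derive_var (0 : R)))).
  have d2n : (1 + (0 : R) ^+ 2) ^+ 2 != 0 by rewrite expf_neq0// gt_eqF// one_sqr_gt0.
  have de := derive_expR (derive_opp (derive_mul (derive_const (0 : R) (2 * b)) (derive_atan (derive_var (0 : R))))).
  exact: (derive_cont (derive_mul (derive_mul (derive_mul (derive_const (0 : R) (- 2)) tp) (derive_inv (f := fun s : R => (1 + s ^+ 2) ^+ 2) d2n d2)) de)).
have dp0 : dp 0 = 2.
  by rewrite /dp /tangency_poly atan0 mulr0 oppr0 expR0 expr0n /= addr0; field.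
have : \forall s \near (0 : R), `|dp 0 - dp s| < 1 by exact: cvgr_dist_lt dpc _ ltr01.
move=> /nbhs_ballP[e /= e0 he].
have dpb s : `|s| < e -> 1 <= dp s <= 3.
  move=> se; have : `|dp 0 - dp s| < 1 by apply: he; rewrite /ball /= sub0r normrN.
  by rewrite dp0 ltr_norml => /andP[h1 h2]; apply/andP; split; move: h1 h2; clear; lra.
(* The derivative of the profile is between 1 and 3 near 0, which bounds differences both ways. *)
have key u v : `|u| < e -> `|v| < e -> `|u - v| <= `|profile b u - profile b v| <= 3 * `|u - v|.
  wlog uv : u v / u <= v.
    move=> H ue ve; have [uv|/ltW vu] := leP u v; first exact: H.
    by rewrite [`|u - v|]distrC [`|profile b u - _|]distrC; apply: H.
  rewrite !ltr_norml => /andP[u1 _] /andP[_ v2].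
  have [c /andP[uc cv] E] := MVT_cc uv (fun s _ => derive_profile b s).
  have ce : `|c| < e by rewrite ltr_norml (lt_le_trans u1 uc) (le_lt_trans cv v2).
  rewrite ![`|_ - v|]distrC [`|profile b u - _|]distrC E normrM (ger0_norm (x := v - u)) ?subr_ge0//.
  have /andP[d1 d3] := dpb _ ce.
  rewrite -/(dp c) ger0_norm ?(le_trans ler01 d1)//.
  by rewrite ler_peMl ?subr_ge0//= ler_wpM2r ?subr_ge0.
have zI : tan_min <= 0 <= tan_max by rewrite !ltW ?tan_min_lt0 ?tan_max_gt0.
have nI : \forall s \near (0 : R), tan_min <= s <= tan_max.
  near=> s; apply/andP; split; apply: ltW; near: s.
    by apply: lt_nbhsr; exact: tan_min_lt0.
  by apply: lt_nbhsl; exact: tan_max_gt0.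
have nb0 : nbhs (opposite_tan 0) [set y : R | `|y| < e].
  apply/nbhs_ballP; exists e => // y; rewrite opposite_tan0 /ball /= sub0r normrN //.
have nV := opposite_tan_cont zI nb0.
have ne : \forall s \near (0 : R), `|s| < e.
  by apply/nbhs_ballP; exists e => // y; rewrite /ball /= sub0r normrN.
exists [set s | [/\ tan_min <= s <= tan_max, `|s| < e & `|opposite_tan s| < e]].
  by near=> s; split; [near: s; exact: nI|near: s; exact: ne|have sI : tan_min <= s <= tan_max by (near: s; exact: nI)]; move: sI; near: s; exact: nV.
pose K : R := expR (- (b * pi)) + expR (b * pi).
rewrite /lipschitz_on; near=> M => -[x y] /= [[xI xe xV] [yI ye yV]].
have /andP[h1 _] := key _ _ xV yV; have /andP[_ h2] := key _ _ xe ye.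
apply: (le_trans h1); rewrite (opposite_tanP xI).2 (opposite_tanP yI).2.
have h3 : `|opposite_level x - opposite_level y| <= K * `|profile b x - profile b y|.
  rewrite /opposite_level.
  set A := Num.max 0 (- profile b x); set B := Num.max 0 (- profile b y).
  set A' := Num.max 0 (profile b x); set B' := Num.max 0 (profile b y).
  have -> : expR (- (b * pi)) * A - expR (b * pi) * A' - (expR (- (b * pi)) * B - expR (b * pi) * B') =
     expR (- (b * pi)) * (A - B) + expR (b * pi) * (B' - A') by ring.
  apply: (le_trans (ler_normD _ _)); rewrite !normrM !(gtr0_norm (expR_gt0 _)) mulrDl lerD// ler_wpM2l ?expR_ge0//.
    by apply: (le_trans (max0_lipschitz _ _)); rewrite opprK addrC distrC.
  by rewrite distrC; exact: max0_lipschitz.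
apply: (le_trans h3); apply: (@le_trans _ _ (K * (3 * `|x - y|))).
  by rewrite ler_wpM2l// addr_ge0 ?expR_ge0.
rewrite mulrA ler_wpM2r//; near: M; exact: nbhs_pinfty_ge (num_real _).
Unshelve. all: by end_near.
Qed.

(** For [b = 0] the profile is odd and both exponential factors are 1, so [opposite_tan s] is
    [- s]. *)
Lemma opposite_tan_smooth : b = 0 -> smooth_germ opposite_tan.
Proof.
move=> b0.
have E s : tan_min <= s <= tan_max -> opposite_tan s = - s.
  move=> /andP[s1 s2].
  have Ns : tan_min <= - s <= tan_max.
    by move: s1 s2; rewrite /tan_min /tan_max b0 !subr0 => s1 s2; rewrite lerN2 s2 lerNl s1.
  rewrite -[RHS](profileK Ns) /opposite_tan; congr profile_inv.
  have -> : profile b (- s) = - profile b s by rewrite -profileN b0 oppr0.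
  have [s0|/ltW s0] := leP 0 s; [rewrite opposite_level_ge0//|rewrite opposite_level_le0//];
    by rewrite b0 mul0r ?oppr0 expR0 mulN1r.
pose U : set R := [set s | tan_min < s < tan_max].
have oU : open U.
  have -> : U = `]tan_min, tan_max[%classic by apply/funext => s; rewrite /U /= in_itv.
  exact: itv_open.
exists U; first by split=> //; rewrite /U /= tan_min_lt0 tan_max_gt0.
move=> n; apply: (Ck_on_ext (f := fun s => - s)) => //.
  by move=> s /andP[s1 s2]; rewrite E// !ltW.
apply: (@Ck_on_linear _ _ U n _ -%R) => s; exact: opp_continuous.
Qed.

End BlockMap.

(** * The disc as an isolating block and its block map *)

Section DiscBlock.
Context {R : realType}.
Variables (k b : R).
Hypothesis k0 : k < 0.
Implicit Types (z p q : plane R) (s t u v : R).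

Notation rr z := (z.1 ^+ 2 + z.2 ^+ 2).
Notation X := (focus_saddle k (- (k * b))).
Let hX : quadratic_field X := focus_saddle_quadratic k (- (k * b)).

Lemma disc_isolating_block : isolating_block X disc.
Proof.
have tanE z : tangency X disc z <-> rr z = 1 /\ k * (z.1 - b * z.2) = 0.
  rewrite disc_tangency; split=> -[z1]; rewrite focus_saddle_radial z1 mulr1; by [].
split; [exact: disc_compact|exact: disc_smooth| | |].
- rewrite eqEsubset; split => z /=; first exact: disc_invariant.
  move=> -> t; exists 0; first exact: flow_const0.
  by rewrite /disc /= expr0n addr0.
- rewrite eqEsubset; split => z.
    move=> [/(disc_n_in k0)[z1 r1] /(disc_n_out k0)[_ r2]]; apply/tanE; split => //.
    by apply/eqP; rewrite eq_le r1 r2.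
  by move=> /tanE[z1 z2]; split; [apply/(disc_n_in k0)|apply/(disc_n_out k0)]; rewrite z2.
(* The only other tangency is [- p]; an open half-plane containing [p] separates them. *)
- move=> p /tanE[p1 p2]; exists [set z | 0 < z.1 * p.1 + z.2 * p.2].
    have fc : {for p, continuous (fun z : plane R => z.1 * p.1 + z.2 * p.2)}.
      by apply: cvgD; apply: cvgM; [exact: fst_cont|exact: cvg_cst|exact: snd_cont|exact: cvg_cst].
    apply: (@cont_near _ _ (fun z : plane R => z.1 * p.1 + z.2 * p.2) p [set x | 0 < x] fc).
    by apply: lt_nbhsr; rewrite -!expr2 p1.
  rewrite eqEsubset; split => z; last first.
    by move=> ->; split; [apply/tanE|rewrite /= -!expr2 p1].
  move=> [/tanE[z1 z2] /= zp].
  have x1 (w : plane R) : k * (w.1 - b * w.2) = 0 -> w.1 = b * w.2.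
    by move=> /eqP; rewrite mulf_eq0 lt_eqF//= subr_eq0 => /eqP.
  have zE := x1 _ z2; have pE := x1 _ p2.
  have bE : 1 + b ^+ 2 != 0 by rewrite gt_eqF// one_sqr_gt0.
  have : (z.2 - p.2) * (z.2 + p.2) = 0.
    apply: (mulIf bE); rewrite mul0r.
    transitivity (rr z - rr p); last by rewrite z1 p1 subrr.
    by rewrite zE pE; ring.
  have zp' : 0 < z.2 * p.2.
    have E : z.1 * p.1 + z.2 * p.2 = (z.2 * p.2) * (1 + b ^+ 2) by rewrite zE pE; ring.
    by move: zp; rewrite E pmulr_lgt0// one_sqr_gt0.
  move=> /eqP; rewrite mulf_eq0 subr_eq0 addr_eq0 => /orP[/eqP E|/eqP E].
    by rewrite /= [z]surjective_pairing [p]surjective_pairing zE pE E.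
  by move: zp'; rewrite E mulNr oppr_gt0 ltNge -expr2 sqr_ge0.
Qed.

Lemma disc_n_inP z : n_in X disc z <-> exists2 s, tan_min b <= s <= tan_max b & z = circ s.
Proof.
rewrite (disc_n_in k0); split=> [[z1 zr]|[s hs ->]]; last first.
  split; first exact: circ_norm.
  by rewrite radial_circ mulr_le0_ge0 ?invr_ge0 ?(ltW (one_sqr_gt0 _))// mulr_ge0_le0 ?tangency_poly_le0// oppr_ge0 ltW.
(* The point [(-1, 0)], missed by [circ], has radial factor [- k > 0] and is not an entrance
   point. *)
have zn : 1 + z.1 != 0.
  rewrite addrC addr_eq0; apply/eqP => x1.
  have y0 : z.2 = 0.
    by move: z1; rewrite x1 sqrrN expr1n => /eqP; rewrite -subr_eq0 addrC addKr sqrf_eq0 => /eqP.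
  by move: zr; rewrite x1 y0 mulr0 subr0 mulrN1 oppr_le0 leNgt k0.
exists (half_tan z); last by rewrite circK.
have h := radial_circ k b (half_tan z); rewrite circK// in h.
move: zr; rewrite h -tangency_poly_le0 pmulr_lle0 ?invr_gt0 ?one_sqr_gt0//.
by rewrite pmulr_rle0// oppr_gt0.
Qed.

Definition disc_block_map z : plane R := - circ (opposite_tan b (half_tan z)).

Lemma disc_block_map_circ s : disc_block_map (circ s) = - circ (opposite_tan b s).
Proof. by rewrite /disc_block_map half_tanK. Qed.

Lemma disc_a_in : a_in X disc (1, 0).
Proof.
split=> [|t t0].
  apply/disc_n_inP; exists 0; last by rewrite circ0.
  by rewrite !ltW ?tan_min_lt0 ?tan_max_gt0.
have kt : 0 < 1 - k * 1 * t by rewrite mulr1 ltr_wpDr// oppr_ge0 mulr_le0_ge0// ltW.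
exists (1 / (1 - k * 1 * t), 0); first exact: axis_orbit.
rewrite /disc /= expr0n addr0 div1r exprVn invf_le1 ?exprn_gt0// exprn_ege1//.
by rewrite lerDl oppr_ge0 mulr1 mulr_le0_ge0// ltW.
Qed.

(** The exit point is [circ (- w^-1)], in the same half plane as the entry. The rule for opposite
    points turns the equation defining [w] into equality of the profiles at both ends. *)
Lemma disc_exit s : tan_min b <= s <= tan_max b -> s != 0 ->
  exit_point X disc (circ s) (disc_block_map (circ s)).
Proof.
move=> hs; have /andP[s1 s2] := hs; have [pI pE] := opposite_tanP hs.
set w := opposite_tan b s in pI pE.
have ps : tangency_poly b s <= 0 by rewrite tangency_poly_le0.
have pt : w != 0 -> 0 <= tangency_poly b (- w^-1).
  move=> w0; have -> : tangency_poly b (- w^-1) = - tangency_poly b w / w ^+ 2.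
    by rewrite /tangency_poly; field.
  by rewrite divr_ge0 ?sqr_ge0// oppr_ge0 tangency_poly_le0.
rewrite disc_block_map_circ -/w neq_lt => /orP[s0|s0].
  have w0 : 0 < w by apply: opposite_tan_neg.
  rewrite -circV ?gt_eqF//; apply: (lower_exit k0) => //.
  - by rewrite oppr_lt0 invr_gt0.
  - by apply: pt; rewrite gt_eqF.
  rewrite profileV_pos// pE opposite_level_le0 ?ltW//.
  by rewrite mulrA mulrNN -expRD subrr expR0 mul1r.
have w0 : w < 0 by apply: opposite_tan_pos.
rewrite -circV ?lt_eqF//; apply: (upper_exit k0) => //.
- by rewrite oppr_gt0 invr_lt0.
- by apply: pt; rewrite lt_eqF.
rewrite profileV_neg// pE opposite_level_ge0 ?ltW//.
by rewrite mulrA mulrNN -expRD addNr expR0 mul1r.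
Qed.

Lemma circ_cont : continuous (@circ R).
Proof.
move=> s; have dd := derive_inv (f := fun u : R => 1 + u ^+ 2) (lt0r_neq0 (one_sqr_gt0 s)) (derive_add (derive_const s 1) (derive_exp 2 (derive_var s))).
have d1 := derive_mul (derive_sub (derive_const s 1) (derive_exp 2 (derive_var s))) dd.
have d2 := derive_mul (derive_mul (derive_const s 2) (derive_var s)) dd.
exact: (cvg_pair (derive_cont d1) (derive_cont d2)).
Qed.

Lemma disc_block_extension : block_extension X disc disc_block_map.
Proof.
split.
- move=> p /disc_n_inP[s hs ->]; rewrite disc_block_map_circ; apply/(disc_n_out k0).
  have [pI _] := opposite_tanP hs; set w := opposite_tan b s in pI *.
  have E1 := circ_norm w; have E2 := radial_circ k b w.
  have -> : k * ((- circ w).1 - b * (- circ w).2) = - (k * ((circ w).1 - b * (circ w).2)).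
    rewrite -[(- circ w).1]/(- (circ w).1) -[(- circ w).2]/(- (circ w).2).
    by move: (circ w).1 (circ w).2 => x y; ring.
  split.
    by rewrite -[RHS]E1; congr (_ + _); rewrite [LHS]sqrrN.
  rewrite E2 -mulNr -mulNr opprK divr_ge0 ?(ltW (one_sqr_gt0 _))//.
  by rewrite mulr_le0// ?tangency_poly_le0// ltW.
- move=> p [/disc_n_inP[s hs ->] nas]; apply: disc_exit => //.
  by apply/eqP => s0; apply: nas; rewrite s0 circ0; exact: disc_a_in.
- apply/subspace_continuousP => p np.
  change (disc_block_map x @[x --> within (n_in X disc) (nbhs p)] --> disc_block_map p).
  have /disc_n_inP[s hs pE] := np.
  have tc : {for p, continuous half_tan}.
    have den : 1 + p.1 != 0.
      have s1 := one_sqr_gt0 s; rewrite pE /circ /=.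
      have -> : 1 + (1 - s ^+ 2) / (1 + s ^+ 2) = 2 / (1 + s ^+ 2) by field; rewrite gt_eqF.
      by rewrite mulf_neq0 ?invr_eq0 ?gt_eqF.
    apply: cvgM; first exact: snd_cont.
    by apply: cvgV => //; apply: cvgD; [exact: cvg_cst|exact: fst_cont].
  have oc : opposite_tan b (half_tan z) @[z --> within (n_in X disc) (nbhs p)] --> opposite_tan b (half_tan p).
    rewrite pE half_tanK => A /(opposite_tan_cont hs) nA.
    have {}nA : nbhs (half_tan p) [set u | tan_min b <= u <= tan_max b -> A (opposite_tan b u)].
      by rewrite pE half_tanK.
    have nA2 : \forall z \near p, tan_min b <= half_tan z <= tan_max b -> A (opposite_tan b (half_tan z)).
      exact: (tc _ nA).
    rewrite -pE; apply: filterS nA2 => z hz /disc_n_inP[u hu zE]; apply: hz.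
    by rewrite zE half_tanK.
  by apply: cvgN; apply: (cvg_comp _ (@circ R) oc); exact: circ_cont.
Qed.

(** Away from [(1, 0)] the value is the exit point, which is unique; [(1, 0)] is a limit of such
    entrance points, so continuity determines the value there. *)
Lemma disc_extension_unique g : block_extension X disc g -> forall p, n_in X disc p ->
  g p = disc_block_map p.
Proof.
move=> gext p /disc_n_inP[s hs ->].
have [_ gexit gc] := gext; have [_ _ fc] := disc_block_extension.
have off u : tan_min b <= u <= tan_max b -> u != 0 -> g (circ u) = disc_block_map (circ u).
  move=> hu u0; have e := disc_exit hu u0; apply: (exit_point_unique hX _ e); apply: gexit; split.
    by apply/disc_n_inP; exists u.
  exact: exit_not_a_in hX e.
have [s0|] := eqVneq s 0; last exact: off.
have n0 : n_in X disc (circ s) by apply/disc_n_inP; exists s.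
have zmin := tan_min_lt0 b; have zmax := tan_max_gt0 b.
have nI : \forall u \near (0 : R)^', tan_min b <= u <= tan_max b /\ u != 0.
  have n1 : \forall u \near (0 : R)^', u != 0 by rewrite near_withinE; near=> u.
  have n2 : \forall u \near (0 : R)^', tan_min b <= u <= tan_max b.
    apply: cvg_within; near=> u; apply/andP; split; apply: ltW; near: u.
      exact: lt_nbhsr.
    exact: lt_nbhsl.
  by apply: filterS2 n2 n1.
have lim (h : plane R -> plane R) : {within n_in X disc, continuous h} -> h (circ u) @[u --> (0 : R)^'] --> h (circ s).
  move=> /subspace_continuousP/(_ _ n0).
  change (h x @[x --> within (n_in X disc) (nbhs (circ s))] --> h (circ s) -> h (circ u) @[u --> (0 : R)^'] --> h (circ s)).
  move=> hc A /hc nA.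
  have {}nA : nbhs (circ s) [set z | n_in X disc z -> A (h z)] by exact: nA.
  rewrite s0 in nA.
  have nA2 : \forall u \near (0 : R)^', n_in X disc (circ u) -> A (h (circ u)).
    by apply: cvg_within; exact: (@circ_cont 0 _ nA).
  by apply: filterS2 nA2 nI => u hu [uI _]; apply: hu; apply/disc_n_inP; exists u.
have l1 := lim _ gc; have l2 : g (circ u) @[u --> (0 : R)^'] --> disc_block_map (circ s).
  apply: (@cvg_trans _ (disc_block_map (circ u) @[u --> (0 : R)^'])); last exact: lim.
  by apply: near_eq_cvg; apply: filterS nI => u [uI u0]; rewrite off.
exact: cvg_unique l1 l2.
Unshelve. all: by end_near.
Qed.

Lemma disc_a_inE p : a_in X disc p -> p = (1, 0).
Proof.
move=> ap; have /disc_n_inP[s hs pE] := ap.1.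
have [s0|s0] := eqVneq s 0; first by rewrite pE s0 circ0.
by exfalso; move: ap; rewrite pE; apply: (exit_not_a_in hX (disc_exit hs s0)).
Qed.

(** The charts at [(1, 0)] and [(-1, 0)] both read the half-angle tangent, so the transition germ is
    exactly [opposite_tan b]. *)
Lemma disc_chart_right q (q1 : rr q = 1) u : q = (1, 0) -> chart_inv (disc_chart q1) (u, 0) = circ u.
Proof.
move=> qE; rewrite /= /disc_chart_inv /rot /moebius_inv qE /circ /=.
have u1 := one_sqr_gt0 u.
have -> : u ^+ 2 + (1 + 0) ^+ 2 = 1 + u ^+ 2 by ring.
by congr pair; field; rewrite gt_eqF.
Qed.

Lemma disc_chart_left q (q1 : rr q = 1) u : q = (-1, 0) -> (disc_chart q1 (- circ u)).1 = u.
Proof.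
move=> qE; rewrite /= /disc_chart_map /rot /moebius qE /circ.
have u1 := one_sqr_gt0 u; rewrite /=.
have E : (1 + (-1 * - ((1 - u ^+ 2) / (1 + u ^+ 2)) + 1 * 0 * - (2 * u / (1 + u ^+ 2)))) ^+ 2 +
   (-1 * - (2 * u / (1 + u ^+ 2)) - 1 * 0 * - ((1 - u ^+ 2) / (1 + u ^+ 2))) ^+ 2 = 4 / (1 + u ^+ 2).
  by field; rewrite gt_eqF.
by rewrite E; field; rewrite gt_eqF.
Qed.

Lemma focus_saddle_regularisable (C : (R -> R) -> Prop) : C (opposite_tan b) -> regularisable C X.
Proof.
move=> CD; exists disc; first exact: disc_isolating_block.
exists disc_block_map; split; [exact: disc_block_extension|exact: disc_extension_unique|].
move=> p /disc_a_inE pE.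
have p1 : rr p = 1 by rewrite pE /= expr1n expr0n addr0.
have fE : disc_block_map p = (-1, 0).
  rewrite pE -circ0 disc_block_map_circ opposite_tan0 circ0.
  by rewrite -[LHS]/(- 1, - 0) oppr0.
have f1 : rr (disc_block_map p) = 1 by rewrite fE /= sqrrN expr1n expr0n addr0.
exists (disc_chart p1), (disc_chart f1).
suff -> : (fun s => (disc_chart f1 (disc_block_map (chart_inv (disc_chart p1) (s, 0)))).1) = opposite_tan b by [].
by apply/funext => s; rewrite (disc_chart_right p1 s pE) disc_block_map_circ (disc_chart_left f1 _ fE).
Qed.

End DiscBlock.

(** * Normal forms and characteristic values *)

Section Classification.
Context {R : realType}.
Implicit Types (X Y : plane R -> plane R) (z w : plane R).

Definition cross z w : R := z.1 * w.2 - z.2 * w.1.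

Lemma directional_polyE X z : directional_poly X z.1 z.2 = cross z (X z).
Proof. by rewrite /directional_poly -surjective_pairing. Qed.

Lemma cross_linear (T : {linear plane R -> plane R}) z w :
  cross (T z) (T w) = cross (T (1, 0)) (T (0, 1)) * cross z w.
Proof. by rewrite /cross (plane_linearE T z) (plane_linearE T w) /=; ring. Qed.

Lemma cross_linear_neq0 (T T' : {linear plane R -> plane R}) : cancel T' T ->
  cross (T (1, 0)) (T (0, 1)) != 0.
Proof.
move=> T'K; have := cross_linear T (T' (1, 0)) (T' (0, 1)); rewrite !T'K.
rewrite {1}/cross /= mulr0 subr0 mulr1 => E; apply/eqP => d0.
by move: E; rewrite d0 mul0r => /eqP; rewrite oner_eq0.
Qed.

Lemma quadratic_linear (T T' : {linear plane R -> plane R}) X :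
  quadratic_field X -> quadratic_field (fun z => T (X (T' z))).
Proof.
move=> /quadratic_fieldP[a [b [c [a' [b' [c' XE]]]]]].
move: (plane_linearE T) (plane_linearE T').
set s11 := (T' (1, 0)).1; set s21 := (T' (1, 0)).2; set s12 := (T' (0, 1)).1; set s22 := (T' (0, 1)).2.
move=> TE T'E.
have form (l l' : R) : quadratic_form (fun z => (X (T' z)).1 * l + (X (T' z)).2 * l').
  pose A := a * l + a' * l'; pose B := b * l + b' * l'; pose C := c * l + c' * l'.
  exists (A * s11 ^+ 2 + B * s11 * s21 + C * s21 ^+ 2), (2 * A * s11 * s12 + B * (s11 * s22 + s12 * s21) + 2 * C * s21 * s22), (A * s12 ^+ 2 + B * s12 * s22 + C * s22 ^+ 2) => x y.
  by rewrite T'E XE /=; rewrite /A /B /C; ring.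
split.
  have [A [B [C h]]] := form (T (1, 0)).1 (T (0, 1)).1.
  by exists A, B, C => x y; rewrite -h TE.
have [A [B [C h]]] := form (T (1, 0)).2 (T (0, 1)).2.
by exists A, B, C => x y; rewrite -h TE.
Qed.

(** The directional polynomial is the determinant of [z] and [X z], so [T] multiplies it by its
    determinant, and a squared linear factor is pulled back to a squared linear factor. *)
Lemma class_V_linear X Y : linearly_equivalent X Y -> class_V X -> class_V Y.
Proof.
move=> [T [T' [TK T'K YE]]] [hX iso simple].
have {}YE : Y = fun z => T (X (T' z)) by apply/funext.
split; first by rewrite YE; exact: quadratic_linear.
  have n0 : \forall z \near (0 : plane R), X (T' z) = 0 -> T' z = 0.
    by apply: (@cont_near _ _ T' 0 [set w | X w = 0 -> w = 0] (@plane_linear_cont _ T' 0)); rewrite linear0.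
  apply: filterS n0 => z h; rewrite YE => E.
  have E' : X (T' z) = 0 by rewrite -[LHS]TK E linear0.
  by rewrite -[z]T'K h// linear0.
set d := cross (T (1, 0)) (T (0, 1)).
have d0 : d != 0 := cross_linear_neq0 T'K.
have DY z : cross (T z) (Y (T z)) = d * cross z (X z) by rewrite YE TK cross_linear.
move=> u v uv Duv [a [b E]].
set w := T' (u, v); have wE : T w = (u, v) by rewrite /w T'K.
apply: (simple w.1 w.2).
- rewrite -surjective_pairing => w0; apply: uv.
  by rewrite -wE w0 -[(0, 0)]/(0 : plane R) linear0.
- have := DY w; rewrite -directional_polyE wE Duv => /esym/eqP.
  by rewrite mulf_eq0 (negbTE d0) -directional_polyE => /eqP.
- exists (d * (a * (T (1, 0)).1 + b * (T (1, 0)).2)), (d * (a * (T (0, 1)).1 + b * (T (0, 1)).2)) => x y.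
  apply: (mulfI d0); have := DY (x, y); rewrite -[cross (x, y) _]directional_polyE /= => <-.
  rewrite -directional_polyE E.
  have -> : v * (T (x, y)).1 - u * (T (x, y)).2 = d * (w.2 * x - w.1 * y).
    have -> : v * (T (x, y)).1 - u * (T (x, y)).2 = cross (T (x, y)) (T w) by rewrite wE /cross /=; ring.
    by rewrite cross_linear -/d; congr (_ * _); rewrite /cross /=; ring.
  by rewrite (plane_linearE T (x, y)) /=; ring.
Qed.

(** By homogeneity a zero can be scaled into the neighbourhood where the origin is the only one. *)
Lemma isolated_zero X z : class_V X -> X z = 0 -> z = 0.
Proof.
move=> [hX iso _] Xz; have [//|z0] := eqVneq z 0; exfalso.
have [r r0 hr] := nbhs_box iso.
pose M : R := `|z.1| + `|z.2| + 1; have M0 : 0 < M by rewrite ltr_wpDl// addr_ge0.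
pose t : R := r / (2 * M); have t0 : 0 < t by rewrite divr_gt0// mulr_gt0.
have tM : t * M < r by rewrite /t invfM mulrA mulfVK ?gt_eqF// ltr_pdivrMr// ltr_pMr// ltr1n.
have small (x : R) : `|x| <= M -> `|t * x - 0| < r.
  by move=> xM; rewrite subr0 normrM (gtr0_norm t0) (le_lt_trans _ tM)// ler_wpM2l// ltW.
have m1 : `|z.1| <= M by rewrite /M -addrA lerDl addr_ge0.
have m2 : `|z.2| <= M by rewrite /M addrAC lerDr addr_ge0.
have := hr (t * z.1, t * z.2) (small _ m1) (small _ m2).
have [a [b [c [a' [b' [c' XE]]]]]] := quadratic_fieldP hX.
have -> : X (t * z.1, t * z.2) = (t ^+ 2 * (X z).1, t ^+ 2 * (X z).2).
  by rewrite !XE /=; congr pair; ring.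
rewrite Xz /= mulr0 => /(_ erefl) [/eqP e1 /eqP e2].
move: e1; rewrite mulf_eq0 (gt_eqF t0)/= => /eqP e1.
move: e2; rewrite mulf_eq0 (gt_eqF t0)/= => /eqP e2.
by move: z0; rewrite [z]surjective_pairing e1 e2 eqxx.
Qed.

Lemma cubic_root (a b c : R) : exists t : R, t ^+ 3 + a * t ^+ 2 + b * t + c = 0.
Proof.
pose f t : R := t ^+ 3 + a * t ^+ 2 + b * t + c.
pose S : R := `|a| + `|b| + `|c|; have S0 : 0 <= S by rewrite !addr_ge0.
pose M : R := 1 + S; have M1 : 1 <= M by rewrite lerDl.
have MM : M <= M ^+ 2 by rewrite expr2 ler_peMl// (le_trans ler01).
have bound t : `|t| = M -> `|a * t ^+ 2 + b * t + c| <= M ^+ 2 * S.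
  move=> tM; apply: (le_trans (ler_normD _ _)); apply: (@le_trans _ _ (`|a| * M ^+ 2 + `|b| * M ^+ 2 + `|c| * M ^+ 2)).
    apply: lerD; last by rewrite ler_peMr// (le_trans M1).
    apply: (le_trans (ler_normD _ _)); rewrite (normrM a) (normrM b) normrX tM lerD2l.
    by rewrite ler_wpM2l.
  by rewrite le_eqVlt; apply/orP; left; apply/eqP; rewrite /S; ring.
have cube : M ^+ 3 = M ^+ 2 + M ^+ 2 * S by rewrite /M; ring.
have fM : 0 <= f M.
  have := bound M (ger0_norm (le_trans ler01 M1)); rewrite ler_norml => /andP[h _].
  by have := sqr_ge0 M; move: h cube; rewrite /f; clear; lra.
have fN : f (- M) <= 0.
  have := bound (- M); rewrite normrN (ger0_norm (le_trans ler01 M1)) => /(_ erefl); rewrite ler_norml => /andP[_ h].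
  have cN : (- M) ^+ 3 = - M ^+ 3 by ring.
  by have := sqr_ge0 M; move: h cube cN; rewrite /f; clear; lra.
have NM : - M <= M by rewrite -subr_ge0 opprK addr_ge0// (le_trans ler01).
have fc : {within `[- M, M], continuous f}.
  apply: (@within_cont_derive _ _ _ _ (fun t => 3 * t ^+ 2 + a * (2 * t) + b)) => t _.
  apply: (derive_ext (derive_add (derive_add (derive_add (derive_exp 3 (derive_var t)) (derive_mul (derive_const t a) (derive_exp 2 (derive_var t)))) (derive_mul (derive_const t b) (derive_var t))) (derive_const t c))) => //.
  by rewrite /= expr1; ring.
have [|t _ E] := IVT NM fc (v := 0); last by exists t.
by rewrite (min_idPl (le_trans fN fM)) (max_idPr (le_trans fN fM)) fN fM.
Qed.

(** If the axis [y = 0] is not characteristic, the directional polynomial has a root [(t, 1)], being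
    a cubic in [t]; the map [(x, y) |-> (y, x - t y)] sends it to [(1, 0)]. *)
Lemma characteristic_axis X : class_V X -> exists p1 p2 p3 q2 q3 : R,
  linearly_equivalent X (fun z => (p1 * z.1 ^+ 2 + p2 * z.1 * z.2 + p3 * z.2 ^+ 2,
                                   z.2 * (q2 * z.1 + q3 * z.2))).
Proof.
move=> hV; have [hX _ _] := hV.
have [p1 [p2 [p3 [q1 [q2 [q3 XE]]]]]] := quadratic_fieldP hX.
have [q10|q10] := eqVneq q1 0.
  exists p1, p2, p3, q2, q3; apply: linearly_equivalent_ext => z.
  by rewrite XE q10; congr pair; ring.
have [t tE] := cubic_root ((q2 - p1) / q1) ((q3 - p2) / q1) (- p3 / q1).
have {}tE : q1 * t ^+ 3 + (q2 - p1) * t ^+ 2 + (q3 - p2) * t - p3 = 0.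
  by rewrite -(mulr0 q1) -tE; field.
exists (q1 * t ^+ 2 + q2 * t + q3), (2 * q1 * t + q2), q1,
  (2 * p1 * t + p2 - t * (2 * q1 * t + q2)), (p1 - t * q1).
apply: (@linearly_equivalent_matrix _ _ _ 0 1 1 (- t) t 1 1 0).
- by move=> [x y] /=; congr pair; ring.
- by move=> [x y] /=; congr pair; ring.
move=> [x y]; rewrite XE /=; congr pair; first by ring.
transitivity (y ^+ 2 * (q1 * t ^+ 3 + (q2 - p1) * t ^+ 2 + (q3 - p2) * t - p3) +
  (p1 * x ^+ 2 + p2 * x * y + p3 * y ^+ 2 - t * (q1 * x ^+ 2 + q2 * x * y + q3 * y ^+ 2))); last by rewrite tE; ring.
by ring.
Qed.

Definition triple_saddle (a b : R) z : plane R :=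
  (z.1 * (a * z.1 + b * z.2), z.2 * ((a + 1) * z.1 + (b - 1) * z.2)).

(** Once [y] is split off, the sign of the discriminant of the remaining quadratic factor decides.
    Simplicity excludes discriminant 0, and also [al = 0], where [y] would be a double factor. *)
Lemma class_V_normal_form X : class_V X ->
  (exists k m, k != 0 /\ linearly_equivalent X (focus_saddle k m)) \/
  (exists a b, [/\ a != 0, b != 1, a + b != 0 & linearly_equivalent X (triple_saddle a b)]).
Proof.
move=> hV; have [p1 [p2 [p3 [q2 [q3 XY]]]]] := characteristic_axis hV.
have := class_V_linear XY hV; move: XY; set Y := fun z => _ => XY hY.
have [_ _ simple] := hY.
pose al := q2 - p1; pose be := q3 - p2; pose ga := - p3.
have DY x y : directional_poly Y x y = y * (al * x ^+ 2 + be * x * y + ga * y ^+ 2).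
  by rewrite /directional_poly /Y /= /al /be /ga; ring.
have al0 : al != 0.
  apply/eqP => al0; apply: (simple 1 0); first by move=> []; apply/eqP; rewrite oner_eq0.
    by rewrite DY mul0r.
  by exists be, ga => x y; rewrite DY al0; ring.
have p10 : p1 != 0.
  apply/eqP => p10; have : ((1, 0) : plane R) = 0.
    apply: (isolated_zero hY); rewrite /Y /= p10.
    by rewrite [RHS]surjective_pairing /=; congr pair; ring.
  by move=> [] /eqP; rewrite oner_eq0.
have [disc0|disc0|disc0] := ltrgtP (be ^+ 2 - 4 * al * ga) 0.
- left; pose ka := Num.sqrt (al * ga - be ^+ 2 / 4).
  have ka2 : ka ^+ 2 = al * ga - be ^+ 2 / 4.
    by rewrite sqr_sqrtr//; move: disc0; clear; lra.
  have ka0 : ka != 0 by rewrite gt_eqF// sqrtr_gt0; move: disc0; clear; lra.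
  exists (p1 / al), ((q3 - (p1 / al + 1) * be / 2) / ka); split.
    by rewrite mulf_neq0// invr_eq0.
  apply: (linearly_equivalent_trans XY).
  (* Completing the square: [U = al x + be y / 2] and [V = ka y] satisfy [U^2 + V^2 = al (al x^2 +
     be x y + ga y^2)]. *)
  apply: (@linearly_equivalent_matrix _ _ _ al (be / 2) 0 ka al^-1 (- be / (2 * al * ka)) 0 ka^-1).
  + by move=> [x y] /=; congr pair; field; rewrite ?ka0 ?al0.
  + by move=> [x y] /=; congr pair; field; rewrite ?ka0 ?al0.
  move=> [x y]; rewrite /focus_saddle /Y /=; congr pair; last first.
    by rewrite /al; field; rewrite -/al ka0 al0.
  have q2E : q2 = al + p1 by rewrite /al; ring.
  have q3E : q3 = be + p2 by rewrite /be; ring.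
  have p3E : p3 = - ga by rewrite /ga; ring.
  rewrite mul0r add0r (exprMn _ ka) ka2 q2E q3E p3E.
  by field; rewrite ka0 al0.
- right; pose de := Num.sqrt (be ^+ 2 - 4 * al * ga).
  have de2 : de ^+ 2 = be ^+ 2 - 4 * al * ga by rewrite sqr_sqrtr// ltW.
  have de0 : de != 0 by rewrite gt_eqF// sqrtr_gt0.
  pose r1 := (- be - de) / (2 * al); pose r2 := (- be + de) / (2 * al).
  have q2E : q2 = al + p1 by rewrite /al; ring.
  have r21 : r2 - r1 != 0.
    by rewrite (_ : r2 - r1 = de / al) ?mulf_neq0 ?invr_eq0// /r1 /r2; field.
  have q3E : q3 = p2 - al * (r1 + r2) by rewrite /r1 /r2; transitivity (p2 + be); [rewrite /be; ring|field].
  have p3E : p3 = - (al * (r1 * r2)).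
    transitivity (- ga); first by rewrite /ga opprK.
    rewrite /r1 /r2; transitivity ((de ^+ 2 - be ^+ 2) / (4 * al)); last by field.
    by rewrite de2; field.
  pose a := p1 / al; pose b := 1 + (q3 + r1 * q2) / (al * (r2 - r1)).
  have XT : linearly_equivalent X (triple_saddle a b).
    apply: (linearly_equivalent_trans XY).
    (* [U = al (x - r1 y)] and [V = al (r2 - r1) y] are chosen so that [U - V = al (x - r2 y)]: the
       three directions become [U = 0], [V = 0] and [U = V]. *)
    apply: (@linearly_equivalent_matrix _ _ _ al (- (al * r1)) 0 (al * (r2 - r1)) al^-1 (r1 / (al * (r2 - r1))) 0 (al * (r2 - r1))^-1).
    + by move=> [x y] /=; congr pair; field; rewrite ?r21 ?al0.
    + by move=> [x y] /=; congr pair; field; rewrite ?r21 ?al0.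
    move=> [x y]; rewrite /triple_saddle /Y /a /b q3E p3E q2E /=.
    by congr pair; field; rewrite ?r21 ?al0.
  have hT := class_V_linear XT hV.
  exists a, b; split => //.
  + by rewrite mulf_neq0// invr_eq0.
  + apply/eqP => b1; have : ((0, 1) : plane R) = 0.
      apply: (isolated_zero hT); rewrite /triple_saddle /= b1.
      by rewrite [RHS]surjective_pairing /=; congr pair; ring.
    by move=> [] /eqP; rewrite oner_eq0.
  + apply/eqP => ab; have : ((1, 1) : plane R) = 0.
      apply: (isolated_zero hT); rewrite /triple_saddle /=.
      rewrite [RHS]surjective_pairing /=; congr pair; rewrite !mulr1 !mul1r//.
      by rewrite addrACA subrr addr0.
    by move=> [] /eqP; rewrite oner_eq0.
- exfalso; apply: (simple (- be) (2 * al)).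
  + by move=> [_] /eqP; rewrite mulf_eq0 pnatr_eq0 (negbTE al0).
  + rewrite DY (_ : al * _ + _ + _ = - al * (be ^+ 2 - 4 * al * ga)); last by ring.
    by rewrite disc0 !mulr0.
  + exists 0, (4 * al)^-1 => x y; rewrite DY mul0r add0r.
    have gaE : ga = be ^+ 2 / (4 * al) by move/eqP: disc0; rewrite subr_eq0 => /eqP ->; field.
    by rewrite gaE; field.
Qed.

(** As [X] is even, the central symmetry changes it into its opposite. Any half-line may therefore
    be taken as ingoing, and only the signs of the characteristic values matter. *)
Lemma linearly_equivalent_opp X Y : quadratic_field X -> (forall z, Y z = - X z) ->
  linearly_equivalent X Y.
Proof.
move=> hX YE; apply: (@linearly_equivalent_matrix _ _ _ (-1) 0 0 (-1) (-1) 0 0 (-1)).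
- by move=> [x y] /=; congr pair; ring.
- by move=> [x y] /=; congr pair; ring.
have E (w : plane R) : (-1 * w.1 + 0 * w.2, 0 * w.1 + -1 * w.2) = - w.
  by rewrite [RHS]surjective_pairing; congr pair; rewrite !mulN1r !mul0r ?addr0 ?add0r.
by move=> z; rewrite !E YE (quadratic_even hX).
Qed.

Lemma triple_saddle_quadratic a b : quadratic_field (triple_saddle a b).
Proof. by split; [exists a, b, 0|exists 0, (a + 1), (b - 1)] => x y; rewrite /triple_saddle /=; ring. Qed.

Lemma focus_saddle_source (C : (R -> R) -> Prop) k m : 0 < k -> ~ regularisable C (focus_saddle k m).
Proof.
move=> k0 h; apply: (@node_not_regularisable R C (- k) (- m) 1 (- k - 1) (- m)).
- by rewrite oppr_lt0.
- by rewrite gtrDl oppr_lt0.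
apply: regularisable_linear h; apply: linearly_equivalent_opp; first exact: focus_saddle_quadratic.
have opp (x y : R) : - ((x, y) : plane R) = (- x, - y) by [].
by move=> z; rewrite /focus_saddle /node_field opp; congr pair; ring.
Qed.

(** The characteristic values are [a], [b - 1] and [- (a + b)]. A positive one is brought to the
    half-axis [x > 0] as a [node_field]; if none is, [three_saddles] applies. *)
Lemma triple_saddle_not_regularisable (C : (R -> R) -> Prop) (a b : R) : a != 0 -> b != 1 -> a + b != 0 ->
  ~ regularisable C (triple_saddle a b).
Proof.
move=> a0 b1 ab h.
have hT := triple_saddle_quadratic a b.
have opp (x y : R) : - ((x, y) : plane R) = (- x, - y) by [].
have [a_gt|a_lt|//] := ltrgtP 0 a; last by move: a0; rewrite eq_sym => /eqP.
  apply: (@node_not_regularisable R C (- a) (- b) 0 (- (a + 1)) (- (b - 1))); rewrite ?oppr_lt0//.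
    by rewrite ltrN2 ltrDl.
  apply: regularisable_linear h; apply: linearly_equivalent_opp => // z.
  by rewrite /triple_saddle /node_field opp; congr pair; ring.
have [b_gt|b_lt|//] := ltrgtP 1 b; last by move: b1; rewrite eq_sym => /eqP.
  apply: (@node_not_regularisable R C (1 - b) (- (a + 1)) 0 (- b) (- a)); rewrite ?subr_lt0//.
    by rewrite -subr_gt0 opprK subrK.
  apply: regularisable_linear h; apply: (@linearly_equivalent_matrix _ _ _ 0 (-1) (-1) 0 0 (-1) (-1) 0).
  - by move=> [x y] /=; congr pair; ring.
  - by move=> [x y] /=; congr pair; ring.
  by move=> [x y]; rewrite /triple_saddle /node_field /=; congr pair; ring.
have [ab_gt|ab_lt|//] := ltrgtP 0 (a + b); last by move: ab; rewrite eq_sym => /eqP.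
  have [N bl [f [ext _ _]]] := h.
  exact: (three_saddles a_lt b_lt ab_gt _ bl ext).
apply: (@node_not_regularisable R C (a + b) b 0 (a + b - 1) (b - 1)) => //.
  by rewrite gtrBl.
apply: regularisable_linear h; apply: (@linearly_equivalent_matrix _ _ _ 1 0 (-1) 1 1 0 1 1).
- by move=> [x y] /=; congr pair; ring.
- by move=> [x y] /=; congr pair; ring.
by move=> [x y]; rewrite /triple_saddle /node_field /=; congr pair; ring.
Qed.

Lemma focus_saddle_characteristic X k : linearly_equivalent X (focus_saddle k 0) ->
  unique (characteristic_value X) k.
Proof.
move=> [T [T' [TK T'K YE]]].
have XE z : X z = T' (focus_saddle k 0 (T z)) by rewrite YE !TK.
move: (plane_linearE T) (plane_linearE T') (cross_linear_neq0 T'K); rewrite /cross.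
have [E1 E2] : T' (T (1, 0)) = (1, 0) /\ T' (T (0, 1)) = (0, 1) by rewrite !TK.
set t11 := (T (1, 0)).1; set t21 := (T (1, 0)).2; set t12 := (T (0, 1)).1; set t22 := (T (0, 1)).2.
set s11 := (T' (1, 0)).1; set s21 := (T' (1, 0)).2; set s12 := (T' (0, 1)).1; set s22 := (T' (0, 1)).2.
pose d := t11 * t22 - t21 * t12.
move=> TE T'E; rewrite -/d => d0.
move: E1 E2; rewrite (T'E (T (1, 0))) (T'E (T (0, 1))) -/t11 -/t21 -/t12 -/t22 => -[e1 e2] [e3 e4].
have sE1 : s11 = t22 / d.
  apply: (mulIf d0); rewrite divfK// /d.
  transitivity (t22 * (t11 * s11 + t21 * s12) - t21 * (t12 * s11 + t22 * s12)); first by ring.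
  by rewrite e1 e3; ring.
have sE2 : s12 = - t12 / d.
  apply: (mulIf d0); rewrite divfK// /d.
  transitivity (t11 * (t12 * s11 + t22 * s12) - t12 * (t11 * s11 + t21 * s12)); first by ring.
  by rewrite e1 e3; ring.
have sE3 : s21 = - t21 / d.
  apply: (mulIf d0); rewrite divfK// /d.
  transitivity (t22 * (t11 * s21 + t21 * s22) - t21 * (t12 * s21 + t22 * s22)); first by ring.
  by rewrite e2 e4; ring.
have sE4 : s22 = t11 / d.
  apply: (mulIf d0); rewrite divfK// /d.
  transitivity (t11 * (t12 * s21 + t22 * s22) - t12 * (t11 * s21 + t21 * s22)); first by ring.
  by rewrite e2 e4; ring.
(* The coordinates of [T (x, y)]. In them the directional polynomial of [X] is [V (U^2 + V^2) / d],
   which singles out the line [V = 0]. *)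
pose U x y := x * t11 + y * t12; pose V x y := x * t21 + y * t22.
have XE1 x y : X (x, y) = ((t22 * (k * U x y ^+ 2 - V x y ^+ 2) - t12 * ((k + 1) * U x y * V x y)) / d,
   (- t21 * (k * U x y ^+ 2 - V x y ^+ 2) + t11 * ((k + 1) * U x y * V x y)) / d).
  rewrite XE TE T'E sE1 sE2 sE3 sE4 /focus_saddle /= -/(U x y) -/(V x y).
  by congr pair; field.
have D x y : x * (X (x, y)).2 - y * (X (x, y)).1 = V x y * (U x y ^+ 2 + V x y ^+ 2) / d.
  by rewrite XE1 /U /V /= /d; field.
have UV x y : V x y * (U x y ^+ 2 + V x y ^+ 2) / d = 0 -> (x, y) <> 0 -> V x y = 0 /\ U x y != 0.
  move=> /eqP; rewrite !mulf_eq0 invr_eq0 (negbTE d0) orbF => h xy.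
  have nz : ~ (U x y = 0 /\ V x y = 0).
    move=> [u0 v0]; apply: xy; have : T (x, y) = 0 by rewrite TE -/(U x y) -/(V x y) u0 v0.
    by move=> /(congr1 T'); rewrite TK linear0.
  have V0 : V x y = 0.
    case/orP: h => /eqP // h2; apply/eqP; rewrite -sqrf_eq0 eq_le sqr_ge0 andbT.
    by rewrite -h2 lerDr sqr_ge0.
  by split=> //; apply/eqP => u0; apply: nz.
have dU x y : is_derive y (1 : R) (U x) t12.
  by apply: (derive_ext (derive_add (derive_const y (x * t11)) (derive_mul (derive_var y) (derive_const y t12)))) => //; ring.
have dV x y : is_derive y (1 : R) (V x) t22.
  by apply: (derive_ext (derive_add (derive_const y (x * t21)) (derive_mul (derive_var y) (derive_const y t22)))) => //; ring.
have dU' x y : is_derive x (1 : R) (U^~ y) t11.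
  by apply: (derive_ext (derive_add (derive_mul (derive_var x) (derive_const x t11)) (derive_const x (y * t12)))) => //; ring.
have dV' x y : is_derive x (1 : R) (V^~ y) t21.
  by apply: (derive_ext (derive_add (derive_mul (derive_var x) (derive_const x t21)) (derive_const x (y * t22)))) => //; ring.
pose p t := (X (1, t)).2 - t * (X (1, t)).1; pose q t := (X (t, 1)).1 - t * (X (t, 1)).2.
have pE t : p t = V 1 t * (U 1 t ^+ 2 + V 1 t ^+ 2) / d by rewrite /p -D mul1r.
have qE t : q t = - (V t 1 * (U t 1 ^+ 2 + V t 1 ^+ 2) / d) by rewrite /q -D mul1r opprB.
have first y : p y = 0 -> (X (1, y)).1 / derive1 p y = k.
  rewrite pE => /UV[|V0 U0]; first by move=> [] /eqP; rewrite oner_eq0.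
  have dp : is_derive y (1 : R) p (t22 * U 1 y ^+ 2 / d).
    apply: (derive_ext (derive_mul (derive_mul (dV 1 y) (derive_add (derive_exp 2 (dU 1 y)) (derive_exp 2 (dV 1 y)))) (derive_const y d^-1))).
      by move=> t; rewrite pE.
    by rewrite V0; ring.
  rewrite derive1E (derive_val (is_derive := dp)) XE1 /= V0.
  have t220 : t22 != 0.
    apply/eqP => t0; move: V0; rewrite /V t0 mulr0 addr0 mul1r => t1.
    by move: d0; rewrite /d t0 t1 mulr0 mul0r subrr eqxx.
  by field; rewrite d0 t220 U0.
have second : q 0 = 0 -> (X (0, 1)).2 / derive1 q 0 = k.
  rewrite qE => /eqP; rewrite oppr_eq0 => /eqP /UV[|V0 U0]; first by move=> [] /eqP; rewrite oner_eq0.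
  have dq : is_derive 0 (1 : R) q (- (t21 * U 0 1 ^+ 2 / d)).
    apply: (derive_ext (derive_opp (derive_mul (derive_mul (dV' 0 1) (derive_add (derive_exp 2 (dU' 0 1)) (derive_exp 2 (dV' 0 1)))) (derive_const 0 d^-1)))).
      by move=> t; rewrite qE.
    by rewrite V0; ring.
  rewrite derive1E (derive_val (is_derive := dq)) XE1 /= V0.
  have t210 : t21 != 0.
    apply/eqP => t0; move: V0; rewrite /V t0 mulr0 add0r mul1r => t1.
    by move: d0; rewrite /d t0 t1 mulr0 mul0r subrr eqxx.
  by field; rewrite d0 t210 U0.
split; last first.
  by move=> k' [[y [/first h ->]]|[/second h ->]].
(* [t22 = 0] means that the line [V = 0] is vertical, the case left to the second blow-up chart. *)
have [t0|t0] := eqVneq t22 0.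
  right; have q0 : q 0 = 0.
    by rewrite qE /V t0 mulr0 mul0r addr0 !mul0r oppr0.
  by split=> //; rewrite second.
left; have p0 : p (- t21 / t22) = 0.
  have V0 : V 1 (- t21 / t22) = 0 by rewrite /V; field.
  by rewrite pE V0 !mul0r.
by exists (- t21 / t22); split=> //; rewrite first.
Qed.

End Classification.

Theorem proposition6p4 (R : realType) (X : plane R -> plane R) (hX : class_V X) :
  (regularisable smooth_germ X <->
   exists k : R,
     [/\ k < 0,
         unique (characteristic_value X) k
       & linearly_equivalent X
           (fun z => (k * z.1 ^+ 2 - z.2 ^+ 2, (k + 1) * z.1 * z.2))]) /\
  (forall k1 k2 : R, k1 < 0 -> k2 <> 0 ->
   linearly_equivalent X
     (fun z => (k1 * z.1 ^+ 2 + k2 * z.1 * z.2 - z.2 ^+ 2,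
                (k1 + 1) * z.1 * z.2 + k2 * z.2 ^+ 2)) ->
   regularisable lipschitz_germ X).
Proof.
have canon (k : R) : linearly_equivalent (focus_saddle k 0)
    (fun z => (k * z.1 ^+ 2 - z.2 ^+ 2, (k + 1) * z.1 * z.2)).
  by apply: linearly_equivalent_ext => z; rewrite /focus_saddle !mul0r !addr0.
split; last first.
  move=> k1 k2 k10 _ /linearly_equivalent_sym h; apply: (regularisable_linear h).
  (* The value [b = - k2 / k1] makes the coefficient [- (k1 * b)] equal to [k2]. *)
  have := focus_saddle_regularisable k10 (opposite_tan_lipschitz (- k2 / k1)).
  by have -> : - (k1 * (- k2 / k1)) = k2 by field; rewrite lt_eqF.
split=> [reg|[k [k0 _ /linearly_equivalent_sym h]]]; last first.
  apply: (regularisable_linear h); apply: (regularisable_linear (canon k)).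
  have -> : (0 : R) = - (k * 0) by rewrite mulr0 oppr0.
  by apply: focus_saddle_regularisable => //; exact: opposite_tan_smooth.
have [[k [m [k0 h]]]|[a [b [a0 b1 ab h]]]] := class_V_normal_form hX; last first.
  by have := triple_saddle_not_regularisable a0 b1 ab (regularisable_linear h reg).
have reg' := regularisable_linear h reg.
have k_lt : k < 0.
  by move: k0; rewrite neq_lt => /orP[//|k_gt]; have := focus_saddle_source k_gt reg'.
have [N bl [f [ext _ germ]]] := reg'.
have m0 := focus_saddle_smooth k_lt bl ext germ.
rewrite m0 in h; exists k; split => //; first exact: focus_saddle_characteristic.
exact: linearly_equivalent_trans h (canon k).
Qed.
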